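(* Let $\lambda_1,\lambda_2,\lambda_3\in\mathbb{D}^2$ and $w_1,w_2,w_3\in\mathbb{C}$ be the data of an extremal non-degenerate three point Pick problem on the bidisk, meaning that there is a function $\phi$ such that: (a) $\phi$ is an extremal solution to the Pick problem of interpolating $\lambda_i$ to $w_i$, $i=1,2,3$; (b) $\phi$ is not an extremal solution to any of the three two point Pick problems mapping two of the $\lambda_i$'s to the corresponding $w_i$'s; (c) the three point problem is non-degenerate. Then the solution to the three point problem is unique. The solution is given by a rational inner function of degree $2$. There is a formula for the solution in terms of two uniquely determined rank one matrices (namely the two members $\Gamma$ and $\Delta$ of a permissible pair for the problem).
   Context: $\mathbb{D}$ is the open unit disk in $\mathbb{C}$, and $H^\infty(\mathbb{D}^2)$ is the space of bounded analytic functions on the bidisk $\mathbb{D}^2$ with the supremum norm. Superscripts denote coordinates of a point of $\mathbb{D}^2$: $\lambda=(\lambda^1,\lambda^2)$ (they are not powers). The $N$ point Pick problem on the bidisk with data $\lambda_1,\dots,\lambda_N\in\mathbb{D}^2$ and $w_1,\dots,w_N\in\mathbb{C}$ is to find $\phi\in H^\infty(\mathbb{D}^2)$ with $\phi(\lambda_i)=w_i$ for $i=1,\dots,N$ and $\|\phi\|_{H^\infty(\mathbb{D}^2)}\le 1$; such a $\phi$ is called a solution. A solution $\phi$ is an extremal solution if $\|\phi\|=1$ and no solution has a smaller norm. Given the data, define the $N\times N$ matrices $$W=(1-\bar w_i w_j)_{i,j=1}^N,\qquad \Lambda^1=(1-\bar\lambda_i^1\lambda_j^1)_{i,j=1}^N,\qquad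 \Lambda^2=(1-\bar\lambda_i^2\lambda_j^2)_{i,j=1}^N .$$ Let $\cdot$ denote the Schur (entrywise) product, $(A\cdot B)_{ij}=A_{ij}B_{ij}$. A pair $\Gamma,\Delta$ of positive semi-definite $N\times N$ matrices is called permissible if $W=\Lambda^1\cdot\Gamma+\Lambda^2\cdot\Delta$. The problem is degenerate if there is a permissible pair one of whose members is $0$; otherwise it is non-degenerate. Here $N=3$. A function on $\mathbb{D}^2$ is inner if it is bounded and analytic and its boundary values have modulus $1$ almost everywhere on the distinguished boundary (the torus). *)

(* Defs.v *)
From HB Require Import structures.
From mathcomp Require Import all_boot all_order all_algebra.
(* The notations of mpoly clash with those of mathcomp-analysis. *)
From mathcomp Require Import -(notations) mpoly.
From mathcomp Require Import all_classical all_reals all_analysis.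
From mathcomp Require Import complex.

Set Implicit Arguments.
Unset Strict Implicit.
Unset Printing Implicit Defensive.

Import Order.TTheory GRing.Theory Num.Theory.
Import numFieldNormedType.Exports.

Local Open Scope classical_set_scope.
Local Open Scope ring_scope.
Local Open Scope sesquilinear_scope.

(* The norm [`|z|] of [z : R[i]] is itself a (real) element of [R[i]]. *)
Definition modulus (R : realType) (z : R[i]) : R := complex.Re `|z|.

Section Bidisk.
Variable R : realType.
Local Notation C := R[i].
Implicit Types (phi : C * C -> C) (z : C * C).

Definition bidisk : set (C * C) := [set z | `|z.1| < 1 /\ `|z.2| < 1].

(* Functions on the bidisk are represented by total functions on C^2 whose
   values outside the bidisk are ignored. The scalar field of [C^o * C^o] is C,
   so [differentiable] means complex differentiable in the sense of Frechet. *)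
Definition Hinfty phi : Prop :=
  (forall z, bidisk z ->
     differentiable (phi : C^o * C^o -> C^o) (z : C^o * C^o)) /\
  (exists M : R, forall z, bidisk z -> modulus (phi z) <= M).

Definition Hinfty_norm phi : R := sup [set modulus (phi z) | z in bidisk].

Definition psd N (A : 'M[C]_N) : Prop :=
  A \is hermsymmx /\ forall x : 'cV[C]_N, 0 <= (x ^t* *m A *m x) 0 0.

Definition schur N (A B : 'M[C]_N) : 'M[C]_N := map2_mx *%R A B.

Section PickProblem.
Variable N : nat.
Variables (lam : 'I_N -> C * C) (w : 'I_N -> C).

Definition Pick_solution phi : Prop :=
  [/\ Hinfty phi, (forall i, phi (lam i) = w i) & Hinfty_norm phi <= 1].

Definition extremal_solution phi : Prop :=
  [/\ Pick_solution phi, Hinfty_norm phi = 1 &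
      ~ exists psi, Pick_solution psi /\ Hinfty_norm psi < Hinfty_norm phi].

Definition Wmx : 'M[C]_N := \matrix_(i, j) (1 - (w i)^* * w j).
Definition Lambda1 : 'M[C]_N := \matrix_(i, j) (1 - (lam i).1^* * (lam j).1).
Definition Lambda2 : 'M[C]_N := \matrix_(i, j) (1 - (lam i).2^* * (lam j).2).

Definition permissible (G D : 'M[C]_N) : Prop :=
  [/\ psd G, psd D & Wmx = schur Lambda1 G + schur Lambda2 D].

Definition degenerate : Prop :=
  exists G D, permissible G D /\ (G = 0 \/ D = 0).

(* If G = a^* a and D = b^* b (rank one, a and b row vectors), the identity
   W = Lambda1 . G + Lambda2 . D says that the vectors
   (1, lam_j^1 a_j, lam_j^2 b_j) and (w_j, a_j, b_j) have the same Gram matrix,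
   so that some unitary U maps the former to the latter for every j. *)
Definition colligation (a b : 'rV[C]_N) (U : 'M[C]_(1 + (1 + 1))) : Prop :=
  U \is unitarymx /\
  U *m col_mx (const_mx 1 : 'rV[C]_N)
         (col_mx (\row_j ((lam j).1 * a 0 j)) (\row_j ((lam j).2 * b 0 j)))
  = col_mx (\row_j w j) (col_mx a b).

(* The transfer function A + B E(z) (1 - Q E(z))^-1 P of the block matrix
   U = [A B; P Q], where E(z) = diag(z^1, z^2). *)
Definition transfer (U : 'M[C]_(1 + (1 + 1))) z : C :=
  let E : 'M[C]_(1 + 1) := block_mx z.1%:M 0 0 z.2%:M in
  (ulsubmx U +
   ursubmx U *m E *m invmx (1%:M - drsubmx U *m E) *m dlsubmx U) 0 0.

(* The formula for phi: its value on the bidisk depends only on G and D, and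
   not on the choice of a, b and U. *)
Definition given_by (G D : 'M[C]_N) phi : Prop :=
  (exists a b : 'rV[C]_N, G = a ^t* *m a /\ D = b ^t* *m b) /\
  forall a b : 'rV[C]_N, G = a ^t* *m a -> D = b ^t* *m b ->
    (exists U, colligation a b U) /\
    (forall U, colligation a b U ->
       forall z, bidisk z -> phi z = transfer U z).

End PickProblem.

(* [fun i => lam (lift k i)] is the family lam with its k-th member omitted. *)
Definition extremal_nondegenerate
    (lam : 'I_3 -> C * C) (w : 'I_3 -> C) : Prop :=
  exists phi,
    [/\ extremal_solution lam w phi,
        forall k : 'I_3,
          ~ extremal_solution (fun i : 'I_2 => lam (lift k i))
                              (fun i : 'I_2 => w (lift k i)) phi
      & ~ degenerate lam w].

Definition torus_pt (t : R) : C := (cos t +i* sin t)%C.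

(* The boundary values of a function in H^oo are its radial limits. *)
Definition inner_function phi : Prop :=
  Hinfty phi /\
  {ae (lebesgue_measure \x lebesgue_measure)%E, forall st : R * R,
     st.1 \in `[0, 2 * pi] -> st.2 \in `[0, 2 * pi] ->
     exists l : C, modulus l = 1 /\
       phi (r%:C%C * torus_pt st.1, r%:C%C * torus_pt st.2)
         @[r --> (1 : R)^'-] --> (l : C^o)}.

Definition poly_degree (p : mpoly 2 C) : nat := (mmeasure mdeg p).-1.

Definition poly_eval (p : mpoly 2 C) z : C :=
  meval (fun i : 'I_2 => if i == 0 then z.1 else z.2) p.

Definition poly_coprime (p q : mpoly 2 C) : Prop :=
  forall d u v : mpoly 2 C, p = d * u -> q = d * v -> poly_degree d = 0%N.

(* The degree of a rational function is the larger of the total degrees of its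
   numerator and denominator in lowest terms. *)
Definition rational_of_degree phi (n : nat) : Prop :=
  exists p q : mpoly 2 C,
    [/\ poly_coprime p q, maxn (poly_degree p) (poly_degree q) = n &
        forall z, bidisk z ->
          poly_eval q z != 0 /\ phi z = poly_eval p z / poly_eval q z].

End Bidisk.

(* Main.v *)
(** Agler's theorem on the bidisk in N points drives everything. Call K
admissible if K . Lambda1 and K . Lambda2 are positive semidefinite. A polynomial
f bounded by 1 on the torus satisfies
sum K_ij conj(f(lam_i)) f(lam_j) <= sum K_ij: multiplication by the two
coordinates gives commuting contractions for the form K, and Ando's dilation turns
them into commuting isometries, for which von Neumann's inequality follows from
Parseval's identity on roots of unity. Approximating a solution on smaller bidisks
by polynomials (its Taylor coefficients are limits of averages over roots of unity,
independent of the radius by Goursat's subdivision argument), one sees that every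
admissible K pairs nonnegatively with W, and separating W from the cone of all
Lambda1 . Gamma + Lambda2 . Delta yields a permissible pair; conversely a
permissible pair yields a solution as the transfer function of a unitary matrix.

By extremality and compactness some admissible K <> 0 annihilates W. For three
points and a non-degenerate problem, K . Lambda1 and K . Lambda2 have rank 2 and
annihilate Gamma and Delta, which therefore have rank one; averaging two
permissible pairs shows that the pair is unique. Given a solution psi and a point
z of the bidisk, a permissible pair for the nodes lam_1, lam_2, lam_3, z must
extend the unique one, which forces psi z to be the value at z of the transfer
function of the 3 x 3 unitary matrix built from Gamma and Delta. That function
is a quotient p / q with p and q affine in each variable and |p| = |q| on the
torus. It has degree 2 because otherwise it would depend on one variable only and
the problem would be degenerate; it is inner because q vanishes on the torus only
on a null set. *)

Require Import Defs.
From HB Require Import structures.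
From mathcomp Require Import all_boot all_order all_algebra.
From mathcomp Require Import -(notations) mpoly.
From mathcomp Require Import all_classical all_reals all_analysis.
From mathcomp Require Import measurable_realfun complex.
From mathcomp Require Import ring lra zify.

Set Implicit Arguments.
Unset Strict Implicit.
Unset Printing Implicit Defensive.

Import Order.TTheory GRing.Theory Num.Theory.
Import numFieldNormedType.Exports.

Local Open Scope classical_set_scope.
Local Open Scope ring_scope.
Local Open Scope sesquilinear_scope.

(** Condition (b) makes the nodes distinct and forbids zero rows of K: a zero row would leave a
    functional annihilating W for two of the points, where a solution of norm less than 1 exists.
    With distinct nodes an admissible K that kills a vector without zero entries is 0, since its
    kernel is invariant under both coordinates; this is used twice, to see that K does not
    annihilate the all-ones matrix and that two rows of K carry different values of w. The rank of K
    . Lambda1 exceeds 1 because rank one, with no zero row, would make Lambda2 / Lambda1 positive,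
    so that Delta could be absorbed into Gamma. The delicate point of uniqueness is that the 3 x 3
    unitary is determined by its values at the three vectors (1, lam^1 a, lam^2 b) only if these are
    independent. A dependence puts a and lam^1 a into the span of 1 and w and makes Lambda1 . Gamma
    a multiple of W, contrary to non-degeneracy. On the analytic side no integral is formed: sums
    over 2^n-th roots of unity, which subdivide exactly, replace contour integrals, and an
    ultrafilter supplies limits before convergence is known. *)

(** * Conjugate transposes and unitary extensions *)

Section Adjoint.
Variable C : numClosedFieldType.

Lemma adjmxE m n (A : 'M[C]_(m, n)) i j : (A ^t*) i j = (A j i)^*.
Proof. by rewrite !mxE. Qed.

Lemma adjmxK m n (A : 'M[C]_(m, n)) : A ^t* ^t* = A.
Proof. exact: trmxCK. Qed.

Lemma adjmxM m n p (A : 'M[C]_(m, n)) (B : 'M[C]_(n, p)) :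
  (A *m B) ^t* = B ^t* *m A ^t*.
Proof. by rewrite trmx_mul map_mxM. Qed.

Lemma adjmxD m n (A B : 'M[C]_(m, n)) : (A + B) ^t* = A ^t* + B ^t*.
Proof. by rewrite linearD /= map_mxD. Qed.

Lemma adjmxB m n (A B : 'M[C]_(m, n)) : (A - B) ^t* = A ^t* - B ^t*.
Proof. by rewrite linearB /= map_mxB. Qed.

Lemma adjmxZ m n a (A : 'M[C]_(m, n)) : (a *: A) ^t* = a^* *: A ^t*.
Proof. by rewrite linearZ /= map_mxZ. Qed.

Lemma adjmx1 n : (1%:M : 'M[C]_n) ^t* = 1%:M.
Proof. by rewrite trmx1 map_mx1. Qed.

Lemma adjmx0 m n : (0 : 'M[C]_(m, n)) ^t* = 0.
Proof. by rewrite trmx0 map_mx0. Qed.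

Lemma adjmx_col m1 m2 n (A : 'M[C]_(m1, n)) (B : 'M[C]_(m2, n)) :
  (col_mx A B) ^t* = row_mx (A ^t*) (B ^t*).
Proof. by rewrite tr_col_mx map_row_mx. Qed.

Lemma hermsymmx_adj n (A : 'M[C]_n) : (A \is hermsymmx) = (A == A ^t*).
Proof. by rewrite qualifE /= expr0 scale1r. Qed.

Lemma mulmx_col m n p (A : 'M[C]_(m, n)) (B : 'M[C]_(n, p)) j :
  A *m col j B = col j (A *m B).
Proof. by rewrite !colE mulmxA. Qed.

Lemma sqnormE n (x : 'cV[C]_n) : (x ^t* *m x) 0 0 = \sum_i `|x i 0| ^+ 2.
Proof.
rewrite mxE; apply: eq_bigr => i _; rewrite !mxE normCK mulrC //.
Qed.

Lemma sqnorm_ge0 n (x : 'cV[C]_n) : 0 <= (x ^t* *m x) 0 0.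
Proof. by rewrite sqnormE sumr_ge0 // => i _; rewrite exprn_ge0. Qed.

Lemma sqnorm_eq0 n (x : 'cV[C]_n) : (x ^t* *m x) 0 0 = 0 -> x = 0.
Proof.
rewrite sqnormE => /eqP; rewrite psumr_eq0; last first.
  by move=> i _; rewrite exprn_ge0.
move=> /allP h; apply/colP => i; have := h i (mem_index_enum _).
by rewrite sqrf_eq0 normr_eq0 => /eqP ->; rewrite mxE.
Qed.

Lemma mulmx_adj_unitary n (U : 'M[C]_n) : U \is unitarymx -> U ^t* *m U = 1%:M.
Proof.
by move=> hU; rewrite -(invmx_unitary hU) mulVmx // unitarymx_unit.
Qed.

(* The columns are matched one at a time: if [U X] and [Y] agree outside the
   column [k], the reflection [1 - v v^* / (v^* x)] along the difference
   [v = x - y] of their columns [k] maps [x] to [y], is unitary because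
   [|x| = |y|], and fixes every common column. *)
Lemma unitary_extension m n (X Y : 'M[C]_(m, n)) :
  X ^t* *m X = Y ^t* *m Y -> exists2 U : 'M[C]_m, U \is unitarymx & U *m X = Y.
Proof.
move=> XY.
suff: forall k : nat, (k <= n)%N -> exists2 U : 'M[C]_m, U \is unitarymx &
    forall j : 'I_n, (j < k)%N -> U *m col j X = col j Y.
  case/(_ n (leqnn n)) => U Uu hU; exists U => //.
  apply/matrixP => i j; have /colP/(_ i) := hU j (ltn_ord j).
  by rewrite mulmx_col !mxE.
elim=> [|k IH] hk.
  by exists 1%:M; rewrite ?unitarymx1 //; apply/unitarymxP; rewrite adjmx1 mulmx1.
have [U Uu hU] := IH (ltnW hk).
pose jk := Ordinal hk.
pose x := U *m col jk X; pose y := col jk Y; pose v := x - y.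
have gram i j : (U *m col i X) ^t* *m (U *m col j X) = (col i Y) ^t* *m col j Y.
  rewrite adjmxM -mulmxA (mulmxA (U ^t*)) mulmx_adj_unitary // mul1mx.
  apply/matrixP => a b; rewrite !ord1.
  have /matrixP/(_ i j) := XY; rewrite !mxE.
  under eq_bigr do rewrite !mxE; under [in X in _ = X -> _]eq_bigr do rewrite !mxE.
  move=> e; transitivity (\sum_i0 (X i0 i)^* * X i0 j).
    by apply: eq_bigr => l _; rewrite !mxE.
  by rewrite e; apply: eq_bigr => l _; rewrite !mxE.
pose a : C := (v ^t* *m x) 0 0.
(* Because x and y have the same norm, |v|^2 is twice the real part of [a]. This makes [H] unitary,
   and it gives v = 0 when [a] = 0, in which case [U] already works. *)
have vv : (v ^t* *m v) 0 0 = a + a^*.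
  have -> : a^* = (x ^t* *m v) 0 0.
    rewrite /a -[in LHS](adjmxE (v ^t* *m x)) adjmxM adjmxK //.
  have subE (A B : 'M[C]_1) : (A - B) 0 0 = A 0 0 - B 0 0 by rewrite !mxE.
  have /matrixP/(_ 0 0) := gram jk jk; rewrite -/x -/y => xxyy.
  rewrite /a /v adjmxB !(mulmxBl, mulmxBr) !subE xxyy; ring.
pose H := 1%:M - a^-1 *: (v *m v ^t*).
have [a0|a0] := eqVneq a 0.
  have v0 : v = 0 by apply: sqnorm_eq0; rewrite vv a0 rmorph0 addr0.
  exists U => // j; rewrite ltnS leq_eqVlt => /orP[/eqP jE|]; last exact: hU.
  have -> : j = jk by apply: val_inj.
  by apply/eqP; rewrite -subr_eq0; apply/eqP.
have Hu : H \is unitarymx.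
  apply/unitarymxP; rewrite /H (adjmxB 1%:M) adjmxZ (adjmxM v) adjmxK adjmx1.
  rewrite mulmxBl mulmxBr !mul1mx mulmxBr mulmx1.
  rewrite -scalemxAl -scalemxAr scalerA mulmxA -(mulmxA v).
  rewrite [v ^t* *m v]mx11_scalar vv mul_mx_scalar -scalemxAl scalerA.
  rewrite fmorphV.
  have -> : a^-1 / a^* * (a + a^*) = a^-1 + (a^*)^-1.
    have : a^* != 0 by rewrite fmorph_eq0.
    by move=> ?; field; apply/andP.
  by rewrite scalerDl; apply/matrixP => i j; rewrite !mxE; ring.
have Hx : H *m x = y.
  rewrite /H mulmxBl mul1mx -scalemxAl -mulmxA [v ^t* *m x]mx11_scalar.
  by rewrite mul_mx_scalar scalerA mulVf // scale1r /v opprB addrC subrK.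
have Hfix (j : 'I_n) : (j < k)%N -> H *m col j Y = col j Y.
  move=> jk'; rewrite /H mulmxBl mul1mx -scalemxAl -mulmxA.
  suff -> : v ^t* *m col j Y = 0 by rewrite mulmx0 scaler0 subr0.
  by rewrite /v adjmxB mulmxBl -{1}(hU _ jk') gram subrr.
exists (H *m U) => [|j]; first by rewrite mul_unitarymx.
rewrite ltnS leq_eqVlt -mulmxA => /orP[/eqP jE|jk'].
  by have -> : j = jk by apply: val_inj.
by rewrite hU // Hfix.
Qed.
End Adjoint.

(** * Positive semidefinite matrices *)

Section Psd.
Variable R : realType.
Local Notation C := R[i].

Lemma mulmx3E m n (x : 'cV[C]_m) (A : 'M[C]_(m, n)) (y : 'cV[C]_n) :
  (x ^t* *m A *m y) 0 0 = \sum_i \sum_j (x i 0)^* * A i j * y j 0.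
Proof.
rewrite mxE exchange_big /=; apply: eq_bigr => j _.
by rewrite mxE mulr_suml; apply: eq_bigr => i _; rewrite !mxE.
Qed.

Lemma psd_sym N (A : 'M[C]_N) i j : psd A -> A i j = (A j i)^*.
Proof.
by case; rewrite hermsymmx_adj => /eqP/matrixP/(_ i j) -> _; rewrite adjmxE.
Qed.

Lemma psd_gram m N (X : 'M[C]_(m, N)) : psd (X ^t* *m X).
Proof.
split; first by rewrite hermsymmx_adj adjmxM adjmxK.
by move=> x; rewrite mulmxA -adjmxM -mulmxA sqnorm_ge0.
Qed.

(** Unitary diagonalization: the eigenvalues are values of the form at eigenvectors, hence
    nonnegative, and [S] carries their square roots. *)
Lemma psd_factor N (A : 'M[C]_N) : psd A -> exists X : 'M[C]_N, A = X ^t* *m X.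
Proof.
case=> hA pA; have := hermitian_normalmx hA.
move=> /orthomx_spectralP; set P := spectralmx A; set d := spectral_diag A => AE.
have Pu : P \is unitarymx by exact: spectral_unitarymx.
rewrite invmx_unitary // in AE.
have d0 i : 0 <= d 0 i.
  have := pA (P ^t* *m delta_mx i 0).
  rewrite AE adjmxM adjmxK !mulmxA mulmxtVK // -!mulmxA (mulmxA P).
  have /unitarymxP -> := Pu; rewrite mul1mx mulmxA.
  rewrite mulmx3E (bigD1 i) //= (bigD1 i) //= !big1 ?addr0; last 2 first.
  - move=> k ki; rewrite big1 // => l _; rewrite !mxE (negPf ki) /=.
    by rewrite ?mulr0n rmorph0 !mul0r.
  - by move=> k ki; rewrite !mxE (negPf ki) /= ?mulr0n mulr0.
  by rewrite !mxE !eqxx /= ?mulr1n rmorph1 mul1r mulr1.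
clearbody P d; pose S := diag_mx (\row_i sqrtC (d 0 i)).
suff dE : diag_mx d = S ^t* *m S by exists (S *m P); rewrite AE dE adjmxM !mulmxA.
apply/matrixP => i j; rewrite [RHS]mxE (bigD1 i) //= big1 ?addr0; last first.
  by move=> k ki; rewrite !mxE (negPf ki) ?mulr0n rmorph0 mul0r.
rewrite !mxE eqxx mulr1n; case: eqP => [->|_]; last by rewrite mulr0n mulr0.
rewrite !mulr1n conj_Creal ?ger0_real ?sqrtC_ge0 //.
by rewrite -expr2 sqrtCK.
Qed.

Lemma psd_null N (A : 'M[C]_N) (x : 'cV[C]_N) :
  psd A -> (x ^t* *m A *m x) 0 0 = 0 -> A *m x = 0.
Proof.
move=> /psd_factor[X ->]; rewrite mulmxA -adjmxM -mulmxA => /sqnorm_eq0 Xx.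
by rewrite -mulmxA Xx mulmx0.
Qed.

Lemma psd0 N : psd (0 : 'M[C]_N).
Proof. by have := psd_gram (0 : 'M[C]_N); rewrite mulmx0. Qed.

Lemma psdD N (A B : 'M[C]_N) : psd A -> psd B -> psd (A + B).
Proof.
move=> [hA pA] [hB pB]; split.
  by move: hA hB; rewrite !hermsymmx_adj adjmxD => /eqP <- /eqP <-.
by move=> x; rewrite mulmxDr mulmxDl mxE addr_ge0.
Qed.

Lemma psdZ N (a : C) (A : 'M[C]_N) : 0 <= a -> psd A -> psd (a *: A).
Proof.
move=> a0 [hA pA]; split.
  move: hA; rewrite !hermsymmx_adj adjmxZ => /eqP <-.
  by rewrite conj_Creal ?ger0_real.
by move=> x; rewrite -scalemxAr -scalemxAl mxE mulr_ge0.
Qed.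

Lemma psd_congr m N (A : 'M[C]_N) (B : 'M[C]_(N, m)) :
  psd A -> psd (B ^t* *m A *m B).
Proof.
by move=> /psd_factor[X ->]; rewrite mulmxA -adjmxM -mulmxA; exact: psd_gram.
Qed.

(** With B = Y^* Y, the form of the Schur product at x is the sum over the rows k of Y of the form
    of A at the vector with entries Y_ki x_i. *)
Lemma psd_schur N (A B : 'M[C]_N) : psd A -> psd B -> psd (schur A B).
Proof.
move=> pA pB; split.
  rewrite hermsymmx_adj; apply/eqP/matrixP => i j.
  by rewrite adjmxE !mxE rmorphM /= -(psd_sym i j pA) -(psd_sym i j pB).
move=> x; have [Y ->] := psd_factor pB.
rewrite mulmx3E.
have -> : \sum_i \sum_j (x i 0)^* * schur A (Y ^t* *m Y) i j * x j 0 =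
    \sum_k (((\col_i (Y k i * x i 0)) ^t* *m A *m \col_i (Y k i * x i 0)) 0 0).
  under [RHS]eq_bigr do rewrite mulmx3E.
  rewrite [RHS]exchange_big /=; apply: eq_bigr => i _.
  rewrite [RHS]exchange_big /=; apply: eq_bigr => j _.
  rewrite !mxE mulr_sumr mulr_sumr mulr_suml; apply: eq_bigr => k _.
  by rewrite !mxE rmorphM; ring.
by apply: sumr_ge0 => k _; case: pA.
Qed.

Lemma psd_diag_ge0 N (A : 'M[C]_N) i : psd A -> 0 <= A i i.
Proof.
move=> /psd_factor[X ->]; rewrite mxE sumr_ge0 // => j _.
by rewrite !mxE mulrC -normCK exprn_ge0.
Qed.

Lemma psd_diag_eq0 N (A : 'M[C]_N) i j : psd A -> A i i = 0 -> A i j = 0.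
Proof.
move=> pA Ai; have : A *m delta_mx i 0 = 0 :> 'cV_N.
  apply: psd_null => //; rewrite mulmx3E (bigD1 i) //= (bigD1 i) //= !big1.
  - by rewrite !mxE !eqxx Ai; ring.
  - by move=> k ki; rewrite big1 // => l _; rewrite !mxE (negPf ki) ?mulr0n rmorph0 !mul0r.
  - by move=> k ki; rewrite !mxE (negPf ki) ?mulr0n mulr0.
by rewrite -colE => /colP/(_ j); rewrite !mxE (psd_sym _ _ pA) => ->; rewrite rmorph0.
Qed.

Lemma psd_eq0 N (A : 'M[C]_N) : psd A -> (forall i, A i i = 0) -> A = 0.
Proof.
by move=> pA A0; apply/matrixP => i j; rewrite mxE; exact: psd_diag_eq0.
Qed.

Lemma rank1_factor m n (A : 'M[C]_(m, n)) : (\rank A <= 1)%N ->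
  exists (c : 'cV[C]_m) (r : 'rV[C]_n), A = c *m r.
Proof.
move=> rA; have := mulmx_base A.
move: (col_base A) (row_base A); case: (\rank A) rA => [|[|//]] _ c r <-.
  by exists 0, 0; rewrite mulmx0 (flatmx0 r) mulmx0.
by exists c, r.
Qed.

(** A nonzero positive matrix has a diagonal entry A_kk > 0. Row k divided by the square root of
    A_kk works because the 2 x 2 minors vanish. *)
Lemma psd_rank1 N (A : 'M[C]_N) : psd A -> (\rank A <= 1)%N ->
  exists u : 'rV[C]_N, A = u ^t* *m u.
Proof.
move=> pA rA; have [A0|An0] := EM (forall i, A i i = 0).
  by exists 0; rewrite mulmx0; exact: psd_eq0.
have [k /eqP Ak] : exists k, A k k <> 0 by apply/existsNP.
have [c [r AE]] := rank1_factor rA.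
have Aij i j : A i j = c i 0 * r 0 j.
  by rewrite AE mxE big_ord1.
have Akk : 0 <= A k k by exact: psd_diag_ge0.
exists (\row_j (A k j / sqrtC (A k k))).
apply/matrixP => i j; rewrite mxE big_ord1 !mxE rmorphM fmorphV /=.
rewrite -psd_sym // (conj_Creal (x := sqrtC _)) ?ger0_real ?sqrtC_ge0 //.
have s2 : sqrtC (A k k) * sqrtC (A k k) = A k k by rewrite -expr2 sqrtCK.
have -> : A i k / sqrtC (A k k) * (A k j / sqrtC (A k k)) =
    A i k * A k j / A k k.
  by rewrite -[in RHS]s2 invfM; ring.
rewrite !Aij in Ak *; move: Ak; rewrite mulf_eq0 negb_or => /andP[ck rk].
by field; rewrite ck rk.
Qed.

(* For [Y = X + Z] with [X], [Z] positive and [Y = g^* g] of rank one, both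
   vanish on the kernel of [g], hence are multiples of [Y]. *)
Lemma psd_le_rank1 N (X Z : 'M[C]_N) (g : 'rV[C]_N) :
  psd X -> psd Z -> X + Z = g ^t* *m g ->
  exists2 t : C, 0 <= t & X = t *: (g ^t* *m g).
Proof.
move=> pX pZ XZ.
have gg i j : (g ^t* *m g) i j = (g 0 i)^* * g 0 j by rewrite mxE big_ord1 !mxE.
have [g0|gn0] := EM (forall i, g 0 i = 0).
  exists 0 => //; rewrite scale0r; apply: psd_eq0 => // i.
  have := psd_diag_ge0 i pZ; have := psd_diag_ge0 i pX.
  have : X i i + Z i i = 0.
    by have /matrixP/(_ i i) := XZ; rewrite gg g0 mulr0 !mxE.
  move=> /eqP; rewrite addr_eq0 => /eqP ->; rewrite oppr_ge0 => Zi Zi'.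
  by apply/eqP; rewrite oppr_eq0 eq_le Zi Zi'.
have [k /eqP gk] : exists k, g 0 k <> 0 by apply/existsNP.
have null i : X *m (g 0 k *: delta_mx i 0 - g 0 i *: delta_mx k 0) = 0 :> 'cV_N.
  set x : 'cV_N := _ - _.
  have gx : g *m x = 0.
    rewrite /x mulmxBr -!scalemxAr -!colE; apply/matrixP => a b.
    by rewrite !mxE !ord1; ring.
  apply: psd_null => //; have : (x ^t* *m (X + Z) *m x) 0 0 = 0.
    by rewrite XZ -!mulmxA gx !mulmx0 mxE.
  rewrite (mulmxDr (x ^t*)) (mulmxDl _ _ x) mxE => /eqP.
  by rewrite paddr_eq0 ?(proj2 pX) ?(proj2 pZ) // => /andP[/eqP].
have Xl l i : g 0 k * X l i = g 0 i * X l k.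
  have /colP/(_ l) := null i; rewrite mulmxBr -!scalemxAr -!colE !mxE.
  by move/eqP; rewrite subr_eq0 => /eqP.
exists (X k k / (`|g 0 k| ^+ 2)).
  by rewrite divr_ge0 ?exprn_ge0 // psd_diag_ge0.
apply/matrixP => i j; rewrite mxE gg normCK.
have gk' : (g 0 k)^* != 0 by rewrite fmorph_eq0.
apply: (mulfI gk); rewrite Xl.
have -> : X i k = (g 0 i)^* * X k k / (g 0 k)^*.
  rewrite psd_sym //; apply: (mulIf gk'); rewrite mulfVK // -rmorphM mulrC Xl.
  by rewrite rmorphM /= -psd_sym.
by field; rewrite gk gk'.
Qed.
End Psd.

(** * Roots of unity of order a power of two *)

Section RootsOfUnity.
Variable C : numClosedFieldType.

Lemma prim_root_pow2 (w : C) n :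
  w ^+ (2 ^ n) = -1 -> (2 ^ n.+1).-primitive_root w.
Proof.
move=> wn; have w1 : w ^+ (2 ^ n.+1) = 1 by rewrite expnSr exprM wn expr2 mulrNN mulr1.
have [m mw] := prim_order_exists (expn_gt0 2 n.+1) w1.
move=> /(dvdn_pfactor _ _ (isT : prime 2))[k kn mE]; move: mw; rewrite mE.
have [->//|kn'] := eqVneq k n.+1.
have {kn kn'} kn : (k <= n)%N by rewrite -ltnS ltn_neqAle kn' kn.
move=> /prim_expr_order wk; move: wn; rewrite -(subnKC kn) expnD exprM wk expr1n.
by move/eqP; rewrite -subr_eq0 opprK -mulr2n pnatr_eq0.
Qed.

(** Orders that are powers of two suffice everywhere, and for them a primitive root comes from
    repeated square roots of -1. *)
Lemma ex_prim_root_pow2 n : exists w : C, (2 ^ n).-primitive_root w.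
Proof.
case: n => [|n].
  have [m m1] := prim_order_exists (isT : (0 < 1)%N) (expr1 (1 : C)).
  by rewrite dvdn1 => /eqP mE; exists 1; rewrite expn0 -mE.
suff [w wn] : exists w : C, w ^+ (2 ^ n) = -1 by exists w; exact: prim_root_pow2.
elim: n => [|n [w wn]]; first by exists (-1); rewrite expr1.
by exists (sqrtC w); rewrite expnS exprM sqrtCK.
Qed.

Lemma prim_root_norm n (w : C) : n.-primitive_root w -> `|w| = 1.
Proof.
move=> wp; have n0 := prim_order_gt0 wp.
have /eqP := congr1 Num.norm (prim_expr_order wp).
by rewrite normrX normr1 pexpr_eq1 // => /eqP.
Qed.

Lemma unit_conjK (w : C) : `|w| = 1 -> w * w^* = 1.
Proof. by move=> w1; rewrite -normCK w1 expr1n. Qed.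

Lemma prim_root_orthogonal n (w : C) k l : n.-primitive_root w ->
  (k < n)%N -> (l < n)%N ->
  \sum_(j < n) (w ^+ (j * k))^* * w ^+ (j * l) = (n * (k == l))%:R.
Proof.
move=> wp kn ln; have w1 := unit_conjK (prim_root_norm wp).
pose r := (w^*) ^+ k * w ^+ l.
rewrite (eq_bigr (fun j : 'I_n => r ^+ j)); last first.
  by move=> j _; rewrite /r exprMn -!exprM rmorphXn /= mulnC [(j * l)%N]mulnC.
have [kl|kl] := eqVneq k l.
  rewrite /r -kl muln1 (eq_bigr (fun=> 1)); first by rewrite sumr_const card_ord.
  by move=> j _; rewrite -exprMn mulrC w1 !expr1n.
rewrite muln0; have r1 : r != 1.
  apply: contra_neq kl => /(congr1 (fun x => w ^+ k * x)).
  rewrite /r mulrA -exprMn w1 expr1n mul1r mulr1 => /eqP.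
  by rewrite (eq_prim_root_expr wp) eq_sym !modn_small // => /eqP.
apply: (mulfI (x := r - 1)); first by rewrite subr_eq0.
rewrite mulr0 -subrX1 /r exprMn -!exprM -rmorphXn mulnC exprM.
by rewrite (mulnC l) (exprM w n) (prim_expr_order wp) !expr1n rmorph1 mul1r subrr.
Qed.
End RootsOfUnity.

(** * Von Neumann's inequality for semidefinite Hermitian forms *)

Section SemiForm.
Variables (R : realType).
Local Notation C := R[i].

(** The form may have a kernel, as the matrix K of the application may be singular. The arguments
    below only compare values of the form and never divide by them. *)
Record semi_form (X : lmodType C) := SemiForm {
  sform :> X -> X -> C;
  sformP : forall x a y z, sform x (a *: y + z) = a * sform x y + sform x z;
  sformC : forall x y, sform y x = (sform x y)^*;
  sform_ge0 : forall x, 0 <= sform x x }.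

Lemma linear_sumZ (X Y : lmodType C) (f : X -> Y) (I : Type) (r : seq I)
    (P : pred I) (a : I -> C) (x : I -> X) : linear f ->
  f (\sum_(i <- r | P i) a i *: x i) = \sum_(i <- r | P i) a i *: f (x i).
Proof.
move=> lf; have f0 : f 0 = 0.
  by have := lf (-1) 0 0; rewrite scaler0 addr0 scaleN1r addNr.
elim/big_rec2 : _ => // i y1 y2 _ IH; by rewrite lf IH.
Qed.

Lemma linear_scale (X Y : lmodType C) (f : X -> Y) a x :
  linear f -> f (a *: x) = a *: f x.
Proof.
move=> lf; have f0 : f 0 = 0.
  by have := lf (-1) 0 0; rewrite scaler0 addr0 scaleN1r addNr.
by rewrite -[a *: x]addr0 lf f0 addr0.
Qed.

Lemma linear_iter (X : lmodType C) (f : X -> X) n : linear f -> linear (iter n f).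
Proof. by move=> lf; elim: n => [|n IH] a x y //=; rewrite IH lf. Qed.

Variables (X : lmodType C) (B : semi_form X).
Local Notation q x := (B x x).

Lemma sform_linear x : linear (B x : X -> C^o).
Proof. by move=> a y z; rewrite sformP. Qed.

Lemma sform0 x : B x 0 = 0.
Proof. by have := sformP B x (-1) 0 0; rewrite scaler0 addr0 mulN1r addNr. Qed.

Lemma sform_sumr (I : Type) (r : seq I) (P : pred I) (a : I -> C) (x : I -> X) y :
  B y (\sum_(i <- r | P i) a i *: x i) = \sum_(i <- r | P i) a i * B y (x i).
Proof. exact: (linear_sumZ _ _ _ _ (@sform_linear y)). Qed.

Lemma sform_suml (I : Type) (r : seq I) (P : pred I) (a : I -> C) (x : I -> X) y :
  B (\sum_(i <- r | P i) a i *: x i) y = \sum_(i <- r | P i) (a i)^* * B (x i) y.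
Proof.
rewrite sformC sform_sumr rmorph_sum; apply: eq_bigr => i _.
by rewrite rmorphM /= -sformC.
Qed.

Lemma sqform_unit (u : C) x : `|u| = 1 -> q (u *: x) = q x.
Proof.
move=> u1; have := sform_sumr (index_enum 'I_1) xpredT (fun=> u) (fun=> x).
have := sform_suml (index_enum 'I_1) xpredT (fun=> u) (fun=> x).
move=> /(_ (u *: x)); rewrite !big_ord1 => -> /(_ x); rewrite !big_ord1 => ->.
by rewrite mulrA (mulrC u^*) unit_conjK // mul1r.
Qed.

Lemma parseval n (w : C) (e : nat -> X) : n.-primitive_root w ->
  \sum_(j < n) q (\sum_(l < n) w ^+ (j * l) *: e l) =
  n%:R * \sum_(l < n) q (e l).
Proof.
move=> wp; under eq_bigr => j _.
  rewrite sform_suml; under eq_bigr do rewrite sform_sumr mulr_sumr.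
  over.
rewrite exchange_big mulr_sumr /=; apply: eq_bigr => k _.
rewrite exchange_big /= (bigD1 k) //= [X in _ + X]big1 ?addr0.
  transitivity ((\sum_(j < n) (w ^+ (j * k))^* * w ^+ (j * k)) * q (e k)).
    by rewrite [RHS]mulr_suml; apply: eq_bigr => j _; rewrite mulrA.
  by rewrite (prim_root_orthogonal wp) // eqxx muln1.
move=> l lk.
transitivity ((\sum_(j < n) (w ^+ (j * k))^* * w ^+ (j * l)) * B (e k) (e l)).
  by rewrite [RHS]mulr_suml; apply: eq_bigr => j _; rewrite mulrA.
by rewrite (prim_root_orthogonal wp) // eq_sym val_eqE (negPf lk) muln0 mul0r.
Qed.

Section VonNeumann.
Variables (V : X -> X) (d : nat) (f : nat -> X -> X).
Hypotheses (Vlin : linear V) (flin : forall p, linear (f p)).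
Hypothesis fV : forall p x, f p (V x) = V (f p x).
Hypothesis Viso : forall x, q (V x) = q x.
Hypothesis f_le1 : forall (z : C) x, `|z| = 1 ->
  q (\sum_(p < d) z ^+ p *: f p x) <= q x.

Let qiter k x : q (iter k V x) = q x.
Proof. by elim: k => //= k IH; rewrite Viso. Qed.

Let fiter p k x : f p (iter k V x) = iter k V (f p x).
Proof. by elim: k => //= k IH; rewrite fV IH. Qed.

(** [y j] is the generating function of the orbit x, V x, ... of length M + d at the root w^j, and
    [z j] is its image under the contraction at the conjugate root. By Parseval the [y j] have total
    square (M + d) q x, up to the factor L. The coefficients of w^(jd) [z j] with indices d, ..., d
    + M - 1 are the vectors V^l F, each of square q F, and the others contribute nonnegative
    terms. *)
Lemma vn_finite M x :
  M%:R * q (\sum_(p < d) iter p V (f p x)) <= (M + d)%:R * q x.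
Proof.
set F := \sum_(p < d) _.
(* All exponents k + (d - p) stay below M + d + d <= L, so different exponents give different powers
   of the root and Parseval applies. *)
pose n := (M + d + d)%N; pose L := (2 ^ n)%N.
have nL : (n <= L)%N by rewrite ltnW // ltn_expl.
have [w wp] := ex_prim_root_pow2 C n; rewrite -/L in wp.
have w1 := prim_root_norm wp.
have L0 : 0 < L%:R :> C by rewrite ltr0n expn_gt0.
pose y j := \sum_(k < M + d) w ^+ (j * k) *: iter k V x.
pose z j := \sum_(p < d) ((w ^+ j)^*) ^+ p *: f p (y j).
have zy j : q (z j) <= q (y j).
  by apply: f_le1; rewrite norm_conjC normrX w1 expr1n.
pose e l := \sum_(p < d) \sum_(k < M + d | (k + (d - p))%N == l) iter k V (f p x).
have sum_y : \sum_(j < L) q (y j) = L%:R * ((M + d)%:R * q x).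
  have ML : (M + d <= L)%N by rewrite (leq_trans _ nL) // leq_addr.
  pose e' l := if (l < M + d)%N then iter l V x else 0.
  transitivity (\sum_(j < L) q (\sum_(l < L) w ^+ (j * l) *: e' l)).
    apply: eq_bigr => j _; suff -> : y j = \sum_(l < L) w ^+ (j * l) *: e' l by [].
    rewrite /y (big_ord_widen _ (fun k => w ^+ (j * k) *: iter k V x) ML).
    rewrite big_mkcond; apply: eq_bigr => l _; rewrite /e'.
    by case: ifP; rewrite ?scaler0.
  rewrite (parseval _ wp); congr (_ * _).
  rewrite (eq_bigr (fun l : 'I_L => if (l < M + d)%N then q x else 0)).
    rewrite -big_mkcond -(big_ord_widen _ (fun=> q x) ML) sumr_const card_ord.
    by rewrite mulr_natl.
  by move=> l _; rewrite /e'; case: ifP => _; rewrite ?qiter ?sform0.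
have sum_z : \sum_(j < L) q (z j) = L%:R * \sum_(l < L) q (e l).
  rewrite -(parseval _ wp); apply: eq_bigr => j _.
  have wj : `|w ^+ (j * d)| = 1 by rewrite normrX w1 expr1n.
  rewrite -(sqform_unit _ wj); suff <- : w ^+ (j * d) *: z j =
    \sum_(l < L) w ^+ (j * l) *: e l by [].
  rewrite /z /e scaler_sumr.
  under [RHS]eq_bigr do rewrite scaler_sumr.
  rewrite exchange_big /=; apply: eq_bigr => p _.
  rewrite /y linear_sumZ // !scaler_sumr.
  under [RHS]eq_bigr do rewrite scaler_sumr big_mkcond.
  rewrite exchange_big /=; apply: eq_bigr => k _.
  have kL : (k + (d - p) < L)%N.
    by apply: leq_trans nL; rewrite /n; have := ltn_ord k; have := ltn_ord p; lia.
  rewrite (bigD1 (Ordinal kL)) //= eqxx big1 ?addr0; last first.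
    move=> l lk; case: ifP => // /eqP kl; case/eqP: lk; exact: val_inj.
  rewrite fiter !scalerA; congr (_ *: _).
  have pd := ltnW (ltn_ord p).
  have -> : w ^+ (j * d) * (w ^+ j)^* ^+ p * w ^+ (j * k) =
      w ^+ (j * (k + (d - p))) * (w ^+ (j * p) * (w ^+ (j * p))^*).
    have -> : (j * d = j * (d - p) + j * p)%N by rewrite -mulnDr subnK.
    by rewrite mulnDr !exprD -rmorphXn -exprM /=; ring.
  by rewrite unit_conjK ?mulr1 // normrX w1 expr1n.
have e_F l : (l < M)%N -> e (d + l)%N = iter l V F.
  move=> lM; rewrite /F /e.
  rewrite [in RHS](eq_bigr (fun p : 'I_d => 1 *: iter p V (f p x))); last first.
    by move=> p _; rewrite scale1r.
  rewrite (linear_sumZ _ _ _ _ (linear_iter _ Vlin)).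
  apply: eq_bigr => p _; rewrite scale1r.
  have kM : (l + p < M + d)%N by have := ltn_ord p; lia.
  rewrite (big_pred1 (Ordinal kM)) /= ?iterD //.
  move=> k; rewrite /=; apply/eqP/eqP => [h|->] /=; last by have := ltn_ord p; lia.
  by apply: val_inj => /=; have := ltn_ord p; lia.
have : L%:R * \sum_(l < L) q (e l) <= L%:R * ((M + d)%:R * q x).
  by rewrite -sum_z -sum_y ler_sum.
rewrite ler_pM2l // => /(le_trans _); apply.
have -> : M%:R * q F = \sum_(d <= l < d + M) q (e l).
  rewrite -{1}[d]add0n [(d + M)%N]addnC big_addn addnK big_mkord.
  rewrite (eq_bigr (fun=> q F)) ?sumr_const ?card_ord ?mulr_natl //.
  by move=> l _; rewrite addnC e_F // qiter.
rewrite -(big_mkord xpredT (fun l => q (e l))).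
have dL : (d + M <= L)%N by apply: leq_trans nL; rewrite /n; lia.
rewrite (@big_cat_nat _ _ _ (d + M)%N 0%N L) //= (@big_cat_nat _ _ _ d 0%N (d + M)%N) ?leq_addr //=.
by rewrite -addrA addrCA lerDl addr_ge0 // sumr_ge0 // => i _; rewrite sform_ge0.
Qed.

(** Divide [vn_finite] by M and let M grow. The coefficients [f p] are operators commuting with V,
    so that the step can be iterated over the two variables. *)
Lemma von_neumann_step x : q (\sum_(p < d) iter p V (f p x)) <= q x.
Proof.
have h M := vn_finite M x; move: h; set F := \sum_(_ < _) _ => h.
have [a aE] : exists a : R, q F = a%:C%C.
  by exists (complex.Re (q F)); rewrite RRe_real // ger0_real // sform_ge0.
have [b bE] : exists b : R, q x = b%:C%C.
  by exists (complex.Re (q x)); rewrite RRe_real // ger0_real // sform_ge0.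
have b0 : 0 <= b by rewrite -ler0c -bE sform_ge0.
have {}h (M : nat) : M%:R * a <= (M + d)%:R * b.
  by have := h M; rewrite aE bE -!(rmorph_nat (real_complex R)) -!rmorphM lecR.
rewrite aE bE lecR leNgt; apply/negP => ab.
have c0 : 0 <= d%:R * b / (a - b) by rewrite divr_ge0 ?mulr_ge0 // subr_ge0 ltW.
have := archi_boundP c0; rewrite ltr_pdivrMr ?subr_gt0 //.
move: (Num.bound _) => M; have := h M; rewrite natrD; lra.
Qed.
End VonNeumann.
End SemiForm.

(** * Ando's dilation and the inequality for polynomials on the torus *)

Section Ando.
Variable R : realType.
Local Notation C := R[i].

Definition peval2 (d : nat) (c : nat -> nat -> C) (z1 z2 : C) : C :=
  \sum_(p < d) \sum_(r < d) c p r * z1 ^+ p * z2 ^+ r.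

(* The finitely supported sequences in ['cV[C]_m], as a left C-module. *)
Definition polycol (m : nat) : Type := 'cV[{poly C}]_m.
HB.instance Definition _ m := GRing.Zmodule.on (polycol m).
Definition polycol_scale m (a : C) (z : polycol m) : polycol m :=
  a%:P *: (z : 'cV[{poly C}]_m).
Lemma polycol_scaleA m a b (z : polycol m) :
  polycol_scale a (polycol_scale b z) = polycol_scale (a * b) z.
Proof. by rewrite /polycol_scale scalerA polyCM. Qed.
Lemma polycol_scale1 m : left_id 1 (@polycol_scale m).
Proof. by move=> z; rewrite /polycol_scale scale1r. Qed.
Lemma polycol_scaleDr m : right_distributive (@polycol_scale m) +%R.
Proof. by move=> a z z'; rewrite /polycol_scale scalerDr. Qed.
Lemma polycol_scaleDl m (z : polycol m) :
  {morph (@polycol_scale m)^~ z : a b / a + b}.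
Proof. by move=> a b; rewrite /polycol_scale polyCD scalerDl. Qed.
HB.instance Definition _ m := GRing.Zmodule_isLmodule.Build C (polycol m)
  (@polycol_scaleA m) (@polycol_scale1 m) (@polycol_scaleDr m)
  (@polycol_scaleDl m).

Definition coefv m k (z : 'cV[{poly C}]_m) : 'cV[C]_m := \col_i (z i 0)`_k.

Definition bound m (z : 'cV[{poly C}]_m) : nat := \max_i size (z i 0%R).

Lemma coefv_linear m k a (z z' : polycol m) :
  coefv k (a *: z + z') = a *: coefv k z + coefv k z'.
Proof. by apply/colP => i; rewrite !mxE coefD coefCM. Qed.

Lemma coefv_bound m k (z : 'cV[{poly C}]_m) : (bound z <= k)%N -> coefv k z = 0.
Proof.
move=> h; apply/colP => i; rewrite !mxE nth_default //.
by apply: leq_trans h; exact: (leq_bigmax (F := fun i => size (z i 0%R))).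
Qed.

(** The inner product of finitely supported vector sequences. The coefficients of [z] vanish from
    [bound z] on, so that nothing is lost by cutting there. *)
Definition pdot m (z z' : 'cV[{poly C}]_m) : C :=
  \sum_(k < bound z) ((coefv k z) ^t* *m coefv k z') 0 0.

Lemma pdotE m n (z z' : 'cV[{poly C}]_m) : (bound z <= n)%N ->
  pdot z z' = \sum_(k < n) ((coefv k z) ^t* *m coefv k z') 0 0.
Proof.
move=> zn; rewrite /pdot.
rewrite (big_ord_widen _ (fun k => ((coefv k z) ^t* *m coefv k z') 0 0) zn).
rewrite big_mkcond; apply: eq_bigr => k _; case: ltnP => // zk.
by rewrite coefv_bound // adjmx0 mul0mx mxE.
Qed.

Lemma adj00 m (x y : 'cV[C]_m) : (y ^t* *m x) 0 0 = ((x ^t* *m y) 0 0)^*.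
Proof. by rewrite -[RHS](adjmxE (x ^t* *m y)) adjmxM adjmxK. Qed.

Lemma pdotP m (x y z : polycol m) (a : C) :
  pdot x (a *: y + z) = a * pdot x y + pdot x z.
Proof.
rewrite /pdot mulr_sumr -big_split; apply: eq_bigr => k _ /=.
by rewrite coefv_linear mulmxDr -scalemxAr !mxE.
Qed.

Lemma pdotC m (x y : 'cV[{poly C}]_m) : pdot y x = (pdot x y)^*.
Proof.
rewrite (pdotE x (leq_maxl (bound y) (bound x))).
rewrite (pdotE y (leq_maxr (bound y) (bound x))) rmorph_sum.
by apply: eq_bigr => k _; rewrite adj00.
Qed.

Lemma pdot_ge0 m (x : 'cV[{poly C}]_m) : 0 <= pdot x x.
Proof. by apply: sumr_ge0 => k _; exact: sqnorm_ge0. Qed.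

Variables (N : nat) (K : 'M[C]_N) (lam1 lam2 : 'rV[C]_N).
Let D1 := diag_mx lam1.
Let D2 := diag_mx lam2.
Hypotheses (pK : psd K) (pK1 : psd (K - D1 ^t* *m K *m D1))
  (pK2 : psd (K - D2 ^t* *m K *m D2)).

Let X : lmodType C := ('cV[C]_N * polycol (N + N))%type.

Let form (x y : X) : C := (x.1 ^t* *m K *m y.1) 0 0 + pdot x.2 y.2.

Let formP x a y z : form x (a *: y + z) = a * form x y + form x z.
Proof.
rewrite /form pdotP /= mulmxDr -scalemxAr !mxE; ring.
Qed.

Let formC x y : form y x = (form x y)^*.
Proof.
rewrite /form rmorphD /= -pdotC; congr (_ + _).
by rewrite -[RHS](adjmxE (x.1 ^t* *m K *m y.1)) !adjmxM adjmxK -mulmxA;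
  have [] := pK; rewrite hermsymmx_adj => /eqP <-.
Qed.

Let form_ge0 x : 0 <= form x x.
Proof. by rewrite addr_ge0 ?pdot_ge0 //; case: pK. Qed.

Let F := SemiForm formP formC form_ge0.

(* Ando's dilation in the form of Berger, Coburn and Lebow: [shift] is a square
   root of the multiplication by the variable, and the unitary [G] exchanges the
   two orders in which the defects of the contractions are recorded. *)
Definition shift : 'M[{poly C}]_(N + N) := block_mx 0 'X%:M 1%:M 0.

Lemma shift_sqr : shift *m shift = 'X%:M.
Proof.
rewrite /shift mulmx_block !mul0mx !mulmx0 !add0r !addr0 mul1mx mulmx1.
by rewrite -scalar_mx_block.
Qed.

Definition cst m n (A : 'M[C]_(m, n)) : 'M[{poly C}]_(m, n) := map_mx polyC A.

Lemma cstM m n p (A : 'M[C]_(m, n)) (B : 'M[C]_(n, p)) :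
  cst (A *m B) = cst A *m cst B.
Proof. exact: map_mxM. Qed.

Definition inject (u : 'cV[C]_N) : 'cV[{poly C}]_(N + N) := col_mx (cst u) 0.

Lemma inject_exchange (g : 'M[C]_(N + N)) (u v u' v' : 'cV[C]_N) :
  g *m col_mx u v = col_mx u' v' ->
  cst g *m (inject u + shift *m inject v) = inject u' + shift *m inject v'.
Proof.
have E (x y : 'cV[C]_N) : inject x + shift *m inject y = cst (col_mx x y).
  rewrite /cst map_col_mx /shift /inject mul_block_col !mul0mx mulmx0 mul1mx.
  by rewrite !addr0 add_col_mx addr0 add0r.
by rewrite !E -cstM => ->.
Qed.

(** This is the commutation of the two dilations on the sequence component. It holds because the
    square of [shift] is the scalar 'X, which commutes with [g], although [shift] itself need
    not. *)
Lemma shift_commute (g gi : 'M[{poly C}]_(N + N)) (a1 b1 a2 b2 z : 'cV[{poly C}]_(N + N)) :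
  g *m gi = 1%:M -> gi *m g = 1%:M -> g *m (a1 + shift *m b1) = a2 + shift *m b2 ->
  g *m (a1 + shift *m (b1 + shift *m (gi *m z))) =
  a2 + shift *m (gi *m (g *m (b2 + shift *m z))).
Proof.
move=> ggi gig e; have [s sE] : exists s, s = shift by exists shift.
have s2 y : s *m (s *m y) = 'X *: y.
  by rewrite mulmxA sE shift_sqr mul_scalar_mx.
rewrite -sE in e *; rewrite (mulmxA gi) gig mul1mx (mulmxDr s b2) s2 (addrA a2) -e.
by rewrite (mulmxDr s b1) s2 (addrA a1) (mulmxDr g _ ('X *: _)) -scalemxAr (mulmxA g gi) ggi mul1mx.
Qed.

Lemma coefv_unitary m (G : 'M[C]_m) k (z : 'cV[{poly C}]_m) :
  coefv k (cst G *m z) = G *m coefv k z.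
Proof.
apply/colP => i; rewrite !mxE coef_sum; apply: eq_bigr => j _.
by rewrite !mxE coefCM.
Qed.

Lemma pdot_unitary m (G : 'M[C]_m) (z : 'cV[{poly C}]_m) : G \is unitarymx ->
  pdot (cst G *m z) (cst G *m z) = pdot z z.
Proof.
move=> Gu; set z' := cst G *m z.
rewrite (pdotE _ (leq_maxl (bound z') (bound z))).
rewrite (pdotE z (leq_maxr (bound z') (bound z))); apply: eq_bigr => k _.
by rewrite coefv_unitary adjmxM -mulmxA (mulmxA (G ^t*)) mulmx_adj_unitary ?mul1mx.
Qed.

(** [shift] moves the upper block down and sends the lower block, times 'X, up. The constant
    coefficient of the upper block becomes free and receives u, orthogonally to the rest. *)
Lemma pdot_shift (u : 'cV[C]_N) (z : 'cV[{poly C}]_(N + N)) :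
  pdot (inject u + shift *m z) (inject u + shift *m z) =
  (u ^t* *m u) 0 0 + pdot z z.
Proof.
set z' := inject u + _.
have z'E : z' = col_mx (cst u + 'X *: dsubmx z) (usubmx z).
  rewrite /z' /shift -{1}[z]vsubmxK mul_block_col !mul0mx mul1mx mul_scalar_mx.
  by rewrite /inject add_col_mx !add0r addr0.
pose n := maxn (bound z') (bound z).
have coefv_col k (a b : 'cV[{poly C}]_N) :
    ((coefv k (col_mx a b)) ^t* *m coefv k (col_mx a b)) 0 0 =
    ((coefv k a) ^t* *m coefv k a) 0 0 + ((coefv k b) ^t* *m coefv k b) 0 0.
  have -> : coefv k (col_mx a b) = col_mx (coefv k a) (coefv k b).
    apply/colP => i; rewrite -(splitK i); case: (fintype.split i) => j /=.
      by rewrite mxE !col_mxEu mxE.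
    by rewrite mxE !col_mxEd mxE.
  by rewrite adjmx_col mul_row_col mxE.
rewrite (@pdotE _ n.+1); last by rewrite leqW // leq_maxl.
rewrite [pdot z z](@pdotE _ n.+1); last by rewrite ltnW // ltnS leq_maxr.
have zn : coefv n z = 0 by rewrite coefv_bound // leq_maxr.
rewrite z'E.
under eq_bigr do rewrite coefv_col.
have -> : \sum_(k < n.+1) ((coefv k z) ^t* *m coefv k z) 0 0 =
    \sum_(k < n.+1) ((coefv k (usubmx z)) ^t* *m coefv k (usubmx z)) 0 0 +
    \sum_(k < n) ((coefv k (dsubmx z)) ^t* *m coefv k (dsubmx z)) 0 0.
  transitivity (\sum_(k < n.+1) (((coefv k (usubmx z)) ^t* *m coefv k (usubmx z)) 0 0 +
      ((coefv k (dsubmx z)) ^t* *m coefv k (dsubmx z)) 0 0)).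
    by apply: eq_bigr => k _; rewrite -coefv_col vsubmxK.
  rewrite big_split /=; congr (_ + _); rewrite big_ord_recr /=.
  suff -> : coefv n (dsubmx z) = 0 by rewrite mulmx0 mxE addr0.
  apply/colP => i; rewrite !mxE.
  by have /colP/(_ (rshift N i)) := zn; rewrite !mxE.
rewrite big_split /= addrC addrCA; congr (_ + _).
rewrite big_ord_recl; congr (_ + _).
  suff -> : coefv 0 (cst u + 'X *: dsubmx z) = u by [].
  by apply/colP => i; rewrite !mxE coefD coefC coefXM addr0.
apply: eq_bigr => k _.
suff -> : coefv (lift ord0 k) (cst u + 'X *: dsubmx z) = coefv k (dsubmx z) by [].
by apply/colP => i; rewrite !mxE coefD coefC coefXM add0r.
Qed.

Let gram_isometry (D Y : 'M[C]_N) (h : 'cV[C]_N) :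
  K - D ^t* *m K *m D = Y ^t* *m Y ->
  ((D *m h) ^t* *m K *m (D *m h)) 0 0 + ((Y *m h) ^t* *m (Y *m h)) 0 0 =
  (h ^t* *m K *m h) 0 0.
Proof.
move=> KY; have -> : (Y *m h) ^t* *m (Y *m h) = h ^t* *m (Y ^t* *m Y) *m h.
  by rewrite adjmxM !mulmxA.
rewrite -KY mulmxBr mulmxBl [X in _ + X]mxE.
by rewrite adjmxM !mulmxA [X in _ + (_ + X)]mxE addrC subrK.
Qed.

(** The column of values is the polynomial in D1 and D2 applied to the vector of ones. It is also
    the first component of the same polynomial in the commuting isometries V1 and V2 applied to
    [x0], and the sequence component only adds to the norm. *)
Lemma ando_von_neumann (d : nat) (c : nat -> nat -> C) :
  (forall z1 z2 : C, `|z1| = 1 -> `|z2| = 1 -> `|peval2 d c z1 z2| <= 1) ->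
  ((\col_j peval2 d c (lam1 0 j) (lam2 0 j)) ^t* *m K *m
    (\col_j peval2 d c (lam1 0 j) (lam2 0 j))) 0 0 <= \sum_i \sum_j K i j.
Proof.
move=> c1; set f := \col_j _.
have [Y1 KY1] := psd_factor pK1; have [Y2 KY2] := psd_factor pK2.
have D12 : D1 *m D2 = D2 *m D1 by exact: diag_mxC.
(* Both columns have the Gram matrix K - (D1 D2)^* K D1 D2, so a unitary maps one record of the
   defects to the other. *)
have [G Gu GE] : exists2 G : 'M[C]_(N + N), G \is unitarymx &
    G *m col_mx (Y1 *m D2) Y2 = col_mx (Y2 *m D1) Y1.
  apply: unitary_extension; rewrite !adjmx_col !mul_row_col !adjmxM.
  have conjg (A B : 'M[C]_N) : (A ^t* *m B ^t*) *m (B *m A) =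
      A ^t* *m (B ^t* *m B) *m A by rewrite !mulmxA.
  have DKD : D2 ^t* *m (D1 ^t* *m K *m D1) *m D2 = D1 ^t* *m (D2 ^t* *m K *m D2) *m D1.
    by rewrite !mulmxA -!adjmxM -!(mulmxA _ D1) D12 -!mulmxA.
  have cancel (V : zmodType) (p q r s : V) : p - q + (s - p) = r - q + (s - r).
    by rewrite [LHS]addrC [RHS]addrC !subrKA.
  rewrite !conjg -KY1 -KY2 !(mulmxBr, mulmxBl) DKD.
  exact: cancel.
pose Gi := G ^t*.
have Giu : Gi \is unitarymx by rewrite trmxC_unitary.
have GGi : cst G *m cst Gi = 1%:M.
  by rewrite -cstM /Gi; have /unitarymxP -> := Gu; rewrite /cst map_mx1.
have GiG : cst Gi *m cst G = 1%:M.
  by rewrite -cstM (mulmx_adj_unitary Gu) /cst map_mx1.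
pose V1 (x : X) : X := (D1 *m x.1, cst G *m (inject (Y1 *m x.1) + shift *m x.2)).
pose V2 (x : X) : X := (D2 *m x.1, inject (Y2 *m x.1) + shift *m (cst Gi *m x.2)).
have V1iso x : F (V1 x) (V1 x) = F x x.
  rewrite /= /form /= pdot_unitary // pdot_shift addrA; congr (_ + _).
  exact: gram_isometry.
have V2iso x : F (V2 x) (V2 x) = F x x.
  rewrite /= /form /= pdot_shift pdot_unitary // addrA; congr (_ + _).
  exact: gram_isometry.
have injectP a u v : inject (a *: u + v) = a%:P *: inject u + inject v.
  rewrite /inject scale_col_mx add_col_mx scaler0 addr0; congr col_mx.
  by apply/colP => i; rewrite !mxE polyCD polyCM.
have V1lin : linear V1.
  move=> a x y; rewrite /V1 /=; congr pair.
    by rewrite mulmxDr -scalemxAr.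
  change (cst G *m (inject (Y1 *m (a *: x.1 + y.1)) +
      shift *m (a%:P *: (x.2 : 'cV[{poly C}]_(N + N)) + y.2)) =
    a%:P *: (cst G *m (inject (Y1 *m x.1) + shift *m x.2)) +
      cst G *m (inject (Y1 *m y.1) + shift *m y.2)).
  rewrite (mulmxDr Y1) -scalemxAr injectP (mulmxDr shift) -scalemxAr addrACA -scalerDr.
  by rewrite (mulmxDr (cst G)) -scalemxAr.
have V2lin : linear V2.
  move=> a x y; rewrite /V2 /=; congr pair.
    by rewrite mulmxDr -scalemxAr.
  change (inject (Y2 *m (a *: x.1 + y.1)) +
      shift *m (cst Gi *m (a%:P *: (x.2 : 'cV[{poly C}]_(N + N)) + y.2)) =
    a%:P *: (inject (Y2 *m x.1) + shift *m (cst Gi *m x.2)) +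
      (inject (Y2 *m y.1) + shift *m (cst Gi *m y.2))).
  rewrite (mulmxDr Y2) -scalemxAr injectP (mulmxDr (cst Gi)) -scalemxAr.
  by rewrite (mulmxDr shift) -scalemxAr scalerDr addrACA.
have VC x : V1 (V2 x) = V2 (V1 x).
  case: x => h z; rewrite /V1 /V2 /= (mulmxA D1) D12 -(mulmxA D2); congr (_, _).
  apply: (shift_commute (b1 := inject (Y2 *m h)) (b2 := inject (Y1 *m h)) z GGi GiG).
  apply: inject_exchange.
  by rewrite !(mulmxA _ _ h) -!mul_col_mx mulmxA GE.
have iterV2C k x : V1 (iter k V2 x) = iter k V2 (V1 x).
  by elim: k => //= k IH; rewrite VC IH.
pose f2 p x := \sum_(r < d) c p r *: iter r V2 x.
have f2lin p : linear (f2 p).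
  move=> a x y; rewrite /f2 scaler_sumr -big_split; apply: eq_bigr => r _ /=.
  by rewrite (linear_iter _ V2lin) scalerDr !scalerA mulrC.
have f2C p x : f2 p (V1 x) = V1 (f2 p x).
  rewrite /f2 linear_sumZ //; apply: eq_bigr => r _.
  by rewrite iterV2C.
(* The outer step treats V1 with the operators [f2 p] as coefficients. For fixed z1 an inner step
   treats V2 with scalar coefficients, and what remains is the bound on the polynomial at the torus
   point (z1, z2). *)
have vn1 x : F (\sum_(p < d) iter p V1 (f2 p x)) (\sum_(p < d) iter p V1 (f2 p x))
    <= F x x.
  apply: von_neumann_step => // z1 {}x z1u.
  have -> : \sum_(p < d) z1 ^+ p *: f2 p x =
      \sum_(r < d) iter r V2 ((\sum_(p < d) c p r * z1 ^+ p) *: x).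
    rewrite /f2; under eq_bigr do rewrite scaler_sumr.
    rewrite exchange_big /=; apply: eq_bigr => r _.
    rewrite [RHS](_ : _ = (\sum_(p < d) c p r * z1 ^+ p) *: iter r V2 x).
      rewrite scaler_suml; apply: eq_bigr => p _.
      by rewrite scalerA mulrC.
    exact: linear_scale (linear_iter r V2lin).
  apply: (von_neumann_step (f := fun r => *:%R (\sum_(p < d) c p r * z1 ^+ p))) => //.
  - by move=> p a u v; rewrite scalerDr !scalerA mulrC.
  - by move=> p u; rewrite (linear_scale _ _ V2lin).
  move=> z2 y z2u.
  have -> : \sum_(p < d) z2 ^+ p *: ((\sum_(p0 < d) c p0 p * z1 ^+ p0) *: y) =
      peval2 d c z1 z2 *: y.
    rewrite /peval2 exchange_big scaler_suml; apply: eq_bigr => p _.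
    by rewrite scalerA -mulr_suml mulrC.
  have -> : F (peval2 d c z1 z2 *: y) (peval2 d c z1 z2 *: y) =
      `|peval2 d c z1 z2| ^+ 2 * F y y.
    set a := peval2 _ _ _ _.
    have := sform_sumr F (index_enum 'I_1) xpredT (fun=> a) (fun=> y).
    have := sform_suml F (index_enum 'I_1) xpredT (fun=> a) (fun=> y).
    move=> /(_ (a *: y)); rewrite !big_ord1 => -> /(_ y); rewrite !big_ord1 => ->.
    by rewrite mulrA -normCKC.
  rewrite ler_piMl ?form_ge0 ?exprn_ile1 //; exact: c1.
pose x0 : X := (const_mx 1, 0).
have pow r h z : (iter r V2 (h, z)).1 = \col_j (lam2 0 j ^+ r * h j 0).
  elim: r => [|r IH]; first by apply/colP => j; rewrite mxE expr0 mul1r.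
  rewrite /= IH; apply/colP => j; rewrite mul_diag_mx !mxE exprS mulrA //.
have pow1 r x : (iter r V1 x).1 = \col_j (lam1 0 j ^+ r * x.1 j 0).
  elim: r => [|r IH]; first by apply/colP => j; rewrite mxE expr0 mul1r.
  rewrite /= IH; apply/colP => j; rewrite mul_diag_mx !mxE exprS mulrA //.
have fst_sum (I : Type) (r : seq I) (g : I -> X) :
    (\sum_(i <- r) g i).1 = \sum_(i <- r) (g i).1.
  by elim/big_rec2 : _ => // i y1 y2 _ <-.
have := vn1 x0; rewrite /= /form fst_sum.
have -> : \sum_(p < d) (iter p V1 (f2 p x0)).1 = f.
  apply/colP => j; rewrite summxE mxE; apply: eq_bigr => p _.
  rewrite pow1 mxE /f2 fst_sum summxE mulr_sumr; apply: eq_bigr => r _.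
  by rewrite /= pow !mxE mulr1 mulrCA mulrA.
have -> : pdot x0.2 x0.2 = 0.
  by rewrite /pdot big1 // => k _; rewrite /coefv mxE big1 // => i _;
    rewrite !mxE coef0 mulr0.
rewrite addr0; have -> : (x0.1 ^t* *m K *m x0.1) 0 0 = \sum_i \sum_j K i j.
  rewrite mulmx3E; apply: eq_bigr => i _; apply: eq_bigr => j _.
  by rewrite !mxE rmorph1 mul1r mulr1.
by apply: le_trans; rewrite lerDl pdot_ge0.
Qed.
End Ando.

(** * The real-valued modulus *)

Section Modulus.
Variable R : realType.
Local Notation C := R[i].
Implicit Types (z w : C) (x : R).

Lemma modulusE z : `|z| = (modulus z)%:C%C.
Proof. by rewrite /modulus RRe_real // ger0_real. Qed.

Lemma ltr0c x : (0 < x%:C%C :> C) = (0 < x).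
Proof. by rewrite -(rmorph0 (real_complex R)) ltcR. Qed.

Lemma modulus_ge0 z : 0 <= modulus z.
Proof. by rewrite -ler0c -modulusE. Qed.

Lemma modulusM z w : modulus (z * w) = modulus z * modulus w.
Proof. by apply: complexI; rewrite rmorphM /= -!modulusE normrM. Qed.

Lemma modulusN z : modulus (- z) = modulus z.
Proof. by rewrite /modulus normrN. Qed.

Lemma modulusD z w : modulus (z + w) <= modulus z + modulus w.
Proof. by rewrite -lecR rmorphD /= -!modulusE ler_normD. Qed.

Lemma modulusB z w : modulus (z - w) <= modulus z + modulus w.
Proof. by rewrite -(modulusN w) modulusD. Qed.

Lemma modulus0 : modulus (0 : C) = 0.
Proof. by rewrite /modulus normr0. Qed.

Lemma modulus1 : modulus (1 : C) = 1.
Proof. by rewrite /modulus normr1. Qed.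

Lemma modulus_real x : modulus (x%:C%C : C) = `|x|.
Proof. by rewrite /modulus normc_def /= expr0n addr0 sqrtr_sqr. Qed.

Lemma modulus_nat n : modulus (n%:R : C) = n%:R.
Proof. by rewrite -(rmorph_nat (real_complex R)) modulus_real normr_nat. Qed.

Lemma modulusi : modulus ('i%C : C) = 1.
Proof. by rewrite /modulus normc_def /= expr0n add0r expr1n sqrtr1. Qed.

Lemma modulusX z n : modulus (z ^+ n) = modulus z ^+ n.
Proof. by elim: n => [|n IH]; rewrite ?expr0 ?modulus1 // !exprS modulusM IH. Qed.

Lemma modulusV z : modulus z^-1 = (modulus z)^-1.
Proof. by apply: complexI; rewrite fmorphV /= -!modulusE normfV. Qed.

Lemma modulus_conj z : modulus z^* = modulus z.
Proof. by rewrite /modulus norm_conjC. Qed.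

Lemma modulus_eq0 z : (modulus z == 0) = (z == 0).
Proof.
by rewrite -(inj_eq (@complexI R)) -modulusE normr_eq0.
Qed.

Lemma modulus_gt0 z : (0 < modulus z) = (z != 0).
Proof. by rewrite lt_def modulus_ge0 andbT modulus_eq0. Qed.

Lemma modulus_sum (I : Type) (r : seq I) (P : pred I) (f : I -> C) :
  modulus (\sum_(i <- r | P i) f i) <= \sum_(i <- r | P i) modulus (f i).
Proof.
elim/big_rec2 : _ => [|i x z _ h]; first by rewrite modulus0.
by apply: le_trans (modulusD _ _) _; rewrite lerD2l.
Qed.

Lemma modulus_rect (x y : R) : modulus (x%:C%C + 'i%C * y%:C%C) <= `|x| + `|y|.
Proof. by rewrite (le_trans (modulusD _ _)) // modulusM modulusi mul1r !modulus_real. Qed.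

Lemma modulus_ReIm z : modulus z <= `|complex.Re z| + `|complex.Im z|.
Proof. by rewrite {1}[z]complexE modulus_rect. Qed.

Lemma modulus_Re z : `|complex.Re z| <= modulus z.
Proof. by rewrite -lecR -modulusE normc_ge_Re. Qed.

Lemma modulus_lt1 z : (`|z| < 1) = (modulus z < 1).
Proof. by rewrite modulusE -(rmorph1 (real_complex R)) ltcR. Qed.

Lemma modulus_le1 z : (`|z| <= 1) = (modulus z <= 1).
Proof. by rewrite modulusE -(rmorph1 (real_complex R)) lecR. Qed.

Lemma modulus_eq1 z : (`|z| == 1) = (modulus z == 1).
Proof. by rewrite modulusE -(rmorph1 (real_complex R)) (inj_eq (@complexI R)). Qed.

Lemma modulus_distC z w : modulus (z - w) = modulus (w - z).
Proof. by rewrite -modulusN opprB. Qed.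
End Modulus.

(** * Derivability in epsilon-delta form, over the reals and over the complex numbers *)

Section LocalApproximation.

Lemma is_derive_approx (K : numFieldType) (f : K^o -> K^o) (x d : K) :
  is_derive (x : K^o) (1 : K^o) f d -> forall e : K, 0 < e -> exists2 del : K, 0 < del &
    forall u : K, `|u| < del -> `|f (x + u) - f x - d * u| <= e * `|u|.
Proof.
move=> [dv dE] e e0.
have := dv; rewrite /derivable.
move=> /cvg_ex[l /= hl].
have lE : l = d by rewrite -dE /derive; apply/esym/cvg_lim.
move/(@cvgrPdist_lt _ K^o) : hl => /(_ e e0).
rewrite /at_right near_withinE /= => /nbhs_ballP[del /= del0 hdel].
exists del => // u ud.
have [->|u0] := eqVneq u 0.
  by rewrite addr0 subrr mulr0 subrr !normr0 mulr0.
have := hdel u; rewrite /ball /= sub0r normrN => /(_ ud u0) /ltW.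
rewrite lE /GRing.scale /= mulr1 (addrC u) => h.
have -> : f (x + u) - f x - d * u = - ((d - u^-1 * (f (x + u) - f x)) * u).
  by field.
by rewrite normrN normrM ler_wpM2r.
Qed.
End LocalApproximation.

(** * The complex exponential and its first-order approximation *)

Section Exponential.
Variable R : realType.
Local Notation C := R[i].
Local Notation cis := (@torus_pt R).

Lemma cisD a b : cis (a + b) = cis a * cis b.
Proof.
rewrite /torus_pt cosD sinD; apply/eqP; rewrite eq_complex /=.
by rewrite eqxx /= addrC.
Qed.

Lemma cis0 : cis 0 = 1.
Proof. by rewrite /torus_pt cos0 sin0. Qed.

Lemma modulus_cis a : modulus (cis a) = 1.
Proof. by rewrite /modulus /torus_pt normc_def /= cos2Dsin2 sqrtr1. Qed.

Lemma cisX a n : cis a ^+ n = cis (a * n%:R).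
Proof.
elim: n => [|n IH]; first by rewrite mulr0 cis0.
by rewrite exprS IH -cisD mulrSr mulrDr mulr1 addrC.
Qed.

(** This is exp (s + i t). In these logarithmic coordinates circles about 0 become vertical segments
    of length 2 pi. *)
Definition cexp (s t : R) : C := (expR s)%:C%C * cis t.

Lemma cexpD s t s' t' : cexp (s + s') (t + t') = cexp s t * cexp s' t'.
Proof. by rewrite /cexp expRD cisD rmorphM; ring. Qed.

Lemma modulus_cexp s t : modulus (cexp s t) = expR s.
Proof. by rewrite modulusM modulus_cis modulus_real mulr1 ger0_norm // expR_ge0. Qed.

Lemma cexp_approx0 (e : R) : 0 < e -> exists2 del : R, 0 < del &
  forall u v, `|u| < del -> `|v| < del ->
    modulus (cexp u v - 1 - (u%:C%C + 'i%C * v%:C%C)) <= e * (`|u| + `|v|).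
Proof.
(* The errors estimated below add up to at most e1 |u| + 8 e1 |v|; the factor 10 covers this. *)
move=> e0; have [e1 [e10 e1e e11]] : exists e1 : R, [/\ 0 < e1, 10%:R * e1 <= e & e1 <= 1].
  exists (Num.min (e / 10%:R) 1); split.
  - by rewrite lt_min ltr01 andbT divr_gt0.
  - by rewrite mulrC -ler_pdivlMr // ge_min lexx.
  - by rewrite ge_min lexx orbT.
have [d1 d10 h1] := is_derive_approx (is_derive_expR (0 : R)) e10.
have [d2 d20 h2] := is_derive_approx (is_derive_cos (0 : R)) e10.
have [d3 d30 h3] := is_derive_approx (is_derive_sin (0 : R)) e10.
exists (Num.min (Num.min d1 d2) (Num.min d3 e1)).
  by rewrite !lt_min d10 d20 d30 e10.
move=> u v; rewrite !lt_min => /andP[/andP[ud1 _] /andP[_ ue]].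
move=> /andP[/andP[_ vd2] /andP[vd3 ve]].
have {h1} := h1 _ ud1; have {h2} := h2 _ vd2; have {h3} := h3 _ vd3.
rewrite !add0r expR0 cos0 sin0 !mul1r !oppr0 !mul0r !addr0 ?subr0.
set r3 := sin v - v; set r2 := cos v - 1; set r1 := expR u - 1 - u.
move=> h3 h2 h1.
have -> : cexp u v - 1 - (u%:C%C + 'i%C * v%:C%C) =
  (r1 + (1 + u + r1) * r2)%:C%C + 'i%C * ((u + r1) * v + (1 + u + r1) * r3)%:C%C.
  rewrite /cexp /torus_pt; apply/eqP; rewrite eq_complex /= /r1 /r2 /r3.
  by apply/andP; split; apply/eqP; ring.
apply: le_trans (modulus_rect _ _) _.
have nu := normr_ge0 u; have nv := normr_ge0 v.
have ur1 : `|u + r1| <= 2 * `|u|.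
  by apply: le_trans (ler_normD _ _) _; nra.
have ur2 : `|1 + u + r1| <= 3.
  rewrite -addrA; apply: le_trans (ler_normD _ _) _; rewrite normr1; nra.
have A : `|r1 + (1 + u + r1) * r2| <= e1 * `|u| + 3 * (e1 * `|v|).
  apply: le_trans (ler_normD _ _) _; rewrite normrM lerD //.
  by apply: ler_pM => //; exact: h2.
have B : `|(u + r1) * v + (1 + u + r1) * r3| <= 2 * `|u| * `|v| + 3 * (e1 * `|v|).
  apply: le_trans (ler_normD _ _) _; rewrite !normrM lerD //.
    by apply: ler_pM.
  by apply: ler_pM.
have uv : `|u| * `|v| <= e1 * `|v| by rewrite ler_wpM2r // ltW.
have : e1 * (`|u| + `|v|) * 10 <= e * (`|u| + `|v|).
  by rewrite mulrAC ler_wpM2r ?addr_ge0 // mulrC.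
have := mulr_ge0 (ltW e10) nu; have := mulr_ge0 (ltW e10) nv.
nra.
Qed.

Lemma cexp_approx (s t e : R) : 0 < e -> exists2 del : R, 0 < del &
  forall s' t', `|s' - s| < del -> `|t' - t| < del ->
    modulus (cexp s' t' - cexp s t - cexp s t * ((s' - s)%:C%C + 'i%C * (t' - t)%:C%C))
      <= e * (`|s' - s| + `|t' - t|).
Proof.
move=> e0; have m0 : 0 < expR s := expR_gt0 s.
have [del del0 h] := cexp_approx0 (divr_gt0 e0 m0).
exists del => // s' t' sd td; have := h _ _ sd td.
set u := s' - s; set v := t' - t.
have -> : cexp s' t' = cexp s t * cexp u v.
  by rewrite -cexpD /u /v !(addrC _ (_ - _)) !subrK.
set c := cexp s t; set w := u%:C%C + 'i%C * v%:C%C => {}h.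
have -> : c * cexp u v - c - c * w = c * (cexp u v - 1 - w) by ring.
rewrite modulusM modulus_cexp; apply: le_trans (ler_wpM2l (ltW m0) h) _.
by rewrite mulrA (mulrC (expR s)) divfK // gt_eqF.
Qed.
End Exponential.

(** * Goursat's subdivision argument for Riemann sums *)

Section Goursat.
Variable R : realType.
Local Notation C := R[i].

(** A left Riemann sum over [x, x + a]. The number of nodes is a power of two so that halving the
    interval is an exact identity. *)
Definition rsum (f : R -> C) (n : nat) (x a : R) : C :=
  (a / 2 ^+ n)%:C%C * \sum_(0 <= j < 2 ^ n) f (x + a * j%:R / 2 ^+ n).

Lemma rsum_split f n x a :
  rsum f n.+1 x a = rsum f n x (a / 2) + rsum f n (x + a / 2) (a / 2).
Proof.
have n2 : (2 : R) ^+ n != 0 by rewrite expf_neq0.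
rewrite /rsum exprS expnS mul2n -addnn.
rewrite (@big_cat_nat _ _ _ (2 ^ n)%N) ?leq_addr //= mulrDr.
rewrite [X in _ + _ * X](@big_addn _ _ _ 0 (2 ^ n + 2 ^ n) (2 ^ n)%N xpredT) /=.
congr (_ + _).
  congr (_ * _); first by congr (_%:C)%C; field.
  by apply: eq_bigr => j _; congr f; field.
rewrite addnK; congr (_ * _); first by congr (_%:C)%C; field.
apply: eq_bigr => j _; congr f; rewrite natrD natrX; field.
exact: n2.
Qed.

Lemma rsumB f g n x a : rsum (fun y => f y - g y) n x a = rsum f n x a - rsum g n x a.
Proof. by rewrite /rsum sumrB mulrBr. Qed.

Lemma eq_rsum f g n x a : f =1 g -> rsum f n x a = rsum g n x a.
Proof. by move=> fg; congr (_ * _); apply: eq_bigr => i _; rewrite fg. Qed.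

Lemma rsum_cst (c : C) n x a : rsum (fun=> c) n x a = a%:C%C * c.
Proof.
rewrite /rsum sumr_const_nat subn0 -[c *+ _]mulr_natl mulrA; congr (_ * _).
rewrite -(rmorph_nat (real_complex R)) -rmorphM natrX; congr (_%:C)%C.
by rewrite divfK // expf_neq0.
Qed.

Lemma modulus_rsum (f : R -> C) n x a E : 0 <= a ->
  (forall y, x <= y <= x + a -> modulus (f y) <= E) ->
  modulus (rsum f n x a) <= a * E.
Proof.
move=> a0 fE; have p2 : (0 : R) < 2 ^+ n by rewrite exprn_gt0.
rewrite /rsum modulusM modulus_real ger0_norm; last by rewrite divr_ge0 // ltW.
have -> : a * E = a / 2 ^+ n * \sum_(0 <= j < 2 ^ n) E.
  by rewrite sumr_const_nat subn0 -[E *+ _]mulr_natl natrX mulrA divfK // gt_eqF.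
rewrite ler_wpM2l //; first by rewrite divr_ge0 // ltW.
apply: le_trans (modulus_sum _ _ _) _.
rewrite !big_mkord; apply: ler_sum => j _; apply: fE.
rewrite lerDl divr_ge0 ?mulr_ge0 ?(ltW p2) //= lerD2l.
rewrite ler_pdivrMr // ler_wpM2l // -natrX ler_nat; exact/ltnW.
Qed.

Variables (c : C) (H : R -> R -> C).

(* The contour sum of the rectangle [s, s + a] x [t, t + b] with 2^n nodes on
   each side. Summing over the four quarters of the rectangle gives exactly the
   contour sum with 2^(n+1) nodes, and an affine function of [w = c s + i t] has
   contour sum exactly 0. *)
Definition contour_sum n s t a b : C :=
  c * rsum (H ^~ t) n s a + 'i%C * rsum (H (s + a)) n t b
  - c * rsum (H ^~ (t + b)) n s a - 'i%C * rsum (H s) n t b.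

Lemma contour_sum_split n s t a b :
  contour_sum n.+1 s t a b =
  contour_sum n s t (a / 2) (b / 2) + contour_sum n (s + a / 2) t (a / 2) (b / 2) +
  contour_sum n s (t + b / 2) (a / 2) (b / 2) +
  contour_sum n (s + a / 2) (t + b / 2) (a / 2) (b / 2).
Proof.
rewrite /contour_sum !rsum_split.
have -> : s + a / 2 + a / 2 = s + a by field.
have -> : t + b / 2 + b / 2 = t + b by field.
ring.
Qed.

(** Only the deviation [D] of H from the affine function [g] contributes, because the contour sum of
    [g] vanishes exactly. The rest is at most the supremum of [D] times the weighted perimeter. *)
Lemma contour_sum_small n s t a b s0 t0 (B : C) E : 0 <= a -> 0 <= b ->
  (forall s' t', s <= s' <= s + a -> t <= t' <= t + b ->
     modulus (H s' t' - H s0 t0 - B * (c * (s' - s0)%:C%C + 'i%C * (t' - t0)%:C%C)) <= E) ->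
  modulus (contour_sum n s t a b) <= 2 * (modulus c + 1) * (a + b) * E.
Proof.
move=> a0 b0 h.
pose g s' t' := H s0 t0 + B * (c * (s' - s0)%:C%C + 'i%C * (t' - t0)%:C%C).
pose D s' t' := H s' t' - g s' t'.
have DE s' t' : s <= s' <= s + a -> t <= t' <= t + b -> modulus (D s' t') <= E.
  by move=> hs ht; rewrite /D /g opprD addrA; exact: h.
have sa : s <= s <= s + a by rewrite lexx lerDl.
have sa' : s <= s + a <= s + a by rewrite lexx lerDl a0.
have tb : t <= t <= t + b by rewrite lexx lerDl.
have tb' : t <= t + b <= t + b by rewrite lexx lerDl b0.
have hor : rsum (g ^~ t) n s a - rsum (g ^~ (t + b)) n s a = - (a%:C%C * (B * ('i%C * b%:C%C))).
  rewrite -rsumB -mulrN -(rsum_cst _ n s); apply: eq_rsum => y; rewrite /g.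
  rewrite (_ : t + b - t0 = t - t0 + b) ?rmorphD /=; ring.
have ver : rsum (g (s + a)) n t b - rsum (g s) n t b = b%:C%C * (B * (c * a%:C%C)).
  rewrite -rsumB -(rsum_cst _ n t); apply: eq_rsum => y; rewrite /g.
  rewrite (_ : s + a - s0 = s - s0 + a) ?rmorphD /=; ring.
have -> : contour_sum n s t a b =
    c * rsum (D ^~ t) n s a + 'i%C * rsum (D (s + a)) n t b
    - c * rsum (D ^~ (t + b)) n s a - 'i%C * rsum (D s) n t b.
  rewrite /contour_sum /D !rsumB.
  have := hor; have := ver; set g1 := rsum (g _) _ _ _; set g2 := rsum (g s) _ _ _.
  set g3 := rsum _ n s a; set g4 := rsum _ n s a => /eqP; rewrite subr_eq => /eqP ->.
  move/eqP; rewrite subr_eq => /eqP ->.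
  ring.
apply: le_trans (modulusB _ _) _; apply: le_trans (lerD (modulusB _ _) (lexx _)) _.
apply: le_trans (lerD (lerD (modulusD _ _) (lexx _)) (lexx _)) _.
rewrite !(modulusM 'i%C) !(modulusM c) !modulusi !mul1r.
have E0 : 0 <= E by apply: le_trans (modulus_ge0 _) (DE _ _ sa tb).
have c0 := modulus_ge0 c.
have h1 y : (forall s', s <= s' <= s + a -> modulus (y s') <= E) ->
    modulus c * modulus (rsum y n s a) <= modulus c * (a * E).
  by move=> hy; rewrite ler_wpM2l // modulus_rsum.
have h2 y : (forall t', t <= t' <= t + b -> modulus (y t') <= E) ->
    modulus (rsum y n t b) <= b * E.
  by move=> hy; rewrite modulus_rsum.
apply: (@le_trans _ _ (modulus c * (a * E) + b * E + modulus c * (a * E) + b * E)).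
  rewrite !lerD ?h1 ?h2 // => y hy; exact: DE.
by have := mulr_ge0 a0 E0; have := mulr_ge0 b0 E0;
  have := mulr_ge0 c0 (mulr_ge0 b0 E0); nra.
Qed.

Variables (s t a b : R).
Hypotheses (a0 : 0 < a) (b0 : 0 < b).
Hypothesis Hdiff : forall s0 t0, s <= s0 <= s + a -> exists B : C,
  forall e : R, 0 < e -> exists2 del : R, 0 < del & forall s' t',
    `|s' - s0| < del -> `|t' - t0| < del ->
    modulus (H s' t' - H s0 t0 - B * (c * (s' - s0)%:C%C + 'i%C * (t' - t0)%:C%C)) <=
    e * (`|s' - s0| + `|t' - t0|).

Let ak k : R := a / 2 ^+ k.
Let bk k : R := b / 2 ^+ k.

Let akS k : ak k / 2 = ak k.+1.
Proof. by rewrite /ak exprS invfM; ring. Qed.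
Let bkS k : bk k / 2 = bk k.+1.
Proof. by rewrite /bk exprS invfM; ring. Qed.
Let ak0 k : 0 < ak k. Proof. by rewrite divr_gt0 ?exprn_gt0. Qed.
Let bk0 k : 0 < bk k. Proof. by rewrite divr_gt0 ?exprn_gt0. Qed.

Variable e : R.
Hypothesis e0 : 0 < e.

(** Badness asks for arbitrarily large n. If all four quarters had eventually small sums, so would
    the whole rectangle; hence badness passes to a quarter. *)
Let bad k (p : R * R) := forall m, exists2 n, (m <= n)%N &
  e / 4 ^+ k < modulus (contour_sum n p.1 p.2 (ak k) (bk k)).

(** The conclusion is conditional on badness so that [choice] gives a selection function defined on
    all pairs. *)
Let step k p : exists p' : R * R, bad k p ->
  [/\ bad k.+1 p', p.1 <= p'.1 <= p.1 + ak k.+1 & p.2 <= p'.2 <= p.2 + bk k.+1].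
Proof.
have [hb|] := pselect (bad k p); last by exists p.
pose p1 := p; pose p2 : R * R := (p.1 + ak k.+1, p.2).
pose p3 : R * R := (p.1, p.2 + bk k.+1).
pose p4 : R * R := (p.1 + ak k.+1, p.2 + bk k.+1).
have [h|h1] := pselect (bad k.+1 p1).
  by exists p1 => _; split; rewrite //= lexx lerDl ltW.
have [h|h2] := pselect (bad k.+1 p2).
  by exists p2 => _; split; rewrite //= lexx lerDl ltW.
have [h|h3] := pselect (bad k.+1 p3).
  by exists p3 => _; split; rewrite //= lexx lerDl ltW.
have [h|h4] := pselect (bad k.+1 p4).
  by exists p4 => _; split; rewrite //= lexx lerDl ltW.
have good q : ~ bad k.+1 q -> exists m, forall n, (m <= n)%N ->
    modulus (contour_sum n q.1 q.2 (ak k.+1) (bk k.+1)) <= e / 4 ^+ k.+1.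
  move=> /existsNP[m hm]; exists m => n mn; rewrite leNgt; apply/negP => hn.
  by apply: hm; exists n.
have [m1 {}h1] := good _ h1; have [m2 {}h2] := good _ h2.
have [m3 {}h3] := good _ h3; have [m4 {}h4] := good _ h4.
(* One more than the four thresholds together, because subdividing lowers the exponent n by one. *)
have [[|n]] := hb (m1 + m2 + m3 + m4).+1 => // mn.
rewrite contour_sum_split akS bkS => hn; exfalso.
have {}h1 := h1 n ltac:(lia); have {}h2 := h2 n ltac:(lia).
have {}h3 := h3 n ltac:(lia); have {}h4 := h4 n ltac:(lia).
have e4 : e / 4 ^+ k = 4 * (e / 4 ^+ k.+1).
  by rewrite exprS; field; rewrite expf_neq0.
move: hn; rewrite e4 ltNge => /negP; apply.
apply: le_trans (modulusD _ _) _; apply: le_trans (lerD (modulusD _ _) (lexx _)) _.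
apply: le_trans (lerD (lerD (modulusD _ _) (lexx _)) (lexx _)) _.
by move: h1 h2 h3 h4 => /=; lra.
Qed.

(** Otherwise a nested sequence of bad rectangles shrinks to a point. There H is affine up to a
    small relative error, so that the sums at step k fall below e / 4^k for every n. *)
Lemma goursat : exists m, forall n, (m <= n)%N ->
  modulus (contour_sum n s t a b) <= e.
Proof.
apply: contrapT => hbad.
have bad0 : bad 0 (s, t).
  move=> m; apply: contrapT => h; apply: hbad; exists m => n mn.
  rewrite leNgt; apply/negP => hn; apply: h; exists n => //.
  by rewrite /ak /bk !expr0 !divr1.
have [next nextP] := choice (fun kp : nat * (R * R) => step kp.1 kp.2).
pose p := fix p k := if k is k'.+1 then next (k', p k') else (s, t).
have pbad k : bad k (p k).
  by elim: k => // k IH; have [] := nextP (k, p k) IH.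
have pstep1 k : (p k).1 <= (p k.+1).1 <= (p k).1 + ak k.+1.
  by have [] := nextP (k, p k) (pbad k).
have pstep2 k : (p k).2 <= (p k.+1).2 <= (p k).2 + bk k.+1.
  by have [] := nextP (k, p k) (pbad k).
have lim (x d : nat -> R) : (forall k, 0 < d k) -> (forall k, d k = 2 * d k.+1) ->
    (forall k, x k <= x k.+1 <= x k + d k.+1) ->
    exists l, forall k, x k <= l <= x k + d k.
  move=> d0 dS xS.
  have incr k m : x k <= x (k + m)%N.
    elim: m => [|m IH]; first by rewrite addn0.
    by rewrite addnS (le_trans IH) //; case/andP: (xS (k + m)%N).
  have decr k m : x (k + m)%N + d (k + m)%N <= x k + d k.
    elim: m => [|m IH]; first by rewrite addn0.
    rewrite addnS; apply: le_trans IH; case/andP: (xS (k + m)%N) => _.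
    have := dS (k + m)%N; lra.
  have ub k m : x m <= x k + d k.
    have [km|/ltnW mk] := leqP k m.
      rewrite -(subnKC km); apply: le_trans (decr k (m - k)%N).
      by rewrite lerDl ltW.
    apply: le_trans (incr m (k - m)%N) _; rewrite subnKC //.
    by rewrite lerDl ltW.
  have hs : has_sup (range x).
    by split; [exists (x 0%N), 0%N | exists (x 0%N + d 0%N) => _ [m _ <-]].
  exists (sup (range x)) => k; apply/andP; split.
    by apply: ub_le_sup; [case: hs | exists k].
  by apply: ge_sup; [case: hs | move=> _ [m _ <-]].
have [l1 hl1] : exists l, forall k, (p k).1 <= l <= (p k).1 + ak k.
  by apply: lim pstep1 => // k; rewrite -akS; field.
have [l2 hl2] : exists l, forall k, (p k).2 <= l <= (p k).2 + bk k.
  by apply: lim pstep2 => // k; rewrite -bkS; field.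
have l1s : s <= l1 <= s + a by have := hl1 0%N; rewrite /= /ak expr0 divr1.
have [B hB] := Hdiff l2 l1s.
have c1 : 0 < modulus c + 1 by rewrite ltr_wpDl // modulus_ge0.
(* The constant for which the bound 2 (|c| + 1) (ak + bk) times the error allowed on the k-th
   rectangle is exactly e / 4^k. *)
have c0 : 0 < 4 * (modulus c + 1) * (a + b) ^+ 2.
  by rewrite !mulr_gt0 //; exact: addr_gt0.
have [del del0 hdel] := hB _ (divr_gt0 e0 c0).
have [k kdel] : exists k, (a + b) / 2 ^+ k < del.
  have [k hk] : exists k : nat, (a + b) / del < k%:R.
    exists (Num.bound ((a + b) / del)); apply: archi_boundP.
    by rewrite divr_ge0 ?ltW // addr_gt0.
  exists k; rewrite ltr_pdivrMr ?exprn_gt0 // mulrC -ltr_pdivrMr //.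
  apply: lt_trans hk _; rewrite -natrX ltr_nat; exact: ltn_expl.
have [n _] := pbad k 0%N; rewrite ltNge => /negP; apply.
have abk : ak k + bk k = (a + b) / 2 ^+ k by rewrite /ak /bk mulrDl.
have -> : e / 4 ^+ k = 2 * (modulus c + 1) * (ak k + bk k) *
    (e / (4 * (modulus c + 1) * (a + b) ^+ 2) * (2 * (ak k + bk k))).
  have -> : (4 : R) ^+ k = 2 ^+ k * 2 ^+ k by rewrite -exprMn -natrM.
  by rewrite abk; field; rewrite expf_neq0 // !gt_eqF // addr_gt0.
apply: (@contour_sum_small _ _ _ _ _ l1 l2 B); rewrite ?ltW //.
move=> s' t' hs' ht'.
have hs'' : `|s' - l1| <= ak k.
  have := hl1 k; rewrite ler_norml; move: hs'; lra.
have ht'' : `|t' - l2| <= bk k.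
  have := hl2 k; rewrite ler_norml; move: ht'; lra.
have := ak0 k; have := bk0 k => ? ?.
apply: le_trans (hdel _ _ _ _) _.
- by apply: le_lt_trans hs'' _; apply: le_lt_trans kdel; rewrite -abk; lra.
- by apply: le_lt_trans ht'' _; apply: le_lt_trans kdel; rewrite -abk; lra.
rewrite ler_wpM2l //; first by rewrite divr_ge0 // ltW.
lra.
Qed.
End Goursat.

(** * Averages over roots of unity are asymptotically independent of the circle *)

Section CircleAverages.
Variable R : realType.
Local Notation C := R[i].
Local Notation cis := (@torus_pt R).

Lemma cis_2pi : cis (2 * pi) = 1.
Proof. by rewrite /torus_pt mulr_natl cos2pi sin2pi. Qed.

Definition root2 n : C := cis (2 * pi / 2 ^+ n).

Lemma root2X n j : root2 n ^+ j = cis (2 * pi * j%:R / 2 ^+ n).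
Proof. by rewrite /root2 cisX mulrAC. Qed.

Lemma root2_prim n : (2 ^ n).-primitive_root (root2 n).
Proof.
case: n => [|n].
  have [m m1] := prim_order_exists (isT : (0 < 1)%N) (expr1 (1 : C)).
  by rewrite dvdn1 /root2 expr0 divr1 cis_2pi => /eqP mE; rewrite expn0 -mE.
apply: prim_root_pow2; rewrite root2X natrX.
have -> : 2 * pi * 2 ^+ n / 2 ^+ n.+1 = pi :> R.
  by rewrite exprS; field; rewrite expf_neq0.
by rewrite /torus_pt cospi sinpi; apply/eqP; rewrite eq_complex /= oppr0 !eqxx.
Qed.

Lemma polar (z : C) : z != 0 -> exists s t, z = cexp s t /\ expR s = modulus z.
Proof.
move=> z0; have m0 : 0 < modulus z by rewrite modulus_gt0.
pose u := z / (modulus z)%:C%C.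
have u1 : modulus u = 1.
  by rewrite modulusM modulusV modulus_real gtr0_norm // divff // gt_eqF.
have [t ut] : exists t, u = cis t.
  case: u u1 => x y; rewrite /modulus normc_def /= => /(congr1 (fun x => x ^+ 2)).
  rewrite expr1n sqr_sqrtr ?addr_ge0 ?sqr_ge0 // => xy.
  have x1 : -1 <= x <= 1.
    by rewrite -ler_norml -(ler_pXn2r (n := 2)) ?nnegrE // expr1n real_normK ?num_real //
      -xy lerDl sqr_ge0.
  have sx : sin (acos x) ^+ 2 = y ^+ 2.
    by rewrite sin2cos2 acosK // -xy addrC addKr.
  have [y0|/ltW y0] := leP 0 y.
    exists (acos x); rewrite /torus_pt acosK //; congr (_ +i* _)%C.
    apply/eqP; rewrite -(eqrXn2 (n := 2)) // ?sx //.
    by rewrite sin_acos // sqrtr_ge0.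
  exists (- acos x); rewrite /torus_pt cosN acosK // sinN; congr (_ +i* _)%C.
  apply/eqP; rewrite -eqr_oppLR -(eqrXn2 (n := 2)) ?oppr_ge0 ?sqrrN ?sx //.
  by rewrite sin_acos // sqrtr_ge0.
exists (ln (modulus z)), t; rewrite /cexp lnK // -ut /u; split=> //.
rewrite mulrC divfK //; by rewrite -modulus_eq0 modulus_real gtr0_norm // gt_eqF.
Qed.

Definition average (h : C -> C) n (z : C) : C :=
  (2 ^ n)%:R^-1 * \sum_(j < 2 ^ n) h (z * root2 n ^+ j).

Lemma average_rsum h n s t :
  rsum (fun y => h (cexp s y)) n t (2 * pi) = (2 * pi)%:C%C * average h n (cexp s t).
Proof.
rewrite /rsum /average mulrA big_mkord; congr (_ * _).
  by rewrite -natrX -(rmorph_nat (real_complex R)) -fmorphV -rmorphM.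
apply: eq_bigr => j _; congr h; rewrite root2X -[in LHS](addr0 s) cexpD.
by rewrite /cexp expR0 mul1r.
Qed.

Definition vanishes (u : nat -> C) := forall e : R, 0 < e ->
  exists m, forall n, (m <= n)%N -> modulus (u n) <= e.

Lemma vanishesD u v : vanishes u -> vanishes v -> vanishes (fun n => u n + v n).
Proof.
move=> hu hv e e0; have e2 : 0 < e / 2 by rewrite divr_gt0.
have [m1 h1] := hu _ e2; have [m2 h2] := hv _ e2.
exists (maxn m1 m2) => n; rewrite geq_max => /andP[/h1 {}h1 /h2 {}h2].
by apply: le_trans (modulusD _ _) _; lra.
Qed.

Lemma vanishesN u : vanishes u -> vanishes (fun n => - u n).
Proof.
by move=> hu e e0; have [m h] := hu _ e0; exists m => n; rewrite modulusN; exact: h.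
Qed.

(** The chain rule in logarithmic coordinates: complex derivability of h gives one complex slope in
    the variable s + i t, the kind of affine function on which contour sums vanish. *)
Lemma comp_cexp_approx (h : C -> C) s0 t0 :
  derivable (h : C^o -> C^o) (cexp s0 t0 : C^o) (1 : C^o) -> exists B : C,
  forall e : R, 0 < e -> exists2 del : R, 0 < del & forall s t,
    `|s - s0| < del -> `|t - t0| < del ->
    modulus (h (cexp s t) - h (cexp s0 t0) - B * ((s - s0)%:C%C + 'i%C * (t - t0)%:C%C))
      <= e * (`|s - s0| + `|t - t0|).
Proof.
set z0 := cexp s0 t0 => hd.
have [d hz] : exists d, is_derive (z0 : C^o) (1 : C^o) (h : C^o -> C^o) d.
  by eexists; exact: derivableP.
exists (d * z0) => e e0; have d0 := modulus_ge0 d.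
pose m1 := modulus d + 1; have m10 : 0 < m1 by rewrite ltr_wpDl.
have [e1 [e10 e11 e1e]] : exists e1 : R, [/\ 0 < e1, e1 <= 1 & e1 * m1 <= e / 2].
  exists (Num.min 1 (e / 2 / m1)); split.
  - by rewrite lt_min ltr01 !divr_gt0.
  - by rewrite ge_min lexx.
  - by rewrite -ler_pdivlMr // ge_min lexx orbT.
(* Since [e1] <= 1, |z - z0| is at most (exp s0 + 1) times [sig]. *)
pose m2 := expR s0 + 1; have m20 : 0 < m2 by rewrite ltr_wpDl ?expR_ge0.
pose e2 := e / 2 / m2; have e20 : 0 < e2 by rewrite !divr_gt0.
have e20C : 0 < e2%:C%C :> C by rewrite ltr0c.
have [del2C del20C h2] := is_derive_approx hz e20C.
have [del2 del2E] : exists x : R, del2C = x%:C%C.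
  by exists (complex.Re del2C); rewrite RRe_real // gtr0_real.
rewrite {}del2E in del20C h2; have del20 : 0 < del2 by rewrite -ltr0c.
have [del1 del10 h1] := cexp_approx s0 t0 e10.
exists (Num.min del1 (del2 / m2 / 2)); first by rewrite lt_min del10 !divr_gt0.
move=> s t; rewrite !lt_min => /andP[sd1 sd2] /andP[td1 td2].
set sig := `|s - s0| + `|t - t0|.
have {h1} := h1 _ _ sd1 td1; rewrite -/z0 -/sig.
set w := (s - s0)%:C%C + _ => h1.
have wsig : modulus w <= sig by exact: modulus_rect.
have sig0 : 0 <= sig by rewrite addr_ge0.
set z := cexp s t in h1 *.
have zz0 : modulus (z - z0) <= m2 * sig.
  have -> : z - z0 = (z - z0 - z0 * w) + z0 * w by rewrite subrK.
  apply: le_trans (modulusD _ _) _; rewrite modulusM modulus_cexp /m2.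
  have := expR_ge0 s0; nra.
have zd : modulus (z - z0) < del2.
  apply: le_lt_trans zz0 _; rewrite mulrC -ltr_pdivlMr //.
  by rewrite /sig; lra.
have {}h2 : modulus (h z - h z0 - d * (z - z0)) <= e / 2 * sig.
  have := h2 (z - z0); rewrite !modulusE ltcR -rmorphM lecR => /(_ zd).
  rewrite (_ : z0 + (z - z0) = z); last by ring.
  move=> /le_trans; apply.
  have -> : e / 2 * sig = e2 * (m2 * sig) by rewrite mulrA /e2 divfK // gt_eqF.
  by rewrite ler_wpM2l // ltW.
have -> : h z - h z0 - d * z0 * w =
  (h z - h z0 - d * (z - z0)) + d * (z - z0 - z0 * w) by ring.
apply: le_trans (modulusD _ _) _; rewrite modulusM.
have : modulus d * modulus (z - z0 - z0 * w) <= m1 * (e1 * sig).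
  by apply: ler_pM; rewrite ?modulus_ge0 // /m1 lerDl.
have : m1 * (e1 * sig) <= e / 2 * sig by rewrite mulrA ler_wpM2r // mulrC.
lra.
Qed.

Section Annulus.
Variable h : C -> C.
Hypothesis hd : forall z, z != 0 -> modulus z < 1 ->
  derivable (h : C^o -> C^o) (z : C^o) (1 : C^o).

(** In logarithmic coordinates the contour is a parallelogram of height 2 pi. Its two sides of slope
    k cancel by periodicity, and its vertical sides are the two averages. The slope joins points
    with different arguments; s + i (t + k s) = c s + i t explains [c]. *)
Let average_slant s a t k : 0 < a -> s + a < 0 ->
  vanishes (fun n => average h n (cexp (s + a) (t + k * (s + a))) -
                     average h n (cexp s (t + k * s))).
Proof.
move=> a0 sa0 e e0; pose c : C := 1 + 'i%C * k%:C%C.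
pose H s t := h (cexp s (t + k * s)).
have b0 : 0 < 2 * pi :> R by rewrite mulr_gt0 // pi_gt0.
have Hd s0 t0 : s <= s0 <= s + a -> exists B : C,
    forall e : R, 0 < e -> exists2 del : R, 0 < del & forall s' t',
    `|s' - s0| < del -> `|t' - t0| < del ->
    modulus (H s' t' - H s0 t0 - B * (c * (s' - s0)%:C%C + 'i%C * (t' - t0)%:C%C)) <=
    e * (`|s' - s0| + `|t' - t0|).
  move=> /andP[_ s0a].
  have z00 : cexp s0 (t0 + k * s0) != 0 by rewrite -modulus_gt0 modulus_cexp expR_gt0.
  have z01 : modulus (cexp s0 (t0 + k * s0)) < 1.
    by rewrite modulus_cexp -expR0 ltr_expR (le_lt_trans s0a).
  have [B hB] := comp_cexp_approx (hd z00 z01).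
  have k0 := normr_ge0 k; pose M := 1 + `|k|; have M0 : 0 < M by rewrite ltr_wpDr.
  exists B => {e e0} e e0; have [del del0 {}hB] := hB _ (divr_gt0 e0 M0).
  exists (del / M) => [|s' t' sd td]; first by rewrite divr_gt0.
  have kE : t' + k * s' - (t0 + k * s0) = (t' - t0) + k * (s' - s0) by ring.
  have kn : `|t' + k * s' - (t0 + k * s0)| <= `|t' - t0| + `|k| * `|s' - s0|.
    by rewrite kE -normrM ler_normD.
  rewrite ltr_pdivlMr // in sd; rewrite ltr_pdivlMr // in td.
  have sd0 := normr_ge0 (s' - s0); have td0 := normr_ge0 (t' - t0).
  have h1 : `|s' - s0| < del by apply: le_lt_trans sd; rewrite ler_peMr // /M lerDl.
  have h2 : `|t' + k * s' - (t0 + k * s0)| < del.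
    apply: le_lt_trans kn _; rewrite /M in sd td; 
    have [st|ts] := leP `|s' - s0| `|t' - t0|; nra.
  have := hB _ _ h1 h2; rewrite -/(H s' t') -/(H s0 t0).
  have <- : c * (s' - s0)%:C%C + 'i%C * (t' - t0)%:C%C =
     (s' - s0)%:C%C + 'i%C * (t' + k * s' - (t0 + k * s0))%:C%C :> C.
    by rewrite kE /c !rmorphD !rmorphM !rmorphD !rmorphN /=; ring.
  move=> /le_trans; apply; rewrite -mulrA ler_wpM2l ?(ltW e0) //.
  rewrite mulrC ler_pdivrMr // /M; move: kn; nra.
have e20 : 0 < 2 * pi * e by rewrite mulr_gt0.
have [m hm] := @goursat R c H s t a (2 * pi) a0 b0 Hd _ e20; exists m => n mn; have := hm _ mn.
rewrite /contour_sum.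
have -> : rsum (H ^~ (t + 2 * pi)) n s a = rsum (H ^~ t) n s a.
  apply: eq_rsum => y; rewrite /H; congr h.
  by rewrite addrAC /cexp cisD cis_2pi mulr1.
have Hr s1 : rsum (H s1) n t (2 * pi) = (2 * pi)%:C%C * average h n (cexp s1 (t + k * s1)).
  rewrite -average_rsum /rsum; congr (_ * _); apply: eq_bigr => j _.
  by rewrite /H addrAC.
rewrite (Hr s) (Hr (s + a)); move: (rsum _ _ _ _) (average _ _ _) (average _ _ _).
move=> X B A.
have -> : c * X + 'i%C * ((2 * pi)%:C%C * A) - c * X - 'i%C * ((2 * pi)%:C%C * B) =
  'i%C * ((2 * pi)%:C%C * (A - B)) by ring.
by rewrite !modulusM modulusi mul1r modulus_real gtr0_norm // ler_pM2l.
Qed.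

Let average_lt z z' : z != 0 -> modulus z < modulus z' -> modulus z' < 1 ->
  vanishes (fun n => average h n z' - average h n z).
Proof.
move=> z0 zz' z'1; have z'0 : z' != 0.
  by rewrite -modulus_gt0 (le_lt_trans _ zz') // modulus_ge0.
have [s [t [zE sE]]] := polar z0; have [s' [t' [zE' sE']]] := polar z'0.
have ss' : 0 < s' - s by rewrite subr_gt0 -ltr_expR sE sE'.
have s'0 : s + (s' - s) < 0 by rewrite addrC subrK -ltr_expR expR0 sE'.
pose k := (t' - t) / (s' - s).
have := average_slant (t - k * s) k ss' s'0; rewrite addrC subrK subrK -zE.
suff -> : t - k * s + k * s' = t' by rewrite -zE'.
have -> : t - k * s + k * s' = t + k * (s' - s) by ring.
by rewrite /k divfK ?gt_eqF // addrC subrK.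
Qed.

(** [average_lt] needs strictly increasing moduli, so both points are compared with a real point of
    larger modulus. *)
Lemma average_annulus z z' : z != 0 -> modulus z < 1 -> z' != 0 -> modulus z' < 1 ->
  vanishes (fun n => average h n z' - average h n z).
Proof.
move=> z0 z1 z'0 z'1.
pose r := (1 + Num.max (modulus z) (modulus z')) / 2.
have r1 : r < 1 by rewrite /r; have : Num.max (modulus z) (modulus z') < 1;
  [by rewrite gt_max z1 | lra].
have [zr z'r] : modulus z < r /\ modulus z' < r.
  have : modulus z <= Num.max (modulus z) (modulus z') by rewrite le_max lexx.
  have : modulus z' <= Num.max (modulus z) (modulus z') by rewrite le_max lexx orbT.
  by rewrite /r; split; lra.
have mr : modulus (r%:C%C : C) = r.
  by rewrite modulus_real gtr0_norm // (le_lt_trans _ zr) // modulus_ge0.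
have h1 : vanishes (fun n => average h n r%:C%C - average h n z).
  by apply: average_lt; rewrite ?mr.
have h2 : vanishes (fun n => average h n r%:C%C - average h n z').
  by apply: average_lt; rewrite ?mr.
move=> e e0; have [m hm] := vanishesD h1 (vanishesN h2) e0.
exists m => n /hm; congr (modulus _ <= _); ring.
Qed.
End Annulus.
End CircleAverages.

(** * Limits of bounded sequences along an ultrafilter *)

Section UltraLimit.
Variable R : realType.
Local Notation C := R[i].
Variable U : set_system nat.
Context {UU : UltraFilter U}.
Hypothesis U_infty : forall m, U [set n | (m <= n)%N].

(** Averages over roots of unity are visibly bounded while their convergence is not yet known. An
    ultrafilter gives every bounded sequence a limit, and these limits are linear. *)
Definition ulim (u : nat -> C) (l : C) :=
  forall e : R, 0 < e -> U [set n | modulus (u n - l) <= e].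

Lemma ulim_real (u : nat -> R) M : (forall n, `|u n| <= M) ->
  exists l : R, forall e : R, 0 < e -> U [set n | `|u n - l| <= e].
Proof.
move=> uM; pose S := [set x | U [set n | x <= u n]].
have uM' n : - M <= u n <= M by rewrite -ler_norml.
have hS : has_sup S.
  split; first by exists (- M); apply: filterS filterT => n _; case/andP: (uM' n).
  exists M => x /filter_ex[n /= xn]; apply: le_trans xn _.
  by case/andP: (uM' n).
exists (sup S) => e e0.
have [x Sx xl] := sup_adherent e0 hS.
have nS : ~ S (sup S + e).
  move=> /(ub_le_sup hS.2); lra.
have {nS} hU : U [set n | u n < sup S + e].
  have [//|h] := in_ultra_setVsetC [set n | sup S + e <= u n] UU.
  apply: filterS h => n /=; rewrite ltNge => hn; exact/negP.
apply: filterS2 Sx hU => n /= h1 h2; rewrite ler_norml; lra.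
Qed.

Lemma ulim_bounded (u : nat -> C) M : (forall n, modulus (u n) <= M) ->
  exists l, ulim u l.
Proof.
move=> uM.
have [x hx] := @ulim_real (fun n => complex.Re (u n)) M
  (fun n => le_trans (modulus_Re _) (uM n)).
have Im_le z : `|complex.Im z| <= modulus (z : C).
  have := modulus_Re (z * 'i%C); rewrite ReiNIm normrN modulusM modulusi mulr1.
  by [].
have [y hy] := @ulim_real (fun n => complex.Im (u n)) M
  (fun n => le_trans (Im_le _) (uM n)).
exists (x +i* y)%C => e e0; have e2 : 0 < e / 2 by rewrite divr_gt0.
apply: filterS2 (hx _ e2) (hy _ e2) => n /= h1 h2.
apply: le_trans (modulus_ReIm _) _.
by case: (u n) h1 h2 => a b /=; lra.
Qed.

Lemma ulim_cst c : ulim (fun=> c) c.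
Proof. by move=> e e0; apply: filterS filterT => n _ /=; rewrite subrr modulus0 ltW. Qed.

Lemma ulimD u v a b : ulim u a -> ulim v b -> ulim (fun n => u n + v n) (a + b).
Proof.
move=> hu hv e e0; have e2 : 0 < e / 2 by rewrite divr_gt0.
apply: filterS2 (hu _ e2) (hv _ e2) => n /= h1 h2.
have -> : u n + v n - (a + b) = (u n - a) + (v n - b) by ring.
by apply: le_trans (modulusD _ _) _; lra.
Qed.

Lemma ulimZ c u a : ulim u a -> ulim (fun n => c * u n) (c * a).
Proof.
move=> hu e e0; have m0 := modulus_ge0 c.
have m1 : 0 < modulus c + 1 by rewrite ltr_wpDl.
apply: filterS (hu _ (divr_gt0 e0 m1)) => n /=; rewrite ler_pdivlMr // -mulrBr modulusM.
by have := modulus_ge0 (u n - a); nra.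
Qed.

Lemma ulim_sum (I : Type) (r : seq I) (u : I -> nat -> C) (a : I -> C) :
  (forall i, ulim (u i) (a i)) ->
  ulim (fun n => \sum_(i <- r) u i n) (\sum_(i <- r) a i).
Proof.
move=> h; elim: r => [|i r IH].
  rewrite big_nil; have -> : (fun n : nat => \sum_(i <- [::]) u i n) = (fun=> 0).
    by apply/funext => n; rewrite big_nil.
  exact: ulim_cst.
rewrite big_cons; have -> : (fun n => \sum_(j <- i :: r) u j n) =
    (fun n => u i n + \sum_(j <- r) u j n).
  by apply/funext => n; rewrite big_cons.
exact: ulimD.
Qed.

Lemma ulim_vanishes u a : vanishes (fun n => u n - a) -> ulim u a.
Proof. by move=> hu e /hu[m hm]; apply: filterS (U_infty m). Qed.

Lemma ulim_le u a b (M : R) m : ulim u a ->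
  (forall n, (m <= n)%N -> modulus (u n - b) <= M) -> modulus (a - b) <= M.
Proof.
move=> hu uM; apply/ler_addgt0Pr => e e0.
have [n /= [h1 h2]] := filter_ex (filterI (hu _ e0) (U_infty m)).
have -> : a - b = (u n - b) - (u n - a) by ring.
by apply: le_trans (modulusB _ _) _; rewrite lerD // uM.
Qed.

End UltraLimit.

(** * Power series of bounded analytic functions, with remainder bounds *)

Section PowerSeries.
Variable R : realType.
Local Notation C := R[i].

Lemma ex_ultra : exists2 U : set_system nat, UltraFilter U &
  forall m, U [set n | (m <= n)%N].
Proof.
have [U [UU hU]] := @ultraFilterLemma nat \oo _.
by exists U => // m; apply: hU; exists m.
Qed.

Lemma derivable_continuous (g : C -> C) z :
  derivable (g : C^o -> C^o) (z : C^o) (1 : C^o) ->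
  forall e : R, 0 < e -> exists2 del : R, 0 < del &
    forall u, modulus (u - z) < del -> modulus (g u - g z) <= e.
Proof.
move=> hd e e0.
have [d hz] : exists d, is_derive (z : C^o) (1 : C^o) (g : C^o -> C^o) d.
  by eexists; exact: derivableP.
have [del1C del10C h] := is_derive_approx hz (ltr01 : 0 < 1 :> C).
have [del1 del1E] : exists x : R, del1C = x%:C%C.
  by exists (complex.Re del1C); rewrite RRe_real // gtr0_real.
rewrite {}del1E in del10C h; have del10 : 0 < del1 by rewrite -ltr0c.
have m0 := modulus_ge0 d; have m1 : 0 < modulus d + 1 by rewrite ltr_wpDl.
exists (Num.min del1 (e / (modulus d + 1))); first by rewrite lt_min del10 divr_gt0.
move=> u; rewrite lt_min ltr_pdivlMr // => /andP[u1 u2].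
have := h (u - z); rewrite (_ : z + (u - z) = u); last by ring.
rewrite mul1r !modulusE ltcR lecR => /(_ u1) hu.
have -> : g u - g z = (g u - g z - d * (u - z)) + d * (u - z) by ring.
by apply: le_trans (modulusD _ _) _; rewrite modulusM; nra.
Qed.

Lemma bernoulli_ge (d : R) k : 0 <= d <= 1 -> 1 - k%:R * d <= (1 - d) ^+ k.
Proof.
move=> /andP[d0 d1]; elim: k => [|k IH]; first by rewrite mul0r subr0 expr0.
have h : 0 <= 1 - d by rewrite subr_ge0.
rewrite exprS; apply: le_trans (ler_wpM2l h IH); rewrite -natr1.
have k0 : 0 <= k%:R :> R by []. 
nra.
Qed.

Lemma radius_lim (a b : R) k : 0 <= a ->
  (forall r : R, 0 < r < 1 -> a * r ^+ k <= b) -> a <= b.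
Proof.
move=> a0 h; rewrite leNgt; apply/negP => ba.
have k0 : 0 <= k%:R * a by rewrite mulr_ge0.
pose d := Num.min (1 / 2) ((a - b) / 2 / (k%:R * a + 1)).
have p1 : 0 < k%:R * a + 1 by rewrite ltr_wpDl.
have d0 : 0 < d by rewrite lt_min !divr_gt0 // subr_gt0.
have d1 : d <= 1 / 2 by rewrite ge_min lexx.
have d2 : d * (k%:R * a + 1) <= (a - b) / 2.
  by rewrite -ler_pdivlMr // ge_min lexx orbT.
have r01 : 0 < 1 - d < 1 by lra.
have := h _ r01; have := @bernoulli_ge d k; rewrite (ltW d0) /= => /(_ ltac:(lra)).
move=> /(ler_wpM2l a0) h1 h2; have := le_trans h1 h2; nra.
Qed.

Lemma average_bound (h : C -> C) n z M :
  (forall u, modulus u = modulus z -> modulus (h u) <= M) ->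
  modulus (average h n z) <= M.
Proof.
move=> hM; rewrite /average modulusM modulusV modulus_nat.
rewrite mulrC ler_pdivrMr ?ltr0n ?expn_gt0 //.
apply: le_trans (modulus_sum _ _ _) _.
have -> : M * (2 ^ n)%:R = \sum_(j < 2 ^ n) M by rewrite sumr_const card_ord mulr_natr.
apply: ler_sum => j _; apply: hM.
by rewrite modulusM modulusX modulus_cis expr1n mulr1.
Qed.

Lemma averageB (f g : C -> C) n z :
  average (fun u => f u - g u) n z = average f n z - average g n z.
Proof. by rewrite /average sumrB mulrBr. Qed.

Variables (g : C -> C) (B : R).
Hypothesis gd : forall z, modulus z < 1 ->
  derivable (g : C^o -> C^o) (z : C^o) (1 : C^o).
Hypothesis gB : forall z, modulus z < 1 -> modulus (g z) <= B.

Let B0 : 0 <= B.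
Proof. by apply: le_trans (modulus_ge0 _) (gB (z := 0) _); rewrite modulus0. Qed.

Let gdown k z := g z / z ^+ k.
Let gup k z := g z * z ^+ k.

Let gdown_derivable k z : z != 0 -> modulus z < 1 ->
  derivable (gdown k : C^o -> C^o) (z : C^o) (1 : C^o).
Proof.
move=> z0 z1; apply: derivableM; first exact: gd.
apply: derivableV; first by rewrite expf_neq0.
exact: exprn_derivable.
Qed.

Let gup_derivable k z : modulus z < 1 ->
  derivable (gup k : C^o -> C^o) (z : C^o) (1 : C^o).
Proof. by move=> z1; apply: derivableM; [exact: gd|exact: exprn_derivable]. Qed.

(** The averages do not depend on the circle in the limit, and on the circle of radius r they are at
    most B r. *)
Let average_gup k z : z != 0 -> modulus z < 1 -> (0 < k)%N ->
  vanishes (fun n => average (gup k) n z).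
Proof.
move=> z0 z1 k0 e e0.
pose r := Num.min (1 / 2) (e / 2 / (B + 1)).
have B1 : 0 < B + 1 by rewrite ltr_wpDl.
have r0 : 0 < r by rewrite lt_min !divr_gt0.
have r1 : r < 1.
  have : r <= 1 / 2 by rewrite ge_min lexx.
  lra.
have rB : B * r <= e / 2.
  have : r <= e / 2 / (B + 1) by rewrite ge_min lexx orbT.
  rewrite ler_pdivlMr //; nra.
have mr : modulus (r%:C%C : C) = r by rewrite modulus_real gtr0_norm.
have r0C : r%:C%C != 0 :> C by rewrite -modulus_gt0 mr.
have r1C : modulus (r%:C%C : C) < 1 by rewrite mr.
have e2 : 0 < e / 2 by rewrite divr_gt0.
have [m hm] := average_annulus (fun u _ u1 => @gup_derivable k u u1) r0C r1C z0 z1 e2.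
exists m => n /hm.
have hr : modulus (average (gup k) n r%:C%C) <= e / 2.
  apply: average_bound => u; rewrite mr => ur; rewrite modulusM modulusX ur.
  apply: le_trans rB; apply: ler_pM; rewrite ?modulus_ge0 ?exprn_ge0 ?(ltW r0) //.
    by apply: gB; rewrite ur.
  by rewrite -(prednK k0) exprS ler_piMr ?(ltW r0) // exprn_ile1 // ltW.
set x := average _ _ z; set y := average _ _ _ => xy.
have -> : x = (x - y) + y by ring.
by apply: le_trans (modulusD _ _) _; rewrite /y; lra.
Qed.

(** The Fejer kernel. It is a nonnegative approximate identity, so that boundedness and continuity
    of g suffice to recover g z from the Cesaro means of its Taylor sums. *)
Let fejer_weight (m : nat) (z : C) : R := modulus (\sum_(j < m) z ^+ j) ^+ 2 / m%:R.

Let fejer_weightE m z : modulus z = 1 -> (fejer_weight m z)%:C%C =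
  m%:R^-1 * \sum_(j < m) \sum_(l < m) z ^+ l * (z ^+ j)^* :> C.
Proof.
move=> z1; rewrite rmorphM fmorphV rmorph_nat mulrC; congr (_ * _).
rewrite rmorphXn /= -modulusE normCK rmorph_sum mulr_sumr; apply: eq_bigr => j _.
by rewrite mulr_suml.
Qed.

Let fejer_weight_small m z : (0 < m)%N -> modulus z = 1 ->
  modulus (z - 1) ^+ 2 * fejer_weight m z <= 4 / m%:R.
Proof.
move=> m0 z1; rewrite /fejer_weight mulrA ler_wpM2r ?invr_ge0 //.
rewrite -exprMn -modulusM -subrX1.
have h : modulus (z ^+ m - 1) <= 2.
  by apply: le_trans (modulusB _ _) _; rewrite modulusX z1 expr1n modulus1; lra.
have := modulus_ge0 (z ^+ m - 1); rewrite expr2; nra.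
Qed.

Let fejer_weight_mean m n : (0 < m)%N -> (m <= 2 ^ n)%N ->
  (2 ^ n)%:R^-1 * \sum_(a < 2 ^ n) fejer_weight m (root2 R n ^+ a) = 1.
Proof.
move=> m0 mn; apply: (@complexI R); rewrite rmorphM fmorphV rmorph_nat rmorph_sum.
have n0 : (2 ^ n)%:R != 0 :> C by rewrite pnatr_eq0 -lt0n expn_gt0.
have m0' : m%:R != 0 :> C by rewrite pnatr_eq0 -lt0n.
under eq_bigr do rewrite /= fejer_weightE ?modulusX ?modulus_cis ?expr1n //.
rewrite -mulr_sumr exchange_big /=.
rewrite (eq_bigr (fun=> (2 ^ n)%:R)); last first.
  move=> j _; rewrite exchange_big /= (bigD1 j) //= [X in _ + X]big1 ?addr0.
    under eq_bigr do rewrite mulrC -!exprM.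
    by rewrite (prim_root_orthogonal (root2_prim R n)) ?(leq_trans _ mn) // eqxx muln1.
  move=> l lj; under eq_bigr do rewrite mulrC -!exprM.
  rewrite (prim_root_orthogonal (root2_prim R n)) ?(leq_trans _ mn) //.
  by rewrite eq_sym val_eqE (negPf lj) muln0.
rewrite sumr_const card_ord -mulr_natl rmorph1; field.
by rewrite n0 m0'.
Qed.

Variable U : set_system nat.
Context {UU : UltraFilter U}.
Hypothesis U_infty : forall m, U [set n | (m <= n)%N].

Let half : C := (1 / 2 : R)%:C%C.
Let half_modulus : modulus half = 1 / 2.
Proof. by rewrite modulus_real ger0_norm. Qed.
Let half0 : half != 0.
Proof. by rewrite -modulus_gt0 half_modulus. Qed.
Let half1 : modulus half < 1.
Proof. by rewrite half_modulus; lra. Qed.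

Let ex_coef k : exists c, ulim U (fun n => average (gdown k) n half) c.
Proof.
apply: (@ulim_bounded _ _ _ _ (B * 2 ^+ k)) => n.
apply: average_bound => u uh; rewrite modulusM modulusV modulusX uh half_modulus.
rewrite div1r exprVn invrK ler_wpM2r ?exprn_ge0 //.
by apply: gB; rewrite uh.
Qed.

(** The Taylor coefficient as a Cauchy mean of g z / z^k over the circle of radius 1/2; [coefP]
    shows that every other circle gives the same limit. *)
Let c k := projT1 (cid (ex_coef k)).

Let coefP k z : z != 0 -> modulus z < 1 ->
  ulim U (fun n => average (gdown k) n z) (c k).
Proof.
move=> z0 z1; have ck : ulim U (fun n => average (gdown k) n half) (c k).
  by rewrite /c; case: cid.
have := average_annulus (@gdown_derivable k) half0 half1 z0 z1.
move=> v; have v' : ulim U (fun n => average (gdown k) n z - average (gdown k) n half) 0.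
  apply: ulim_vanishes => // e e0; have [m hm] := v _ e0.
  by exists m => n; rewrite subr0; exact: hm.
have h := ulimD v' ck; rewrite add0r in h.
have -> : (fun n => average (gdown k) n z) = (fun n =>
    average (gdown k) n z - average (gdown k) n half + average (gdown k) n half).
  by apply/funext => n; rewrite subrK.
exact: h.
Qed.

Let coef_bound k : modulus (c k) <= B.
Proof.
apply: (@radius_lim _ _ k); first exact: modulus_ge0.
move=> r /andP[r0 r1]; have mr : modulus (r%:C%C : C) = r by rewrite modulus_real gtr0_norm.
have r0C : r%:C%C != 0 :> C by rewrite -modulus_gt0 mr.
have r1C : modulus (r%:C%C : C) < 1 by rewrite mr.
rewrite -ler_pdivlMr ?exprn_gt0 // -[c k]subr0.
apply: (ulim_le U_infty (coefP k r0C r1C) (m := 0)) => n _; rewrite subr0.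
apply: average_bound => u; rewrite mr => ur; rewrite modulusM modulusV modulusX ur.
by rewrite ler_wpM2r ?invr_ge0 ?exprn_ge0 ?(ltW r0) // gB // ur.
Qed.

Let T j z := \sum_(k < j) c k * z ^+ k.

Let fejer_mean (m n : nat) z : C := (2 ^ n)%:R^-1 *
  \sum_(a < 2 ^ n) g (z * root2 R n ^+ a) * (fejer_weight m (root2 R n ^+ a))%:C%C.

(** Expanding the kernel gives averages of g z times z^(l - j). Those with l <= j tend to Taylor
    coefficients, and those with l > j tend to 0 by [average_gup]. What is left is the mean of the
    partial sums T 1, ..., T m. *)
Let fejer_mean_lim m z : z != 0 -> modulus z < 1 ->
  ulim U (fun n => fejer_mean m n z) (m%:R^-1 * \sum_(j < m) T j.+1 z).
Proof.
move=> z0 z1.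
have -> : (fun n => fejer_mean m n z) = (fun n => m%:R^-1 *
    \sum_(j < m) \sum_(l < m) ((if (l <= j)%N then z ^+ (j - l) else z ^- (l - j)) *
      (if (l <= j)%N then average (gdown (j - l)) n z else average (gup (l - j)) n z))).
  apply/funext => n; rewrite /fejer_mean.
  under eq_bigr => a _.
    rewrite fejer_weightE ?modulusX ?modulus_cis ?expr1n //.
    rewrite mulrCA mulr_sumr; under eq_bigr do rewrite mulr_sumr.
    over.
  rewrite -mulr_sumr mulrCA; congr (_ * _); rewrite exchange_big mulr_sumr /=.
  apply: eq_bigr => j _; rewrite exchange_big mulr_sumr /=; apply: eq_bigr => l _.
  have w0 a : root2 R n ^+ a != 0 by rewrite -modulus_gt0 modulusX modulus_cis expr1n.
  have wK a : root2 R n ^+ a * (root2 R n ^+ a)^* = 1.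
    by rewrite unit_conjK // modulusE modulusX modulus_cis expr1n.
  case: leqP => lj; rewrite /average mulrCA; congr (_ * _); rewrite mulr_sumr;
    apply: eq_bigr => a _; rewrite /gdown /gup; set w := root2 R n ^+ a;
    have {}w0 : w != 0 by exact: w0.
    have -> : (w ^+ j)^* = w ^- j.
      rewrite rmorphXn /= -exprVn; congr (_ ^+ _); apply: (mulfI w0).
      by rewrite wK divff.
    rewrite -[in w ^- j](subnK lj) exprD exprMn; field.
    by apply/and3P; split; apply: expf_neq0.
  have -> : (w ^+ j)^* = w ^- j.
    rewrite rmorphXn /= -exprVn; congr (_ ^+ _); apply: (mulfI w0).
    by rewrite wK divff.
  rewrite -[in w ^+ l](subnK (ltnW lj)) exprD exprMn; field.
  by do ![apply/andP; split | exact: expf_neq0].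
apply: ulimZ; apply: ulim_sum => j.
have -> : T j.+1 z = \sum_(l < m) (if (l <= j)%N then z ^+ (j - l) * c (j - l)%N else 0).
  rewrite /T (reindex_inj rev_ord_inj) /=.
  under eq_bigr do rewrite subSS.
  rewrite (big_ord_widen _ (fun l => c (j - l)%N * z ^+ (j - l)) (ltn_ord j)).
  rewrite big_mkcond; apply: eq_bigr => l _; rewrite ltnS mulrC.
  by case: ifP.
apply: ulim_sum => l; case: leqP => lj.
  by apply: ulimZ; exact: coefP.
rewrite -[0](mulr0 (z ^- (l - j))); apply: ulimZ; apply: ulim_vanishes => // e e0.
have l0 : (0 < l - j)%N by rewrite subn_gt0.
by have [m' hm'] := average_gup z0 z1 l0 e0; exists m' => n; rewrite subr0; exact: hm'.
Qed.

(** Near w = 1 use continuity, elsewhere boundedness: together |g (z w) - g z| <= e + K |w - 1|^2.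
    The kernel has mean 1 and is at most 4 / (m |w - 1|^2). *)
Let fejer_mean_close z (e : R) : modulus z < 1 -> 0 < e -> exists K : R, 0 <= K /\
  forall m n, (0 < m)%N -> (m <= 2 ^ n)%N ->
  modulus (fejer_mean m n z - g z) <= e + K / m%:R.
Proof.
move=> z1 e0; have [del del0 hdel] := derivable_continuous (gd z1) e0.
pose K := 2 * B / del ^+ 2.
have K0 : 0 <= K by rewrite !mulr_ge0 ?invr_ge0 ?sqr_ge0.
exists (K * 4); split => [|m n m0 mn]; first by rewrite mulr_ge0.
have n0 : (0 : R) < (2 ^ n)%:R by rewrite ltr0n expn_gt0.
have wt0 w : 0 <= fejer_weight m w by rewrite divr_ge0 ?sqr_ge0.
have -> : fejer_mean m n z - g z = (2 ^ n)%:R^-1 * \sum_(a < 2 ^ n)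
    (g (z * root2 R n ^+ a) - g z) * (fejer_weight m (root2 R n ^+ a))%:C%C.
  under [in RHS]eq_bigr do rewrite mulrBl.
  rewrite sumrB mulrBr -mulr_sumr; congr (_ - _).
  rewrite mulrCA -[LHS]mulr1; congr (_ * _).
  transitivity (((2 ^ n)%:R^-1 *
      \sum_(a < 2 ^ n) fejer_weight m (root2 R n ^+ a))%:C%C : C).
    by rewrite fejer_weight_mean.
  by rewrite rmorphM fmorphV rmorph_nat rmorph_sum.
rewrite modulusM modulusV modulus_nat mulrC ler_pdivrMr //.
apply: le_trans (modulus_sum _ _ _) _.
have -> : (e + K * 4 / m%:R) * (2 ^ n)%:R = \sum_(a < 2 ^ n)
    (e * fejer_weight m (root2 R n ^+ a) + K * 4 / m%:R).
  rewrite big_split /= -mulr_sumr sumr_const card_ord mulrDl; congr (_ + _);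
    last by rewrite mulr_natr.
  congr (_ * _); apply: (mulfI (invr_neq0 (lt0r_neq0 n0))).
  by rewrite fejer_weight_mean // mulVf // gt_eqF.
apply: ler_sum => a _; set w := root2 R n ^+ a.
have w1 : modulus w = 1 by rewrite modulusX modulus_cis expr1n.
have gw : modulus (g (z * w) - g z) <= e + K * modulus (w - 1) ^+ 2.
  have [wd|wd] := ltP (modulus (w - 1)) del.
    apply: (@le_trans _ _ e); last by rewrite lerDl mulr_ge0 ?sqr_ge0.
    apply: hdel; have -> : z * w - z = z * (w - 1) by ring.
    rewrite modulusM; apply: le_lt_trans wd.
    by rewrite ler_piMl ?modulus_ge0 // ltW.
  apply: (@le_trans _ _ (2 * B)).
    apply: le_trans (modulusB _ _) _; rewrite mulr_natl mulr2n lerD // gB //.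
    by rewrite modulusM w1 mulr1.
  apply: (@le_trans _ _ (K * del ^+ 2)).
    by rewrite /K divfK // expf_neq0 // gt_eqF.
  apply: (@le_trans _ _ (K * modulus (w - 1) ^+ 2)); last by rewrite lerDr ltW.
  by rewrite ler_wpM2l // ler_pXn2r // nnegrE ?modulus_ge0 // ltW.
rewrite modulusM modulus_real ger0_norm //.
apply: le_trans (ler_wpM2r (wt0 _) gw) _; rewrite mulrDl lerD2l -!(mulrA K).
by rewrite ler_wpM2l // fejer_weight_small.
Qed.

Let T_diff z M j : modulus z < 1 -> (M <= j)%N ->
  modulus (T j z - T M z) <= B * modulus z ^+ M / (1 - modulus z).
Proof.
move=> z1 Mj; set r := modulus z in z1 *; have r0 : 0 <= r := modulus_ge0 z.
have r1 : 0 < 1 - r by rewrite subr_gt0.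
suff h : modulus (T j z - T M z) <= B * (r ^+ M - r ^+ j) / (1 - r).
  apply: le_trans h _; rewrite ler_pM2r ?invr_gt0 // ler_wpM2l //.
  by rewrite gerBl exprn_ge0.
rewrite -(subnKC Mj); elim: (j - M)%N => [|i IH].
  by rewrite addn0 !subrr modulus0 mulr0 mul0r.
rewrite addnS /T big_ord_recr /= -/(T (M + i) z).
have -> : T (M + i) z + c (M + i)%N * z ^+ (M + i) - T M z =
    (T (M + i) z - T M z) + c (M + i)%N * z ^+ (M + i) by ring.
apply: le_trans (modulusD _ _) _; apply: le_trans (lerD IH (lexx _)) _.
rewrite modulusM modulusX -/r.
have -> : B * (r ^+ M - r ^+ (M + i).+1) / (1 - r) =
    B * (r ^+ M - r ^+ (M + i)) / (1 - r) + B * r ^+ (M + i).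
  by rewrite exprS; field; rewrite gt_eqF.
by rewrite lerD2l ler_wpM2r ?exprn_ge0.
Qed.

Let T_bound z M j : modulus z < 1 ->
  modulus (T j z - T M z) <= B / (1 - modulus z).
Proof.
move=> z1; have r0 := modulus_ge0 z; have r1 : 0 < 1 - modulus z by rewrite subr_gt0.
have h k : B * modulus z ^+ k / (1 - modulus z) <= B / (1 - modulus z).
  by rewrite ler_pM2r ?invr_gt0 // ler_piMr // exprn_ile1 // ltW.
have [Mj|/ltnW jM] := leqP M j; first exact: le_trans (T_diff z1 Mj) (h _).
by rewrite modulus_distC; exact: le_trans (T_diff z1 jM) (h _).
Qed.

Let small_le0 (x K : R) : 0 <= K ->
  (forall m, (0 < m)%N -> x <= K / m%:R) -> x <= 0.
Proof.
move=> K0 h; rewrite leNgt; apply/negP => x0.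
have := archi_boundP (divr_ge0 K0 (ltW x0)); set m := Num.bound _ => hm.
have m0 : (0 < m)%N by rewrite -(ltr0n R); apply: le_lt_trans hm; rewrite divr_ge0 // ltW.
have := h _ m0; rewrite ler_pdivlMr ?ltr0n //; move: hm; rewrite ltr_pdivrMr //.
by rewrite mulrC => /lt_le_trans h' /h'; rewrite ltxx.
Qed.

(** In the mean of T 1, ..., T m at most M terms differ from T M by more than the claimed bound.
    Their share vanishes as m grows, while the mean itself tends to g z. *)
Let partial_sum_close z M : z != 0 -> modulus z < 1 ->
  modulus (g z - T M z) <= B * modulus z ^+ M / (1 - modulus z).
Proof.
move=> z0 z1; have r1 : 0 < 1 - modulus z by rewrite subr_gt0.
set t := B * _ / _; apply/ler_addgt0Pr => e e0.
have [K [K0 hK]] := fejer_mean_close z1 e0.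
rewrite -subr_le0; apply: (@small_le0 _ (K + M%:R * (B / (1 - modulus z)))).
  by rewrite addr_ge0 // !mulr_ge0 // invr_ge0 ltW.
move=> m m0; have m0' : 0 < m%:R :> R by rewrite ltr0n.
pose p := m%:R^-1 * \sum_(j < m) T j.+1 z.
have [n0 hn0] : exists n0, (m <= 2 ^ n0)%N by exists m; rewrite ltnW // ltn_expl.
have pg : modulus (p - g z) <= e + K / m%:R.
  apply: (ulim_le U_infty (fejer_mean_lim m z0 z1) (m := n0)) => n nn0.
  by apply: hK => //; apply: leq_trans hn0 _; rewrite leq_pexp2l.
have pT : modulus (p - T M z) <= t + M%:R * (B / (1 - modulus z)) / m%:R.
  have -> : p - T M z = m%:R^-1 * \sum_(j < m) (T j.+1 z - T M z).
    rewrite sumrB mulrBr sumr_const card_ord -[T M z *+ m]mulr_natl mulKf //.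
    by rewrite pnatr_eq0 -lt0n.
  rewrite modulusM modulusV modulus_nat mulrC ler_pdivrMr // mulrDl divfK ?gt_eqF //.
  apply: le_trans (modulus_sum _ _ _) _.
  have t0 : 0 <= t by rewrite !mulr_ge0 ?exprn_ge0 ?modulus_ge0 // invr_ge0 ltW.
  have L0 : 0 <= B / (1 - modulus z) by rewrite mulr_ge0 // invr_ge0 ltW.
  apply: (@le_trans _ _ (\sum_(j < m) (t + (if (j < M)%N then B / (1 - modulus z) else 0)))).
    apply: ler_sum => j _; case: ltnP => jM.
      by apply: le_trans (T_bound _ _ z1) _; rewrite lerDr.
    by rewrite addr0; apply: T_diff => //; exact: leqW.
  rewrite big_split /= sumr_const card_ord mulr_natr lerD2l -big_mkcond /=.
  rewrite sumr_const -[X in X <= _]mulr_natl ler_wpM2r // ler_nat.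
  rewrite -sum1_card; have [mM|Mm] := leqP m M.
    apply: leq_trans mM; rewrite -[X in (_ <= X)%N]card_ord -sum1_card.
    by rewrite big_mkcond; apply: leq_sum => i _; case: ifP.
  by rewrite -(big_ord_widen _ (fun=> 1%N) (ltnW Mm)) sum1_card card_ord.
have -> : g z - T M z = (p - T M z) - (p - g z) by ring.
have := modulusB (p - T M z) (p - g z); rewrite mulrDl; lra.
Qed.

Lemma power_series_ultra : exists c : nat -> C, (forall k, modulus (c k) <= B) /\
  forall M z, modulus z < 1 ->
    modulus (g z - \sum_(k < M) c k * z ^+ k) <= B * modulus z ^+ M / (1 - modulus z).
Proof.
exists c; split => // M z z1; have [->|z0] := eqVneq z 0; last exact: partial_sum_close.
rewrite modulus0 subr0 divr1; case: M => [|M].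
  by rewrite big_ord0 subr0 expr0 mulr1 gB // modulus0.
rewrite expr0n mulr0 big_ord_recl expr0 mulr1 big1 ?addr0; last first.
  by move=> k _; rewrite expr0n mulr0.
(* At z = 0, where circle averages are void, the claim for a positive number of terms is g 0 = c 0.
   It follows by continuity from the estimate with one term at a small radius. *)
have z01 : modulus (0 : C) < 1 by rewrite modulus0.
apply/ler_addgt0Pr => e e0; rewrite add0r; have e2 : 0 < e / 2 by rewrite divr_gt0.
have [del del0 hdel] := derivable_continuous (gd z01) e2.
pose r := Num.min (1 / 2) (Num.min (del / 2) (e / 2 / (2 * (B + 1)))).
have B1 : 0 < B + 1 by rewrite ltr_wpDl.
have r0 : 0 < r by rewrite !lt_min !divr_gt0 // mulr_gt0.
have r1 : r <= 1 / 2 by rewrite ge_min lexx.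
have r2 : r <= del / 2 by rewrite !ge_min lexx orbT.
have r3 : r * (2 * (B + 1)) <= e / 2.
  by rewrite -ler_pdivlMr ?mulr_gt0 // !ge_min lexx !orbT.
have mr : modulus (r%:C%C : C) = r by rewrite modulus_real gtr0_norm.
have rC0 : r%:C%C != 0 :> C by rewrite -modulus_gt0 mr.
have rC1 : modulus (r%:C%C : C) < 1 by rewrite mr; lra.
have h1 := partial_sum_close 1 rC0 rC1.
rewrite {1}/T big_ord_recl big_ord0 expr0 mulr1 addr0 mr expr1 in h1.
have h2 : modulus (g r%:C%C - g 0) <= e / 2 by apply: hdel; rewrite subr0 mr; lra.
have h3 : B * r / (1 - r) <= e / 2.
  rewrite ler_pdivrMr; last by lra.
  nra.
have -> : g 0 - c 0%N = (g r%:C%C - c 0%N) - (g r%:C%C - g 0) by ring.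
by apply: le_trans (modulusB _ _) _; lra.
Qed.
End PowerSeries.

Lemma power_series (R : realType) (g : R[i] -> R[i]) (B : R) :
  (forall z, modulus z < 1 -> derivable (g : R[i]^o -> R[i]^o) (z : R[i]^o) (1 : R[i]^o)) ->
  (forall z, modulus z < 1 -> modulus (g z) <= B) ->
  exists c : nat -> R[i], (forall k, modulus (c k) <= B) /\
  forall M z, modulus z < 1 ->
    modulus (g z - \sum_(k < M) c k * z ^+ k) <= B * modulus z ^+ M / (1 - modulus z).
Proof.
by move=> gd gB; have [U UU U_infty] := ex_ultra; exact: (power_series_ultra gd gB U_infty).
Qed.

(** * Polynomial approximation on smaller bidisks *)

Section BidiskApproximation.
Variable R : realType.
Local Notation C := R[i].

(** 1 - x^n is 1 - x times a geometric sum of n terms, each at least x^n. This gives an explicit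
    rate at which x^n tends to 0. *)
Lemma expn_geom_bound (x : R) n : 0 <= x <= 1 -> n%:R * x ^+ n * (1 - x) <= 1 - x ^+ n.
Proof.
move=> /andP[x0 x1]; elim: n => [|n IH]; first by rewrite !mul0r expr0 subrr.
have p0 : 0 <= x ^+ n by rewrite exprn_ge0.
have p1 : x ^+ n <= 1 by rewrite exprn_ile1.
have := ler_wpM2l x0 IH; rewrite exprS -natr1.
have xx : 0 <= (1 - x) * (1 - x * x ^+ n) by rewrite mulr_ge0 ?subr_ge0 // mulr_ile1.
nra.
Qed.

Lemma expn_small (x e : R) : 0 <= x < 1 -> 0 < e -> exists n, x ^+ n <= e.
Proof.
move=> /andP[x0 x1] e0; have d0 : 0 < e * (1 - x) by rewrite mulr_gt0 // subr_gt0.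
have d1 : 0 <= (e * (1 - x))^-1 by rewrite invr_ge0 ltW.
have := archi_boundP d1; set n := Num.bound _ => hn; exists n.
have n0 : 0 < n%:R :> R by apply: le_lt_trans hn.
have h : n%:R * x ^+ n * (1 - x) <= 1.
  apply: le_trans (expn_geom_bound n _) _; first by rewrite x0 ltW.
  by rewrite gerBl exprn_ge0.
have h2 : 1 < n%:R * e * (1 - x).
  by rewrite -mulrA -ltr_pdivrMr // div1r.
have h3 := le_lt_trans h h2.
move: h3; rewrite ltr_pM2r ?subr_gt0 // ltr_pM2l //; exact: ltW.
Qed.

Lemma geometric_sum_le (x : R) n : 0 <= x < 1 -> \sum_(k < n) x ^+ k <= (1 - x)^-1.
Proof.
move=> /andP[x0 x1]; have d : 0 < 1 - x by rewrite subr_gt0.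
rewrite -[leRHS]mul1r ler_pdivlMr //.
have -> : (\sum_(k < n) x ^+ k) * (1 - x) = 1 - x ^+ n.
  by rewrite -[1 - x ^+ n]opprB subrX1 -mulNr opprB mulrC.
by rewrite gerBl exprn_ge0.
Qed.

Section Approximation.
Variable phi : C * C -> C.
Hypothesis phid : forall z, bidisk z ->
  differentiable (phi : C^o * C^o -> C^o) (z : C^o * C^o).
Hypothesis phi1 : forall z, bidisk z -> modulus (phi z) <= 1.

Lemma bidisk_modulus (z1 z2 : C) : modulus z1 < 1 -> modulus z2 < 1 -> bidisk (z1, z2).
Proof. by move=> h1 h2; split; rewrite /= modulus_lt1. Qed.

Lemma derivable_line (z v : C * C) (t : C) : bidisk (z.1 + t * v.1, z.2 + t * v.2) ->
  derivable ((fun s => phi (z.1 + s * v.1, z.2 + s * v.2)) : C^o -> C^o)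
    (t : C^o) (1 : C^o).
Proof.
move=> /phid/(@diff_derivable _ _ _ _ _ (v : C^o * C^o)); rewrite /derivable.
set F := (fun h : C => _); set G := (fun h : C => _).
suff -> : F = G by [].
apply/funext => s; rewrite /F /G /=; congr (_ *: (phi _ - _)); congr pair.
  change (s * v.1 + (z.1 + t * v.1) = z.1 + (s * 1 + t) * v.1); ring.
change (s * v.2 + (z.2 + t * v.2) = z.2 + (s * 1 + t) * v.2); ring.
Qed.

Lemma derivable_fst z1 z2 : modulus z1 < 1 -> modulus z2 < 1 ->
  derivable ((fun s => phi (s, z2)) : C^o -> C^o) (z1 : C^o) (1 : C^o).
Proof.
move=> h1 h2; have -> : (fun s => phi (s, z2)) = (fun s => phi (0 + s * 1, z2 + s * 0)).
  by apply/funext => s; rewrite mulr1 mulr0 add0r addr0.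
apply: (@derivable_line (0, z2) (1, 0)) => /=.
by rewrite mulr1 mulr0 add0r addr0; exact: bidisk_modulus.
Qed.

Lemma derivable_snd z1 z2 : modulus z1 < 1 -> modulus z2 < 1 ->
  derivable ((fun s => phi (z1, s)) : C^o -> C^o) (z2 : C^o) (1 : C^o).
Proof.
move=> h1 h2; have -> : (fun s => phi (z1, s)) = (fun s => phi (z1 + s * 0, 0 + s * 1)).
  by apply/funext => s; rewrite mulr1 mulr0 add0r addr0.
apply: (@derivable_line (z1, 0) (0, 1)) => /=.
by rewrite mulr1 mulr0 add0r addr0; exact: bidisk_modulus.
Qed.

Let half : C := (1 / 2 : R)%:C%C.
Let half_modulus : modulus half = 1 / 2.
Proof. by rewrite modulus_real ger0_norm. Qed.
Let half0 : half != 0.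
Proof. by rewrite -modulus_gt0 half_modulus. Qed.

Lemma average_monomial n k l : (k < 2 ^ n)%N -> (l < 2 ^ n)%N ->
  average (fun u => u ^+ l / u ^+ k) n half = (k == l)%:R.
Proof.
move=> kn ln; rewrite /average.
have w1 j : `|root2 R n ^+ j| = 1 by rewrite modulusE modulusX modulus_cis expr1n.
rewrite (eq_bigr (fun j : 'I_(2 ^ n) => (half ^+ l / half ^+ k) *
  ((root2 R n ^+ (j * k))^* * root2 R n ^+ (j * l)))).
  rewrite -mulr_sumr (prim_root_orthogonal (root2_prim R n)) //.
  have n0 : (2 ^ n)%:R != 0 :> C by rewrite pnatr_eq0 -lt0n expn_gt0.
  case: eqP => [->|_]; last by rewrite muln0 !mulr0.
  by rewrite muln1 divff ?expf_neq0 // mul1r mulVf.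
move=> j _; rewrite !exprMn invfM -!exprM.
have -> : (root2 R n ^+ (j * k))^-1 = (root2 R n ^+ (j * k))^*.
  have w0 : root2 R n ^+ (j * k) != 0 by rewrite -normr_gt0 w1.
  by apply: (mulfI w0); rewrite divff // unit_conjK.
ring.
Qed.

Lemma average_sum (I : Type) (r : seq I) (f : I -> C -> C) n z :
  average (fun u => \sum_(i <- r) f i u) n z = \sum_(i <- r) average (f i) n z.
Proof.
rewrite /average; under eq_bigr do rewrite /=.
by rewrite exchange_big mulr_sumr.
Qed.

Lemma averageZ (a : C) (f : C -> C) n z :
  average (fun u => a * f u) n z = a * average f n z.
Proof. by rewrite /average -mulr_sumr mulrCA. Qed.

(** The Taylor coefficients [c z2 k] in the first variable come from a choice made separately for
    each z2, so nothing is known about their dependence on z2. They are replaced by finite averages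
    [a k z2], which are analytic in z2 as finite combinations of values of phi and can be expanded
    in turn. *)
Lemma bidisk_approximation (rho e : R) : 0 < rho < 1 -> 0 < e ->
  exists d (c : nat -> nat -> C), forall z1 z2, modulus z1 <= rho -> modulus z2 <= rho ->
    modulus (phi (z1, z2) - peval2 d c z1 z2) <= e.
Proof.
move=> /andP[rho0 rho1] e0; have r1 : 0 < 1 - rho by rewrite subr_gt0.
pose K := (1 - rho)^-1; have K0 : 0 < K by rewrite invr_gt0.
have taylor z2 : exists c : nat -> C, modulus z2 < 1 -> (forall k, modulus (c k) <= 1) /\
    forall M z1, modulus z1 < 1 -> modulus (phi (z1, z2) - \sum_(k < M) c k * z1 ^+ k) <=
      1 * modulus z1 ^+ M / (1 - modulus z1).
  have [z21|] := ltP (modulus z2) 1; last by exists (fun=> 0).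
  have [c hc] := @power_series R (fun s => phi (s, z2)) 1 (fun z h => derivable_fst h z21)
    (fun z h => phi1 (bidisk_modulus h z21)).
  by exists c.
have [c hc] := choice taylor.
have mono x M : 0 <= x <= rho -> x ^+ M / (1 - x) <= rho ^+ M * K.
  move=> /andP[x0 xr]; apply: ler_pM; rewrite ?exprn_ge0 ?invr_ge0 ?subr_ge0 //.
  - by rewrite (le_trans xr) // ltW.
  - by rewrite lerXn2r // nnegrE // ltW.
  - by rewrite lef_pV2 ?posrE ?subr_gt0 ?(le_lt_trans xr) // lerD2l lerN2.
(* The truncation errors in the two variables total rho^M K (1 + 2 K), at most e / 2; the other half
   of e is for eta K, the effect of replacing [c z2 k] by [a k z2]. *)
have [M hM] : exists M, rho ^+ M * K * (1 + 2 * K) <= e / 2.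
  have p0 : 0 < K * (1 + 2 * K) by rewrite mulr_gt0 // addr_gt0 // mulr_gt0.
  have e1 : 0 < e / 2 / (K * (1 + 2 * K)) by rewrite !divr_gt0.
  have rr : 0 <= rho < 1 by rewrite (ltW rho0) rho1.
  have [M hM] := expn_small rr e1.
  by exists M; rewrite -mulrA -ler_pdivlMr.
pose eta := Num.min 1 (e / 2 / K).
have eta0 : 0 < eta by rewrite lt_min ltr01 !divr_gt0.
have eta1 : eta <= 1 by rewrite ge_min lexx.
have etaK : eta * K <= e / 2 by rewrite -ler_pdivlMr // ge_min lexx orbT.
(* An average over 2^n nodes recovers the coefficients of terms of degree below 2^n exactly. Thus
   [a k z2] - [c z2 k] averages the Taylor remainder of order 2^n on the circle of radius 1/2,
   divided by u^k with k < M. *)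
have [n [Mn hn]] : exists n, (M <= 2 ^ n)%N /\ 2 ^+ M * (2 * (1 / 2) ^+ (2 ^ n)) <= eta.
  have h0 : 0 < eta / (2 ^+ M * 2) by rewrite divr_gt0 // mulr_gt0 // exprn_gt0.
  have hh : 0 <= (1 / 2 : R) < 1 by lra.
  have [n hn] := expn_small hh h0.
  exists (n + M)%N; split.
    by apply: leq_trans (leq_addl n M) _; rewrite ltnW // ltn_expl.
  rewrite mulrA mulrC -ler_pdivlMr ?mulr_gt0 ?exprn_gt0 //.
  apply: le_trans hn; apply: ler_wiXn2l; try lra.
  by apply: leq_trans (leq_addr M n) _; rewrite ltnW // ltn_expl.
pose a k z2 := average (fun u => phi (u, z2) / u ^+ k) n half.
have ac k z2 : (k < M)%N -> modulus z2 < 1 -> modulus (a k z2 - c z2 k) <= eta.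
  move=> kM z21; have [_ hc2] := hc _ z21; have kn := leq_trans kM Mn.
  have -> : a k z2 - c z2 k = average (fun u =>
      (phi (u, z2) - \sum_(l < 2 ^ n) c z2 l * u ^+ l) / u ^+ k) n half.
    rewrite (_ : (fun u => _) = (fun u => phi (u, z2) / u ^+ k -
      \sum_(l < 2 ^ n) c z2 l * (u ^+ l / u ^+ k))); last first.
      apply/funext => u; rewrite mulrBl mulr_suml; congr (_ - _).
      by apply: eq_bigr => l _; rewrite mulrA.
    rewrite averageB average_sum; congr (_ - _).
    rewrite (bigD1 (Ordinal kn)) //= big1 ?addr0.
      by rewrite averageZ average_monomial // eqxx mulr1.
    move=> l lk; rewrite averageZ average_monomial //.
    by rewrite eq_sym -(inj_eq val_inj) /= in lk; rewrite (negPf lk) mulr0.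
  apply: le_trans (hn); apply: average_bound => u uh.
  have u1 : modulus u < 1 by rewrite uh half_modulus; lra.
  rewrite modulusM modulusV modulusX uh half_modulus.
  rewrite mulrC; apply: ler_pM; rewrite ?invr_ge0 ?exprn_ge0 ?modulus_ge0 //.
    rewrite -exprVn div1r invrK; apply: ler_weXn2l; [lra|exact: ltnW].
  apply: le_trans (hc2 _ _ u1) _; rewrite uh half_modulus mul1r.
  by rewrite (_ : 1 - 1 / 2 = 2^-1) ?invrK 1?mulrC //; field.
have ad k z2 : modulus z2 < 1 -> derivable (a k : C^o -> C^o) (z2 : C^o) (1 : C^o).
  move=> z21; apply: derivableM; first exact: derivable_cst.
  rewrite (_ : (fun _ => _) = \sum_(j < 2 ^ n) (fun z2 => phi (half * root2 R n ^+ j, z2) /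
     (half * root2 R n ^+ j) ^+ k)); last first.
    by apply/funext => s; rewrite fct_sumE.
  apply: derivable_sum => j; apply: derivableM; last exact: derivable_cst.
  apply: derivable_snd => //.
  by rewrite modulusM modulusX modulus_cis expr1n mulr1 half_modulus; lra.
have ab k z2 : (k < M)%N -> modulus z2 < 1 -> modulus (a k z2) <= 2.
  move=> kM z21; have [hc1 _] := hc _ z21.
  rewrite (_ : a k z2 = (a k z2 - c z2 k) + c z2 k); last by ring.
  apply: le_trans (modulusD _ _) _; have := hc1 k; have := ac _ _ kM z21; lra.
have series k : exists b : nat -> C, (k < M)%N -> forall m z2, modulus z2 < 1 ->
    modulus (a k z2 - \sum_(q < m) b q * z2 ^+ q) <= 2 * modulus z2 ^+ m / (1 - modulus z2).
  have [kM|] := ltnP k M; last by exists (fun=> 0).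
  have [b [_ hb]] := power_series (@ad k) (fun z => ab k z kM).
  by exists b.
have [b hb] := choice series.
exists M, b => z1 z2 hz1 hz2.
have z11 : modulus z1 < 1 by apply: le_lt_trans rho1.
have z21 : modulus z2 < 1 by apply: le_lt_trans rho1.
have [_ hc2] := hc _ z21.
have -> : phi (z1, z2) - peval2 M b z1 z2 =
  (phi (z1, z2) - \sum_(k < M) c z2 k * z1 ^+ k) +
  \sum_(k < M) ((c z2 k - a k z2) + (a k z2 - \sum_(q < M) b k q * z2 ^+ q)) * z1 ^+ k.
  have -> : peval2 M b z1 z2 = \sum_(k < M) (\sum_(q < M) b k q * z2 ^+ q) * z1 ^+ k.
    apply: eq_bigr => k _; rewrite mulr_suml; apply: eq_bigr => q _; exact: mulrAC.
  rewrite [X in _ = _ + X](eq_bigr (fun k : 'I_M => c z2 k * z1 ^+ k -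
    (\sum_(q < M) b k q * z2 ^+ q) * z1 ^+ k)); first by rewrite sumrB; ring.
  by move=> k _; ring.
apply: le_trans (modulusD _ _) _.
have h1 : modulus (phi (z1, z2) - \sum_(k < M) c z2 k * z1 ^+ k) <= rho ^+ M * K.
  apply: le_trans (hc2 _ _ z11) _; rewrite mul1r; apply: mono.
  by rewrite modulus_ge0.
have h2 : modulus (\sum_(k < M) ((c z2 k - a k z2) +
    (a k z2 - \sum_(q < M) b k q * z2 ^+ q)) * z1 ^+ k) <= (eta + 2 * (rho ^+ M * K)) * K.
  apply: le_trans (modulus_sum _ _ _) _.
  apply: (@le_trans _ _ (\sum_(k < M) (eta + 2 * (rho ^+ M * K)) * rho ^+ k)).
    apply: ler_sum => k _; rewrite modulusM; apply: ler_pM; rewrite ?modulus_ge0 //.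
      apply: le_trans (modulusD _ _) _; apply: lerD.
        by rewrite modulus_distC ac.
      apply: le_trans (hb k _ _ _ z21) _ => //; rewrite -mulrA ler_wpM2l //.
      by apply: mono; rewrite modulus_ge0.
    by rewrite modulusX lerXn2r ?nnegrE ?modulus_ge0 // ltW.
  rewrite -mulr_sumr ler_wpM2l //; last by apply: geometric_sum_le; rewrite (ltW rho0).
  have := exprn_ge0 M (ltW rho0) => ?.
  by rewrite addr_ge0 ?(ltW eta0) // !mulr_ge0 // ltW.
apply: le_trans (lerD h1 h2) _; nra.
Qed.
End Approximation.

(** * Admissible matrices pair nonnegatively with W *)

Section DualInequality.
Variables (N : nat) (lam : 'I_N -> C * C) (w : 'I_N -> C).

Lemma pick_modulus phi : Pick_solution lam w phi ->
  forall z, bidisk z -> modulus (phi z) <= 1.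
Proof.
case=> -[_ [M hM]] _ h1 z hz; apply: le_trans h1; apply: ub_le_sup; last by exists z.
by exists M => _ [u hu <-]; exact: hM.
Qed.

Lemma one_sub_conj_neq0 (a b : C) : `|a| < 1 -> `|b| < 1 -> 1 - a^* * b != 0.
Proof.
move=> a1 b1; rewrite subr_eq0; apply/eqP => h.
have := congr1 Num.norm h; rewrite normr1 normrM norm_conjC => e.
by have := mulr_ilt1 (normr_ge0 a) (normr_ge0 b) a1 b1; rewrite -e ltxx.
Qed.

Lemma schur_Lambda1 (K : 'M[C]_N) : schur K (Lambda1 lam) =
  K - (diag_mx (\row_i (lam i).1)) ^t* *m K *m diag_mx (\row_i (lam i).1).
Proof.
apply/matrixP => i j; rewrite mul_mx_diag !mxE.
rewrite (bigD1 i) //= big1 ?addr0; last first.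
  by move=> k ki; rewrite !mxE (negPf ki) mulr0n rmorph0 mul0r.
by rewrite !mxE eqxx mulr1n; ring.
Qed.

Lemma schur_Lambda2 (K : 'M[C]_N) : schur K (Lambda2 lam) =
  K - (diag_mx (\row_i (lam i).2)) ^t* *m K *m diag_mx (\row_i (lam i).2).
Proof.
apply/matrixP => i j; rewrite mul_mx_diag !mxE.
rewrite (bigD1 i) //= big1 ?addr0; last first.
  by move=> k ki; rewrite !mxE (negPf ki) mulr0n rmorph0 mul0r.
by rewrite !mxE eqxx mulr1n; ring.
Qed.

Hypothesis lamD : forall i, bidisk (lam i).

(* The functionals [H |-> sum_ij K_ij H_ij] that are nonnegative on the cone of
   all [Lambda1 . Gamma + Lambda2 . Delta] with Gamma, Delta >= 0. *)
Definition admissible (K : 'M[C]_N) : Prop :=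
  psd (schur K (Lambda1 lam)) /\ psd (schur K (Lambda2 lam)).

(* [x^* K x >= (D^n x)^* K (D^n x)], and the right-hand side tends to 0. *)
Lemma admissible_psd K : admissible K -> psd K.
Proof.
case=> p1 _; have K_sym i j : K i j = (K j i)^*.
  have := psd_sym i j p1; rewrite !mxE rmorphM rmorphB rmorph1 rmorphM /= conjCK.
  rewrite mulrC [X in _ = X]mulrC [X in _ - X]mulrC => /mulfI; apply.
  by rewrite mulrC one_sub_conj_neq0 //; case: (lamD i); case: (lamD j).
split; first by rewrite hermsymmx_adj; apply/eqP/matrixP => i j; rewrite adjmxE.
move=> x; pose y n : 'cV[C]_N := \col_i ((lam i).1 ^+ n * x i 0).
pose q n := ((y n) ^t* *m K *m y n) 0 0.
have yS n : y n.+1 = diag_mx (\row_i (lam i).1) *m y n.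
  by apply/colP => i; rewrite mul_diag_mx !mxE exprS mulrA.
have qS n : q n.+1 <= q n.
  rewrite -subr_ge0 /q yS adjmxM; set D := diag_mx _.
  have -> : (y n ^t* *m K *m y n) 0 0 - (y n ^t* *m D ^t* *m K *m (D *m y n)) 0 0 =
      (y n ^t* *m (K - D ^t* *m K *m D) *m y n) 0 0.
    by rewrite mulmxBr mulmxBl !mulmxA !mxE.
  by rewrite -schur_Lambda1; case: p1.
have q0 n : complex.Re (q n) <= complex.Re (q 0%N).
  elim: n => [|n]; first exact: lexx.
  apply: le_trans; move: (q n.+1) (q n) (qS n) => u v.
  by rewrite lecE => /andP[].
have qx : q 0%N = (x ^t* *m K *m x) 0 0.
  rewrite /q; have -> // : y 0%N = x.
  by apply/colP => i; rewrite mxE expr0 mul1r.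
have xreal : (x ^t* *m K *m x) 0 0 \is Num.real.
  apply/CrealP; rewrite mulmx3E rmorph_sum exchange_big /=; apply: eq_bigr => i _.
  rewrite rmorph_sum; apply: eq_bigr => j _.
  by rewrite !rmorphM /= conjCK -K_sym; ring.
pose r := \big[Num.max/0]_i modulus (lam i).1.
have r0 : 0 <= r by exact: bigmax_ge_id.
have r1 : r < 1.
  by apply/bigmax_ltP; split => // i _; rewrite -modulus_lt1; case: (lamD i).
have rl i : modulus (lam i).1 <= r by exact: le_bigmax.
pose S := \sum_i \sum_j modulus (x i 0) * modulus (K i j) * modulus (x j 0).
have qb n : modulus (q n) <= S * r ^+ n.
  rewrite /q mulmx3E /S mulr_suml; apply: le_trans (modulus_sum _ _ _) _.
  apply: ler_sum => i _; rewrite mulr_suml; apply: le_trans (modulus_sum _ _ _) _.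
  apply: ler_sum => j _; rewrite !modulusM modulus_conj !mxE !modulusM !modulusX.
  have p : 0 <= modulus (x i 0) * modulus (K i j) * modulus (x j 0).
    by rewrite !mulr_ge0 ?modulus_ge0.
  have -> : modulus (lam i).1 ^+ n * modulus (x i 0) * modulus (K i j) *
      (modulus (lam j).1 ^+ n * modulus (x j 0)) =
    modulus (x i 0) * modulus (K i j) * modulus (x j 0) *
      (modulus (lam i).1 ^+ n * modulus (lam j).1 ^+ n) by ring.
  rewrite ler_wpM2l // -[leRHS]mulr1; apply: ler_pM; rewrite ?exprn_ge0 ?modulus_ge0 //.
    by rewrite lerXn2r // nnegrE modulus_ge0.
  by rewrite exprn_ile1 ?modulus_ge0 // (le_trans (rl j)) // ltW.
rewrite lecE -(RRe_real xreal) /= eqxx /= leNgt; apply/negP => neg.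
rewrite -qx in neg.
have S0 : 0 <= S by do 2![apply: sumr_ge0 => ? _]; rewrite !mulr_ge0 ?modulus_ge0.
have S1 : 0 < S + 1 by rewrite ltr_wpDl.
have e0 : 0 < - complex.Re (q 0%N) / 2 / (S + 1) by rewrite !divr_gt0 // oppr_gt0.
have rr : 0 <= r < 1 by rewrite r0.
have [n] := expn_small rr e0; rewrite ler_pdivlMr // mulrDr mulr1 (mulrC _ S).
have := q0 n; have := modulus_Re (q n); rewrite ler_norml => /andP[].
have := qb n; have := exprn_ge0 n r0.
move: (modulus (q n)) (S * r ^+ n) (r ^+ n) (complex.Re (q n)) neg.
move: (complex.Re (q 0%N)) => q0R mqn sr rn qn; lra.
Qed.

Lemma finite_min (I : finType) (P : I -> R -> Prop) :
  (forall i x y, x <= y -> P i y -> P i x) ->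
  (forall i, exists2 d : R, 0 < d & P i d) -> exists2 d : R, 0 < d & forall i, P i d.
Proof.
move=> mono h; have h' i : exists d : R, 0 < d /\ P i d.
  by have [d d0 Pd] := h i; exists d.
have [f hf] := choice h'.
exists (\big[Num.min/1]_i f i).
  by apply/bigmin_gtP; split => [|i _]; [exact: ltr01|case: (hf i)].
by move=> i; apply: mono (hf i).2; exact: bigmin_le_cond.
Qed.

(* A solution is approximated at the nodes by polynomials bounded by 1 on the
   bidisk, to which the dilation argument applies. *)
Lemma dual_inequality phi K : Pick_solution lam w phi -> admissible K ->
  0 <= \sum_i \sum_j K i j * Wmx w i j.
Proof.
move=> sol adm; have pK := admissible_psd adm.
have phi1 := pick_modulus sol.
have [[phid _] phiw _] := sol.
have p1 := adm.1; have p2 := adm.2; rewrite schur_Lambda1 in p1; rewrite schur_Lambda2 in p2.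
have lam1 i : modulus (lam i).1 < 1 by rewrite -modulus_lt1; case: (lamD i).
have lam2 i : modulus (lam i).2 < 1 by rewrite -modulus_lt1; case: (lamD i).
have w1 i : modulus (w i) <= 1 by rewrite -phiw phi1.
have approx (d : R) : 0 < d -> exists f : 'cV[C]_N,
    (forall j, modulus (f j 0 - w j) <= d) /\
    (f ^t* *m K *m f) 0 0 <= \sum_i \sum_j K i j.
  move=> d0; have d3 : 0 < d / 3 by rewrite divr_gt0.
  have [del del0 hdel] : exists2 del : R, 0 < del & forall i t,
      modulus (t - 1) < del -> modulus (phi (t * (lam i).1, t * (lam i).2) - w i) <= d / 3.
    apply: (@finite_min _ (fun i del => forall t, modulus (t - 1) < del ->
       modulus (phi (t * (lam i).1, t * (lam i).2) - w i) <= d / 3)).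
      by move=> i x y xy h t tx; apply: h; exact: lt_le_trans tx xy.
    move=> i; have lb : bidisk (0 + 1 * (lam i).1, 0 + 1 * (lam i).2).
      by rewrite !add0r !mul1r; split => /=; case: (lamD i).
    have := @derivable_line phi phid (0, 0) (lam i) 1 lb.
    move=> /derivable_continuous/(_ _ d3)[del del0 h]; exists del => // t /h.
    by rewrite !add0r !mul1r -phiw -surjective_pairing.
  (* The polynomial used is s p (rho z), where p approximates phi within d / 3 on radius rho.
     Shrinking the nodes by rho costs d / 3, the approximation d / 3, and the factor s = 1 / (1 + d
     / 3), which makes it bounded by 1 on the torus, another d / 3. *)
  pose rho := Num.max (1 / 2) (1 - del / 2).
  have rho1 : rho < 1 by rewrite gt_max; apply/andP; split; lra.
  have rho2 : 1 / 2 <= rho by rewrite le_max lexx.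
  have rho3 : 1 - del / 2 <= rho by rewrite le_max lexx orbT.
  have rr : 0 < rho < 1 by lra.
  have [n [c hc]] := bidisk_approximation phid phi1 rr d3.
  pose s := (1 + d / 3)^-1; have s0 : 0 < s by rewrite invr_gt0; lra.
  have mrho : modulus (rho%:C%C : C) = rho by rewrite modulus_real ger0_norm; lra.
  pose c' p r := s%:C%C * (c p r * rho%:C%C ^+ p * rho%:C%C ^+ r).
  have c'E z1 z2 : peval2 n c' z1 z2 = s%:C%C * peval2 n c (rho%:C%C * z1) (rho%:C%C * z2).
    rewrite /peval2 mulr_sumr; apply: eq_bigr => p _; rewrite mulr_sumr.
    by apply: eq_bigr => r _; rewrite /c' !exprMn; ring.
  have hbound z1 z2 : modulus z1 <= 1 -> modulus z2 <= 1 ->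
      modulus (peval2 n c (rho%:C%C * z1) (rho%:C%C * z2)) <= 1 + d / 3.
    move=> h1 h2; have r1 : modulus (rho%:C%C * z1) <= rho.
      by rewrite modulusM mrho ler_piMr //; lra.
    have r2 : modulus (rho%:C%C * z2) <= rho.
      by rewrite modulusM mrho ler_piMr //; lra.
    have b : bidisk (rho%:C%C * z1, rho%:C%C * z2).
      by apply: bidisk_modulus; apply: le_lt_trans rho1.
    have := phi1 _ b; have := hc _ _ r1 r2; set u := phi _; set v := peval2 _ _ _ _.
    move=> uv u1; have -> : v = u - (u - v) by ring.
    by apply: le_trans (modulusB _ _) _; lra.
  exists (\col_j peval2 n c' ((\row_i (lam i).1) 0 j) ((\row_i (lam i).2) 0 j)).
  split; last first.
    apply: ando_von_neumann => // z1 z2 /eqP; rewrite modulus_eq1 => /eqP h1.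
    move=> /eqP; rewrite modulus_eq1 => /eqP h2; rewrite c'E modulus_le1 modulusM.
    rewrite modulus_real gtr0_norm // /s mulrC ler_pdivrMr ?mul1r; last by lra.
    by apply: hbound; rewrite ?h1 ?h2.
  move=> j; rewrite !mxE c'E; set v := peval2 _ _ _ _.
  have hv : modulus v <= 1 + d / 3 by apply: hbound; exact: ltW.
  have r1 : modulus (rho%:C%C * (lam j).1) <= rho.
    by rewrite modulusM mrho ler_piMr //; [lra|exact: ltW].
  have r2 : modulus (rho%:C%C * (lam j).2) <= rho.
    by rewrite modulusM mrho ler_piMr //; [lra|exact: ltW].
  have h1 := hc _ _ r1 r2; rewrite -/v in h1.
  have h2 : modulus (phi (rho%:C%C * (lam j).1, rho%:C%C * (lam j).2) - w j) <= d / 3.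
    apply: hdel; rewrite -(rmorph1 (real_complex R)) -rmorphB modulus_real ltr0_norm; lra.
  have h3 : modulus (s%:C%C * v - v) <= d / 3.
    have -> : s%:C%C * v - v = - ((1 - s)%:C%C * v).
      by rewrite rmorphB rmorph1; ring.
    have s1 : 0 <= 1 - s by rewrite subr_ge0 /s invf_le1; lra.
    rewrite modulusN modulusM modulus_real ger0_norm //.
    apply: le_trans (ler_wpM2l s1 hv) _.
    by rewrite mulrBl mul1r /s mulVf; [lra|rewrite gt_eqF; lra].
  set p := phi _ in h1 h2.
  have -> : s%:C%C * v - w j = (s%:C%C * v - v) - (p - v) + (p - w j) by ring.
  apply: le_trans (modulusD _ _) _.
  apply: le_trans (lerD (modulusB _ _) (lexx _)) _; lra.
have KW : \sum_i \sum_j K i j * Wmx w i j = \sum_i \sum_j K i j -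
    ((\col_j w j) ^t* *m K *m (\col_j w j)) 0 0.
  rewrite mulmx3E -sumrB; apply: eq_bigr => i _; rewrite -sumrB; apply: eq_bigr => j _.
  by rewrite !mxE; ring.
pose S := \sum_i \sum_j modulus (K i j).
have S0 : 0 <= S by do 2![apply: sumr_ge0 => ? _]; rewrite modulus_ge0.
have realK : \sum_i \sum_j K i j \is Num.real.
  have := (proj2 pK) (const_mx 1); rewrite mulmx3E.
  under eq_bigr do under eq_bigr do rewrite !mxE rmorph1 mul1r mulr1.
  exact: ger0_real.
have realw : ((\col_j w j) ^t* *m K *m (\col_j w j)) 0 0 \is Num.real.
  by rewrite ger0_real //; case: pK.
rewrite KW subr_ge0 -(RRe_real realK) -(RRe_real realw) lecR.
apply/ler_addgt0Pr => e e0.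
(* Since |w_i| <= 1 and the entries of f are at most 2 in modulus, replacing w by f changes the form
   by at most 3 d S. *)
pose d := Num.min 1 (e / (3 * (S + 1))).
have S1 : 0 < 3 * (S + 1) by rewrite mulr_gt0 // ltr_wpDl.
have d0 : 0 < d by rewrite lt_min ltr01 divr_gt0.
have d1 : d <= 1 by rewrite ge_min lexx.
have d2 : d * (3 * (S + 1)) <= e by rewrite -ler_pdivlMr // ge_min lexx orbT.
have [f [fw fK]] := approx _ d0.
have dist : modulus (((\col_j w j) ^t* *m K *m (\col_j w j)) 0 0 -
    (f ^t* *m K *m f) 0 0) <= 3 * d * S.
  rewrite !mulmx3E -sumrB mulr_sumr; apply: le_trans (modulus_sum _ _ _) _.
  apply: ler_sum => i _; rewrite -sumrB mulr_sumr; apply: le_trans (modulus_sum _ _ _) _.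
  apply: ler_sum => j _; rewrite !mxE.
  have -> : (w i)^* * K i j * w j - (f i 0)^* * K i j * f j 0 =
    - (K i j * ((w i)^* * (f j 0 - w j) + (f i 0 - w i)^* * f j 0)).
    by rewrite rmorphB /=; ring.
  rewrite modulusN modulusM mulrC ler_wpM2r ?modulus_ge0 //.
  apply: le_trans (modulusD _ _) _; rewrite !modulusM !modulus_conj.
  have fj : modulus (f j 0) <= 2.
    have -> : f j 0 = (f j 0 - w j) + w j by ring.
    by apply: le_trans (modulusD _ _) _; have := fw j; have := w1 j; lra.
  have h1 : modulus (w i) * modulus (f j 0 - w j) <= 1 * d.
    by apply: ler_pM; rewrite ?modulus_ge0.
  have h2 : modulus (f i 0 - w i) * modulus (f j 0) <= d * 2.
    by apply: ler_pM; rewrite ?modulus_ge0.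
  lra.
have realf : (f ^t* *m K *m f) 0 0 \is Num.real by rewrite ger0_real //; case: pK.
move: fK dist; rewrite -(RRe_real realK) -(RRe_real realw) -(RRe_real realf) lecR.
rewrite -rmorphB modulus_real ler_norml => h1 /andP[_ h2].
have : 3 * d * S <= e by nra.
lra.
Qed.
End DualInequality.
End BidiskApproximation.

(** * Minimization over pairs of Hermitian matrices *)

Section CompactMinimum.
Variable R : realType.
Local Notation C := R[i].

(** The constraints have an arbitrary index type so that positivity of a matrix can be imposed as
    one closed condition for each vector. *)
Lemma compact_minimum n (M : R) (I : Type) (F : I -> 'rV[R]_n -> R) (f : 'rV[R]_n -> R) v0 :
  (forall k, continuous (F k)) -> continuous f ->
  (forall k, 0 <= F k v0) -> (forall i, `|v0 0 i| <= M) ->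
  exists v, [/\ forall k, 0 <= F k v, forall i, `|v 0 i| <= M &
    forall u, (forall k, 0 <= F k u) -> (forall i, `|u 0 i| <= M) -> f v <= f u].
Proof.
move=> Fc fc F0 vM.
pose S := [set v : 'rV[R]_n | forall i, v ord0 i \in `[- M, M]] `&`
  \bigcap_(k in [set: I]) (F k @^-1` [set x | 0 <= x]).
have cS : compact S.
  apply: (@subclosed_compact _ S [set v : 'rV[R]_n | forall i, v ord0 i \in `[- M, M]]).
  - apply: closedI; last first.
      by apply: closed_bigI => k _; move/continuous_closedP: (Fc k); apply; exact: closed_ge.
    rewrite (_ : [set v | _] = \bigcap_(i in [set: 'I_n])
        ((fun v : 'rV[R]_n => v ord0 i) @^-1` `[- M, M])); last first.
      by apply/seteqP; split => [v h i _|v h i]; [exact: h|exact: h i Logic.I].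
    apply: closed_bigI => i _.
    have /continuous_closedP := @coord_continuous R 1 n ord0 i; apply.
    exact: interval_closed.
  - apply: (@rV_compact _ _ (fun=> `[- M, M]%classic)).
    by move=> _; exact: segment_compact.
  - by move=> v [].
have Sv0 : S !=set0.
  by exists v0; split => [i|k _]; [rewrite /= in_itv /= -ler_norml; exact: vM|exact: F0].
have [v] := EVT_min_rV Sv0 cS (continuous_subspaceT fc).
rewrite inE => -[vM' vF] vmin; exists v; split.
- by move=> k; exact: vF.
- by move=> i; have := vM' i; rewrite in_itv /= ler_norml.
move=> u uF uM; apply: vmin; rewrite inE; split => [i|k _]; last exact: uF.
by rewrite /= in_itv /= -ler_norml; exact: uM.
Qed.

Section ComplexContinuity.
Variable (n : nat).
Implicit Types F G : 'rV[R]_n -> C.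

Definition ccontinuous F :=
  continuous (fun v => complex.Re (F v)) /\ continuous (fun v => complex.Im (F v)).

Lemma ccontinuous_cst c : ccontinuous (fun=> c).
Proof. by split; exact: cst_continuous. Qed.

Lemma ccontinuousD F G : ccontinuous F -> ccontinuous G -> ccontinuous (fun v => F v + G v).
Proof.
move=> [f1 f2] [g1 g2]; split => v.
  rewrite (_ : (fun v => _) = (fun v => complex.Re (F v) + complex.Re (G v))).
    exact: cvgD (f1 v) (g1 v).
  by apply/funext => u; case: (F u) (G u) => ? ? [].
rewrite (_ : (fun v => _) = (fun v => complex.Im (F v) + complex.Im (G v))).
  exact: cvgD (f2 v) (g2 v).
by apply/funext => u; case: (F u) (G u) => ? ? [].
Qed.

Lemma ccontinuousM F G : ccontinuous F -> ccontinuous G -> ccontinuous (fun v => F v * G v).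
Proof.
move=> [f1 f2] [g1 g2]; split => v.
  rewrite (_ : (fun v => _) = (fun v => complex.Re (F v) * complex.Re (G v)
      - complex.Im (F v) * complex.Im (G v))).
    exact: cvgB (cvgM (f1 v) (g1 v)) (cvgM (f2 v) (g2 v)).
  by apply/funext => u; case: (F u) (G u) => ? ? [].
rewrite (_ : (fun v => _) = (fun v => complex.Re (F v) * complex.Im (G v)
    + complex.Im (F v) * complex.Re (G v))).
  exact: cvgD (cvgM (f1 v) (g2 v)) (cvgM (f2 v) (g1 v)).
by apply/funext => u; case: (F u) (G u) => ? ? [].
Qed.

Lemma ccontinuous_conj F : ccontinuous F -> ccontinuous (fun v => (F v)^*).
Proof.
move=> [f1 f2]; split => v.
  by rewrite (_ : (fun v => _) = (fun v => complex.Re (F v))) //;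
    apply/funext => u; case: (F u).
rewrite (_ : (fun v => _) = (fun v => - complex.Im (F v))); first exact: cvgN (f2 v).
by apply/funext => u; case: (F u).
Qed.

Lemma ccontinuous_sum (I : Type) (r : seq I) (F : I -> 'rV[R]_n -> C) :
  (forall i, ccontinuous (F i)) -> ccontinuous (fun v => \sum_(i <- r) F i v).
Proof.
move=> h; elim: r => [|i r IH].
  rewrite (_ : (fun v => _) = (fun=> 0)); first exact: ccontinuous_cst.
  by apply/funext => v; rewrite big_nil.
rewrite (_ : (fun v => _) = (fun v => F i v + \sum_(j <- r) F j v)).
  exact: ccontinuousD.
by apply/funext => v; rewrite big_cons.
Qed.
End ComplexContinuity.

Section HermitianCoordinates.
Variable N : nat.
(** The first boolean selects the matrix of the pair, the second one its real or imaginary parts. *)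
Let T : finType := (bool * bool * 'I_N * 'I_N)%type.
Local Notation n := #|T|.

Let coord (v : 'rV[R]_n) (t : T) : R := v 0 (enum_rank t).

Definition half_mx (b : bool) (v : 'rV[R]_n) : 'M[C]_N :=
  \matrix_(i, j) ((coord v (b, false, i, j)) +i* (coord v (b, true, i, j)))%C.

(* Pairs of Hermitian matrices, parametrized by real vectors. *)
Definition herm_mx b v : 'M[C]_N := half_mx b v + (half_mx b v) ^t*.

Definition herm_coord (G D : 'M[C]_N) : 'rV[R]_n :=
  \row_k let: (b, c, i, j) := enum_val k in
    let z := (if b then D else G) i j / 2 in if c then complex.Im z else complex.Re z.

Lemma herm_mxK G D b : G \is hermsymmx -> D \is hermsymmx ->
  herm_mx b (herm_coord G D) = if b then D else G.
Proof.
rewrite !hermsymmx_adj /herm_mx => /eqP hG /eqP hD.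
have -> : half_mx b (herm_coord G D) = 2^-1 *: if b then D else G.
  apply/matrixP => i j; rewrite !mxE /coord !mxE !enum_rankK mulrC.
  by apply/eqP; rewrite eq_complex /= !eqxx.
have -> : (2^-1 *: (if b then D else G)) ^t* = 2^-1 *: (if b then D else G).
  by rewrite adjmxZ fmorphV /= conjC_nat; case: b; rewrite -?hG -?hD.
by rewrite -scalerDl -[RHS]scale1r; congr (_ *: _); field.
Qed.

Lemma herm_mx_herm b v : herm_mx b v \is hermsymmx.
Proof. by rewrite hermsymmx_adj /herm_mx adjmxD adjmxK addrC. Qed.

Lemma herm_coord_bound (G D : 'M[C]_N) M : (forall i j, modulus (G i j) <= M) ->
  (forall i j, modulus (D i j) <= M) -> forall k, `|herm_coord G D 0 k| <= M.
Proof.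
move=> hG hD k; rewrite mxE; case: (enum_val k) => [[[b c] i] j].
set z := _ / _; have zM : modulus z <= M.
  rewrite /z modulusM modulusV modulus_nat.
  have h b' : modulus ((if b' then D else G) i j) <= M by case: b'.
  by have := h b; have := modulus_ge0 ((if b then D else G) i j); lra.
case: c; apply: le_trans zM; last exact: modulus_Re.
by have := modulus_Re (z * 'i%C); rewrite ReiNIm normrN modulusM modulusi mulr1.
Qed.

Lemma ccontinuous_herm b i j : ccontinuous (fun v => herm_mx b v i j).
Proof.
have h i' j' : ccontinuous (fun v => half_mx b v i' j').
  split.
    rewrite (_ : (fun v => _) = (fun v : 'rV[R]_n => v 0 (enum_rank ((b, false, i', j') : T)))).
      exact: coord_continuous.
    by apply/funext => v; rewrite mxE.
  rewrite (_ : (fun v => _) = (fun v : 'rV[R]_n => v 0 (enum_rank ((b, true, i', j') : T)))).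
    exact: coord_continuous.
  by apply/funext => v; rewrite mxE.
rewrite (_ : (fun v => _) = (fun v => half_mx b v i j + (half_mx b v j i)^*)).
  by apply: ccontinuousD => //; exact: ccontinuous_conj.
by apply/funext => v; rewrite !mxE.
Qed.

Lemma ccontinuous_form (A : 'rV[R]_n -> 'M[C]_N) (x : 'cV[C]_N) :
  (forall i j, ccontinuous (fun v => A v i j)) ->
  ccontinuous (fun v => (x ^t* *m A v *m x) 0 0).
Proof.
move=> h; rewrite (_ : (fun v => _) = (fun v => \sum_i \sum_j (x i 0)^* * A v i j * x j 0)).
  apply: ccontinuous_sum => i; apply: ccontinuous_sum => j.
  apply: ccontinuousM; last exact: ccontinuous_cst.
  by apply: ccontinuousM => //; exact: ccontinuous_cst.
by apply/funext => v; rewrite mulmx3E.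
Qed.

Lemma herm_psd (A : 'M[C]_N) : A \is hermsymmx ->
  (forall x : 'cV[C]_N, 0 <= complex.Re ((x ^t* *m A *m x) 0 0)) -> psd A.
Proof.
move=> hA h; split => // x.
have hr : (x ^t* *m A *m x) 0 0 \is Num.real.
  apply/CrealP; rewrite -[LHS](adjmxE (x ^t* *m A *m x)) !adjmxM adjmxK mulmxA.
  by move: hA; rewrite hermsymmx_adj => /eqP <-.
by rewrite -(RRe_real hr) ler0c.
Qed.

Lemma psd_entry_bound (A : 'M[C]_N) i j : psd A ->
  modulus (A i j) <= (complex.Re (A i i) + complex.Re (A j j)) / 2.
Proof.
move=> /psd_factor[X ->].
have diag k : complex.Re ((X ^t* *m X) k k) = \sum_l modulus (X l k) ^+ 2.
  rewrite mxE (_ : \sum_l _ = (\sum_l modulus (X l k) ^+ 2)%:C%C) //.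
  rewrite rmorph_sum; apply: eq_bigr => l _.
  by rewrite !mxE mulrC -normCK modulusE rmorphXn.
rewrite !diag mxE; apply: le_trans (modulus_sum _ _ _) _.
rewrite -big_split /= mulr_suml; apply: ler_sum => l _.
rewrite !mxE modulusM modulus_conj.
by have := sqr_ge0 (modulus (X l i) - modulus (X l j)); rewrite sqrrB; lra.
Qed.
End HermitianCoordinates.
End CompactMinimum.

(** * Duality: the cone of permissible decompositions, Agler's theorem and active functionals *)

Section Separation.
Variable R : realType.
Local Notation C := R[i].
Variables (N : nat) (lam : 'I_N -> C * C).
Hypothesis lamD : forall i, bidisk (lam i).
Local Notation L1 := (Lambda1 lam).
Local Notation L2 := (Lambda2 lam).

(** Bilinear, without conjugation: the trace of K^T H. It moves Schur factors from one argument to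
    the other, and the functional defined by a Hermitian H is represented by its entrywise
    conjugate. *)
Definition pairing (K H : 'M[C]_N) : C := \sum_i \sum_j K i j * H i j.

Lemma pairingD K H H' : pairing K (H + H') = pairing K H + pairing K H'.
Proof.
rewrite /pairing -big_split; apply: eq_bigr => i _; rewrite -big_split.
by apply: eq_bigr => j _; rewrite mxE mulrDr.
Qed.

Lemma pairingZ K a H : pairing K (a *: H) = a * pairing K H.
Proof.
rewrite /pairing mulr_sumr; apply: eq_bigr => i _; rewrite mulr_sumr.
by apply: eq_bigr => j _; rewrite mxE mulrCA.
Qed.

Lemma pairing_schur K L G : pairing K (schur L G) = pairing (schur K L) G.
Proof. by apply: eq_bigr => i _; apply: eq_bigr => j _; rewrite !mxE mulrA. Qed.

Lemma pairing_gram K m (X : 'M[C]_(m, N)) : pairing K (X ^t* *m X) =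
  \sum_k (((\col_i X k i) ^t* *m K *m (\col_i X k i)) 0 0).
Proof.
under [RHS]eq_bigr do rewrite mulmx3E.
rewrite /pairing [RHS]exchange_big /=; apply: eq_bigr => i _.
rewrite [RHS]exchange_big /=; apply: eq_bigr => j _.
rewrite !mxE mulr_sumr; apply: eq_bigr => k _.
by rewrite !mxE; ring.
Qed.

Lemma pairing_psd_ge0 K G : psd K -> psd G -> 0 <= pairing K G.
Proof.
move=> pK /psd_factor[X ->]; rewrite pairing_gram sumr_ge0 // => k _.
by case: pK.
Qed.

Lemma Lambda1_herm : L1 \is hermsymmx.
Proof.
rewrite hermsymmx_adj; apply/eqP/matrixP => i j.
by rewrite adjmxE !mxE rmorphB rmorph1 rmorphM /= conjCK mulrC.
Qed.

Lemma Lambda2_herm : L2 \is hermsymmx.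
Proof.
rewrite hermsymmx_adj; apply/eqP/matrixP => i j.
by rewrite adjmxE !mxE rmorphB rmorph1 rmorphM /= conjCK mulrC.
Qed.

Lemma schur_herm (A B : 'M[C]_N) : A \is hermsymmx -> B \is hermsymmx ->
  schur A B \is hermsymmx.
Proof.
rewrite !hermsymmx_adj => /eqP/matrixP hA /eqP/matrixP hB; apply/eqP/matrixP => i j.
by rewrite adjmxE !mxE rmorphM /= {1}hA {1}hB !adjmxE.
Qed.

Lemma psd_herm (A : 'M[C]_N) : psd A -> A \is hermsymmx. Proof. by case. Qed.

Lemma hermD (A B : 'M[C]_N) : A \is hermsymmx -> B \is hermsymmx -> A + B \is hermsymmx.
Proof. by rewrite !hermsymmx_adj adjmxD => /eqP <- /eqP <-. Qed.

Definition cone (H : 'M[C]_N) : Prop :=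
  exists G D, [/\ psd G, psd D & H = schur L1 G + schur L2 D].

Lemma cone_herm H : cone H -> H \is hermsymmx.
Proof.
by case=> G [D [pG pD ->]]; apply: hermD; apply: schur_herm;
  rewrite ?Lambda1_herm ?Lambda2_herm ?psd_herm.
Qed.

Lemma schurDr (A B B' : 'M[C]_N) : schur A (B + B') = schur A B + schur A B'.
Proof. by apply/matrixP => i j; rewrite !mxE mulrDr. Qed.

Lemma schurZr (A B : 'M[C]_N) a : schur A (a *: B) = a *: schur A B.
Proof. by apply/matrixP => i j; rewrite !mxE mulrCA. Qed.

Lemma schur0r (A : 'M[C]_N) : schur A 0 = 0.
Proof. by apply/matrixP => i j; rewrite !mxE mulr0. Qed.

Lemma schurC (A B : 'M[C]_N) : schur A B = schur B A.
Proof. by apply/matrixP => i j; rewrite !mxE mulrC. Qed.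

Lemma coneD H H' : cone H -> cone H' -> cone (H + H').
Proof.
move=> [G [D [pG pD ->]]] [G' [D' [pG' pD' ->]]]; exists (G + G'), (D + D').
by split; [exact: psdD|exact: psdD|rewrite !schurDr addrACA].
Qed.

Lemma coneZ a H : 0 <= a -> cone H -> cone (a *: H).
Proof.
move=> a0 [G [D [pG pD ->]]]; exists (a *: G), (a *: D).
by split; [exact: psdZ|exact: psdZ|rewrite !schurZr scalerDr].
Qed.

Definition frobenius (H : 'M[C]_N) : R := \sum_i \sum_j modulus (H i j) ^+ 2.

Lemma frobenius_ge0 H : 0 <= frobenius H.
Proof. by do 2![apply: sumr_ge0 => ? _]; rewrite sqr_ge0. Qed.

Lemma frobenius_entry (H : 'M[C]_N) i j : modulus (H i j) ^+ 2 <= frobenius H.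
Proof.
rewrite /frobenius (bigD1 i) //= (bigD1 j) //= -addrA lerDl addr_ge0 //.
  by apply: sumr_ge0 => ? _; rewrite sqr_ge0.
by do 2![apply: sumr_ge0 => ? _]; rewrite sqr_ge0.
Qed.

Lemma frobenius_eq0 H : frobenius H = 0 -> H = 0.
Proof.
move=> h; apply/matrixP => i j; have := frobenius_entry H i j; rewrite h mxE => hij.
by apply/eqP; rewrite -modulus_eq0 -sqrf_eq0 eq_le hij sqr_ge0.
Qed.

Lemma modulus_sqrE (z : C) : modulus z ^+ 2 = complex.Re z ^+ 2 + complex.Im z ^+ 2.
Proof. by rewrite /modulus normc_def /= sqr_sqrtr // addr_ge0 ?sqr_ge0. Qed.

Lemma frobeniusD (H H' : 'M[C]_N) (t : R) : frobenius (H + t%:C%C *: H') =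
  frobenius H + 2 * t * complex.Re (pairing (map_mx Num.conj H) H') + t ^+ 2 * frobenius H'.
Proof.
have ReD (x y : C) : complex.Re (x + y) = complex.Re x + complex.Re y.
  by case: x; case: y.
have Resum (I : Type) (r : seq I) (F : I -> C) :
    complex.Re (\sum_(i <- r) F i) = \sum_(i <- r) complex.Re (F i).
  by elim: r => [|i r IH]; rewrite ?big_nil // !big_cons ReD IH.
rewrite /frobenius /pairing Resum !mulr_sumr -!big_split /=; apply: eq_bigr => i _.
rewrite Resum !mulr_sumr -!big_split /=; apply: eq_bigr => j _.
rewrite !mxE !modulus_sqrE; case: (H i j) => a b; case: (H' i j) => c d /=; ring.
Qed.

Let r := \big[Num.max/0]_i Num.max (modulus (lam i).1) (modulus (lam i).2).

Let r1 : r < 1.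
Proof.
apply/bigmax_ltP; split => [|i _]; first exact: ltr01.
by rewrite gt_max -!modulus_lt1; case: (lamD i) => -> ->.
Qed.

Let r0 : 0 <= r. Proof. exact: bigmax_ge_id. Qed.

Let r_ge i : modulus (lam i).1 <= r /\ modulus (lam i).2 <= r.
Proof.
have : Num.max (modulus (lam i).1) (modulus (lam i).2) <= r.
  exact: (le_bigmax _ (fun i => Num.max (modulus (lam i).1) (modulus (lam i).2))).
by rewrite ge_max => /andP[].
Qed.

(** The diagonals of Lambda1 and Lambda2 are at least 1 - r^2, so the diagonal of an element of the
    cone bounds those of G and D, which bound all entries. This is what makes the minimization
    compact. *)
Lemma cone_bound G D (B : R) : psd G -> psd D ->
  (forall i, modulus ((schur L1 G + schur L2 D) i i) <= B) ->
  (forall i j, modulus (G i j) <= B / (1 - r ^+ 2)) /\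
  (forall i j, modulus (D i j) <= B / (1 - r ^+ 2)).
Proof.
move=> pG pD hB; have d0 : 0 < 1 - r ^+ 2 by rewrite subr_gt0 exprn_ilt1.
have ReE (z : C) : 0 <= z -> z = (complex.Re z)%:C%C by move=> /ger0_real /RRe_real.
have diag i : complex.Re (G i i) <= B / (1 - r ^+ 2) /\
    complex.Re (D i i) <= B / (1 - r ^+ 2).
  have := hB i; rewrite !mxE.
  have Li (z : C) : 1 - z^* * z = (1 - modulus z ^+ 2)%:C%C.
    by rewrite rmorphB rmorph1 rmorphXn /= -modulusE normCKC.
  rewrite !Li (ReE _ (psd_diag_ge0 i pG)) (ReE _ (psd_diag_ge0 i pD)) /=.
  have g0 : 0 <= complex.Re (G i i) by rewrite -ler0c -ReE ?psd_diag_ge0.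
  have h0 : 0 <= complex.Re (D i i) by rewrite -ler0c -ReE ?psd_diag_ge0.
  have [l1 l2] := r_ge i.
  have s1 : modulus (lam i).1 ^+ 2 <= r ^+ 2 by rewrite lerXn2r // nnegrE modulus_ge0.
  have s2 : modulus (lam i).2 ^+ 2 <= r ^+ 2 by rewrite lerXn2r // nnegrE modulus_ge0.
  rewrite -!rmorphM -rmorphD modulus_real => h.
  have := le_trans (ler_norm _) h => {}h.
  by rewrite !ler_pdivlMr //; split; nra.
split => i j.
  apply: le_trans (psd_entry_bound i j pG) _.
  by have [h _] := diag i; have [h' _] := diag j; lra.
apply: le_trans (psd_entry_bound i j pD) _.
by have [_ h] := diag i; have [_ h'] := diag j; lra.
Qed.

Lemma pairing_delta (K L : 'M[C]_N) (x : 'cV[C]_N) :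
  pairing K (schur L (\matrix_(i, j) ((x i 0)^* * x j 0))) = (x ^t* *m schur K L *m x) 0 0.
Proof.
rewrite mulmx3E; apply: eq_bigr => i _; apply: eq_bigr => j _.
by rewrite !mxE; ring.
Qed.

(** Let c be a point of the cone nearest to W, and let K represent the functional given by H = c -
    W. First-order optimality makes it nonnegative on the cone and zero at c; hence its value at W
    is -|c - W|^2. *)
Lemma separation W : W \is hermsymmx -> ~ cone W ->
  exists K, admissible lam K /\ complex.Re (pairing K W) < 0.
Proof.
move=> hW nW.
(* A competitor no farther from W than 0 has diagonal entries of modulus at most |W_ii| plus the
   norm of W, hence at most 1 + |W|^2 by x <= (1 + x^2) / 2. Restricting to this bound loses no
   minimizer. *)
pose B := 1 + 2 * frobenius W + 1.
pose M := B / (1 - r ^+ 2).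
pose c v := schur L1 (herm_mx false v) + schur L2 (herm_mx true v) : 'M[C]_N.
pose I := (bool * 'cV[C]_N)%type.
pose F (k : I) v := complex.Re (((k.2) ^t* *m herm_mx k.1 v *m k.2) 0 0).
pose f v := frobenius (c v - W).
have d0 : 0 < 1 - r ^+ 2 by rewrite subr_gt0 exprn_ilt1.
have B0 : 0 <= B by have := frobenius_ge0 W; rewrite /B; lra.
have M0 : 0 <= M by rewrite divr_ge0 // ltW.
have z0 b : herm_mx b (herm_coord (0 : 'M[C]_N) 0) = 0.
  have h0 : (0 : 'M[C]_N) \is hermsymmx by apply: psd_herm; exact: psd0.
  by rewrite herm_mxK //; case: b.
have Fc k : continuous (F k).
  by have [] := ccontinuous_form k.2 (fun i j => @ccontinuous_herm R N k.1 i j).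
have cc i j : ccontinuous (fun v => (c v - W) i j).
  rewrite (_ : (fun v => _) = (fun v => L1 i j * herm_mx false v i j +
    L2 i j * herm_mx true v i j + - W i j)); last by apply/funext => v; rewrite !mxE.
  apply: ccontinuousD; last exact: ccontinuous_cst.
  by apply: ccontinuousD;
    (apply: ccontinuousM; [exact: ccontinuous_cst|exact: ccontinuous_herm]).
have fc : continuous f.
  have h : ccontinuous (fun v => \sum_i \sum_j (c v - W) i j * ((c v - W) i j)^*).
    apply: ccontinuous_sum => i; apply: ccontinuous_sum => j.
    by apply: ccontinuousM => //; exact: ccontinuous_conj.
  have [h1 _] := h; rewrite (_ : f = (fun v => complex.Re
    (\sum_i \sum_j (c v - W) i j * ((c v - W) i j)^*))) //; apply/funext => v.
  rewrite /f /frobenius (_ : \sum_i \sum_j (c v - W) i j * ((c v - W) i j)^* =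
    (\sum_i \sum_j modulus ((c v - W) i j) ^+ 2)%:C%C) //.
  rewrite rmorph_sum; apply: eq_bigr => i _; rewrite rmorph_sum; apply: eq_bigr => j _.
  by rewrite -normCK modulusE rmorphXn.
have [||v [vF vM vmin]] := @compact_minimum R _ M I F f (herm_coord 0 0) Fc fc.
- by move=> k; rewrite /F z0 mulmx0 mul0mx mxE.
- by apply: herm_coord_bound => i j; rewrite mxE modulus0.
have pv b : psd (herm_mx b v).
  by apply: herm_psd => [|x]; [exact: herm_mx_herm|exact: (vF (b, x))].
pose H := c v - W.
have cv : cone (c v) by exists (herm_mx false v), (herm_mx true v).
have gmin G D : psd G -> psd D ->
    frobenius H <= frobenius (schur L1 G + schur L2 D - W).
  move=> pG pD; have [big|small] := ltP (frobenius W) (frobenius (schur L1 G + schur L2 D - W)).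
    apply: le_trans (ltW big).
    have := vmin (herm_coord 0 0); rewrite {2}/f /c !z0 !schur0r add0r sub0r.
    have -> : frobenius (- W) = frobenius W.
      by apply: eq_bigr => i _; apply: eq_bigr => j _; rewrite mxE modulusN.
    apply; first by move=> k; rewrite /F z0 mulmx0 mul0mx mxE.
    by apply: herm_coord_bound => i j; rewrite mxE modulus0.
  have [] := @cone_bound G D B pG pD.
    move=> i; set u := schur L1 G + schur L2 D in small *.
    have -> : u i i = (u - W) i i + W i i by rewrite !mxE; ring.
    apply: le_trans (modulusD _ _) _.
    have := frobenius_entry (u - W) i i; have := frobenius_entry W i i.
    set a := modulus _; set b := modulus _ => h1 h2.
    have := frobenius_ge0 W; rewrite /B; move: small h1 h2.
    have := sqr_ge0 (a - 1); have := sqr_ge0 (b - 1); nra.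
  move=> hG hD; have := vmin (herm_coord G D).
  rewrite {2}/f /c !herm_mxK ?psd_herm //; apply; last exact: herm_coord_bound.
  move=> [b x]; rewrite /F herm_mxK ?psd_herm //=.
  have : psd (if b then D else G) by case: b.
  by case=> _ /(_ x); rewrite lecE => /andP[_].
have hH : H \is hermsymmx.
  rewrite hermsymmx_adj /H adjmxB; move: (cone_herm cv) hW.
  by rewrite !hermsymmx_adj => /eqP <- /eqP <-.
have H0 : frobenius H != 0.
  apply/eqP => /frobenius_eq0 /eqP; rewrite subr_eq0 => /eqP cW.
  by apply: nW; rewrite -cW.
have Hpos : 0 < frobenius H by rewrite lt_def H0 frobenius_ge0.
pose K := map_mx Num.conj H.
(* The quadratic [t |-> |H + t H'|^2] is minimal at 0 on [0, oo). *)
have first_order H' (s : R) : (s = 1 \/ s = -1) ->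
    (forall t : R, 0 < t <= 1 -> cone (c v + (s * t)%:C%C *: H')) ->
    0 <= s * complex.Re (pairing K H').
  move=> s1 hc; rewrite leNgt; apply/negP => neg.
  set p := complex.Re _ in neg; pose A := frobenius H'.
  have A0 : 0 <= A := frobenius_ge0 H'.
  have ss : s ^+ 2 = 1 by case: s1 => ->; rewrite ?sqrrN expr1n.
  have A1 : 0 < A + 1 by rewrite ltr_wpDl.
  pose t := Num.min 1 (- (s * p) / (A + 1)).
  have t0 : 0 < t by rewrite lt_min ltr01 divr_gt0 // oppr_gt0.
  have t1 : t <= 1 by rewrite ge_min lexx.
  have tA : t * (A + 1) <= - (s * p) by rewrite -ler_pdivlMr // ge_min lexx orbT.
  have [|G [D [pG pD cE]]] := hc t; first by rewrite t0.
  have := gmin _ _ pG pD; rewrite -cE.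
  have -> : c v + (s * t)%:C%C *: H' - W = H + (s * t)%:C%C *: H' by rewrite /H addrAC.
  rewrite frobeniusD -/p -/A exprMn ss mul1r -addrA lerDl => h.
  have h2 := ler_wpM2l (ltW t0) tA; have h3 : t * (s * p) < 0 by rewrite pmulr_rlt0.
  suff : (0 : R) < 0 by rewrite ltxx.
  have h4 : 0 < t ^+ 2 by rewrite exprn_gt0.
  move: h h2; rewrite (_ : 2 * (s * t) * p = 2 * (t * (s * p))); last by ring.
  have -> : t * (t * (A + 1)) = t ^+ 2 * A + t ^+ 2 by ring.
  rewrite mulrN; move: (t ^+ 2 * A) (t * (s * p)) (t ^+ 2) h3 h4 => *; lra.
have K_ge0 H' : cone H' -> 0 <= complex.Re (pairing K H').
  move=> cH'; rewrite -[X in 0 <= X]mul1r; apply: first_order; first by left.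
  move=> t /andP[t0 _]; apply: coneD => //; apply: coneZ => //.
  by rewrite mul1r ler0c ltW.
have K_cv : complex.Re (pairing K (c v)) = 0.
  apply/eqP; rewrite eq_le K_ge0 // andbT -oppr_ge0 -mulN1r.
  apply: first_order; first by right.
  move=> t /andP[t0 t1]; rewrite -{1}[c v]scale1r -scalerDl; apply: coneZ => //.
  by rewrite -(rmorph1 (real_complex R)) -rmorphD ler0c mulN1r subr_ge0.
exists K; split; last first.
  have -> : W = c v + (-1) *: H by rewrite /H scaleN1r opprB addrC subrK.
  rewrite pairingD pairingZ.
  have -> : pairing K H = (frobenius H)%:C%C.
    rewrite rmorph_sum; apply: eq_bigr => i _; rewrite rmorph_sum; apply: eq_bigr => j _.
    by rewrite mxE mulrC -normCK modulusE rmorphXn.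
  have ReD (x y : C) : complex.Re (x + y) = complex.Re x + complex.Re y.
    by case: x; case: y.
  by rewrite ReD K_cv add0r mulN1r -rmorphN /= oppr_lt0.
have hK : K \is hermsymmx.
  rewrite hermsymmx_adj; apply/eqP/matrixP => i j.
  rewrite adjmxE [K i j]mxE [K j i]mxE.
  by move: hH; rewrite hermsymmx_adj => /eqP/matrixP/(_ i j); rewrite adjmxE => <-.
have pdelta (x : 'cV[C]_N) : psd (\matrix_(i, j) ((x i 0)^* * x j 0) : 'M[C]_N).
  rewrite (_ : \matrix_(i, j) _ = (x^T) ^t* *m x^T); first exact: psd_gram.
  by apply/matrixP => i j; rewrite !mxE big_ord1 !mxE.
split; apply: herm_psd => [|x].
- by apply: schur_herm; [exact: hK|exact: Lambda1_herm].
- rewrite -pairing_delta; apply: K_ge0.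
  exists (\matrix_(i, j) ((x i 0)^* * x j 0)), 0.
  by split; [exact: pdelta|exact: psd0|rewrite schur0r addr0].
- by apply: schur_herm; [exact: hK|exact: Lambda2_herm].
rewrite -pairing_delta; apply: K_ge0.
exists 0, (\matrix_(i, j) ((x i 0)^* * x j 0)).
by split; [exact: psd0|exact: pdelta|rewrite schur0r add0r].
Qed.

Lemma Wmx_herm (w : 'I_N -> C) : Wmx w \is hermsymmx.
Proof.
rewrite hermsymmx_adj; apply/eqP/matrixP => i j.
by rewrite adjmxE !mxE rmorphB rmorph1 rmorphM /= conjCK mulrC.
Qed.

Lemma agler w phi : Pick_solution lam w phi -> exists G D, permissible lam w G D.
Proof.
move=> sol; apply: contrapT => h.
have [|K [adm neg]] := separation (Wmx_herm w).
  by case=> G [D [pG pD WE]]; apply: h; exists G, D; split.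
have := dual_inequality lamD sol adm; rewrite -/(pairing K (Wmx w)) lecE => /andP[_].
by rewrite leNgt neg.
Qed.

Lemma trace_real (K : 'M[C]_N) : psd K -> \tr K = (complex.Re (\tr K))%:C%C.
Proof.
move=> pK; rewrite RRe_real // ger0_real // sumr_ge0 // => i _; exact: psd_diag_ge0.
Qed.

Lemma admissibleZ K (a : C) : 0 <= a -> admissible lam K -> admissible lam (a *: K).
Proof.
move=> a0 [p1 p2]; split; rewrite schurC schurZr schurC; exact: psdZ.
Qed.

Lemma pairingZl (K H : 'M[C]_N) a : pairing (a *: K) H = a * pairing K H.
Proof.
rewrite /pairing mulr_sumr; apply: eq_bigr => i _; rewrite mulr_sumr.
by apply: eq_bigr => j _; rewrite mxE mulrA.
Qed.

Lemma psd_trace_eq0 (K : 'M[C]_N) : psd K -> \tr K = 0 -> K = 0.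
Proof.
move=> pK /eqP; rewrite psumr_eq0 => [/allP h|i _]; last exact: psd_diag_ge0.
by apply: psd_eq0 => // i; apply/eqP/h; rewrite mem_index_enum.
Qed.

Lemma psd_entry_trace (K : 'M[C]_N) i j : psd K -> modulus (K i j) <= complex.Re (\tr K).
Proof.
move=> pK; apply: le_trans (psd_entry_bound i j pK) _.
have h k : complex.Re (K k k) <= complex.Re (\tr K).
  have : K k k <= \tr K.
    rewrite /mxtrace (bigD1 k) //= lerDl sumr_ge0 // => l _; exact: psd_diag_ge0.
  by rewrite lecE => /andP[].
by have := h i; have := h j; lra.
Qed.

Lemma ReD (x y : C) : complex.Re (x + y) = complex.Re x + complex.Re y.
Proof. by case: x; case: y. Qed.

Lemma separation_normalized W : W \is hermsymmx -> ~ cone W ->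
  exists K, [/\ admissible lam K, \tr K = 1 & complex.Re (pairing K W) < 0].
Proof.
move=> hW nW; have [K [adm neg]] := separation hW nW.
have pK := admissible_psd lamD adm.
pose t := complex.Re (\tr K).
have tE : \tr K = t%:C%C := trace_real pK.
have t0 : 0 < t.
  rewrite lt_def -ler0c -tE; apply/andP; split; last first.
    by rewrite sumr_ge0 // => i _; exact: psd_diag_ge0.
  apply/eqP => tt; have K0 : K = 0 by apply: psd_trace_eq0; rewrite // tE tt.
  by move: neg; rewrite K0 /pairing big1 ?ltxx // => i _; rewrite big1 // => j _;
    rewrite mxE mul0r.
exists (t^-1%:C%C *: K); split.
- by apply: admissibleZ => //; rewrite ler0c invr_ge0 ltW.
- by rewrite mxtraceZ tE -rmorphM mulVf ?gt_eqF.
rewrite pairingZl; case: (pairing K W) neg => a b /= neg.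
by rewrite mul0r subr0 pmulr_rlt0 // invr_gt0.
Qed.

(** Minimize the pairing with W over the compact set of admissible K of trace 1. A positive minimum
    would contradict the functional that separates W - e J from the cone (J the all-ones matrix) for
    e small against the minimum. *)
Lemma active_functional W : W \is hermsymmx ->
  (forall e : R, 0 < e -> ~ cone (W - e%:C%C *: const_mx 1)) ->
  exists K, [/\ admissible lam K, \tr K = 1 & complex.Re (pairing K W) <= 0].
Proof.
move=> hW nW.
have hJ (e : R) : W - e%:C%C *: const_mx 1 \is hermsymmx.
  apply: hermD; [exact: hW|rewrite hermsymmx_adj -scaleNr adjmxZ; apply/eqP/matrixP => i j;
  by rewrite !mxE rmorph1 conj_Creal // realN complex_real].
pose I := ((bool * 'cV[C]_N) + bool)%type.
pose k v := herm_mx false v : 'M[C]_N.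
pose F (c : I) v := match c with
  | inl (b, x) => complex.Re ((x ^t* *m schur (k v) (if b then L2 else L1) *m x) 0 0)
  | inr b => if b then complex.Re (\tr (k v)) - 1 else 1 - complex.Re (\tr (k v)) end.
pose f v := complex.Re (pairing (k v) W).
have ck i j : ccontinuous (fun v => k v i j) by exact: ccontinuous_herm.
have ctr : continuous (fun v => complex.Re (\tr (k v))).
  by have [] := ccontinuous_sum (index_enum 'I_N) (fun i => ck i i).
have Fc c : continuous (F c).
  case: c => [[b x]|b] /=.
    have h i j : ccontinuous (fun v => schur (k v) (if b then L2 else L1) i j).
      rewrite (_ : (fun v => _) = (fun v => k v i j * (if b then L2 else L1) i j)).
        by apply: ccontinuousM => //; exact: ccontinuous_cst.
      by apply/funext => v; rewrite mxE.
    by have [] := ccontinuous_form x h.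
  case: b => v; first exact: cvgB (ctr v) (cvg_cst _).
  exact: cvgB (cvg_cst _) (ctr v).
have fc : continuous f.
  have h : ccontinuous (fun v => pairing (k v) W).
    apply: ccontinuous_sum => i; apply: ccontinuous_sum => j.
    by apply: ccontinuousM => //; exact: ccontinuous_cst.
  by case: h.
have feas K : admissible lam K -> \tr K = 1 -> [/\ k (herm_coord K 0) = K,
    forall c, 0 <= F c (herm_coord K 0) & forall i, `|herm_coord K 0 0 i| <= 1].
  move=> adm trK; have pK := admissible_psd lamD adm.
  have kE : k (herm_coord K 0) = K.
    by rewrite /k herm_mxK; [|exact: psd_herm pK|exact: psd_herm (psd0 _ _)].
  split => // [[[b x]|b]|].
  - rewrite /F kE; have : psd (schur K (if b then L2 else L1)) by case: b; case: adm.
    by case=> _ /(_ x); rewrite lecE => /andP[].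
  - by rewrite /F kE trK; case: b; rewrite /= subrr.
  apply: herm_coord_bound => i j; last by rewrite mxE modulus0.
  by apply: le_trans (psd_entry_trace i j pK) _; rewrite trK.
have [K0 [adm0 tr0 _]] := separation_normalized (hJ 1) (nW 1 ltr01).
have [_ F0 b0] := feas _ adm0 tr0.
have [v [vF _ vmin]] := compact_minimum Fc fc F0 b0.
have admv : admissible lam (k v).
  split; apply: herm_psd => [|x].
  - by apply: schur_herm; [exact: herm_mx_herm|exact: Lambda1_herm].
  - exact: (vF (inl (false, x))).
  - by apply: schur_herm; [exact: herm_mx_herm|exact: Lambda2_herm].
  - exact: (vF (inl (true, x))).
have trv : \tr (k v) = 1.
  rewrite (trace_real (admissible_psd lamD admv)).
  have := vF (inr true); have := vF (inr false); rewrite /= => h1 h2.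
  by rewrite (_ : complex.Re _ = 1) //; apply/eqP; rewrite eq_le; apply/andP; split; lra.
exists (k v); split => //; rewrite -/(f v) leNgt; apply/negP => fv.
(* Entries of a positive matrix of trace 1 have modulus at most 1, so N^2 bounds its pairing with
   the all-ones matrix; this fixes the choice of e. *)
pose n2 : R := N%:R * N%:R.
have n20 : 0 <= n2 by rewrite mulr_ge0.
have e0 : 0 < f v / (n2 + 1) by rewrite divr_gt0 // ltr_wpDl.
have [K [adm trK neg]] := separation_normalized (hJ _) (nW _ e0).
have [kE FK bK] := feas _ adm trK.
have := vmin _ FK bK; rewrite {2}/f kE.
have pJ : complex.Re (pairing K (const_mx 1)) <= n2.
  apply: le_trans (ler_norm _) _; apply: le_trans (modulus_Re _) _.
  apply: le_trans (modulus_sum _ _ _) _.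
  apply: (@le_trans _ _ (\sum_(i < N) \sum_(j < N) 1)); last first.
    by rewrite !sumr_const !card_ord /n2 -mulrnA natrM.
  apply: ler_sum => i _; apply: le_trans (modulus_sum _ _ _) _; apply: ler_sum => j _.
  rewrite mxE mulr1; apply: le_trans (psd_entry_trace i j (admissible_psd lamD adm)) _.
  by rewrite trK.
have ReZ (a : R) (z : C) : complex.Re (a%:C%C * z) = a * complex.Re z.
  by case: z => x y /=; rewrite mul0r subr0.
move: neg; rewrite pairingD -scaleNr pairingZ ReD -rmorphN ReZ => neg vm.
have : f v / (n2 + 1) * (n2 + 1) = f v by rewrite divfK // gt_eqF // ltr_wpDl.
set e := f v / _ in e0 neg * => eE.
suff : f v < f v by rewrite ltxx.
nra.
Qed.
End Separation.

(** * Differentiability of matrix-valued functions *)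

Section MatrixDifferentiable.
Variable R : realType.
Local Notation C := R[i].
Local Notation diff f z := (differentiable (f : C^o * C^o -> C^o) (z : C^o * C^o)).
Implicit Types (f g : C * C -> C) (z : C * C).

Lemma diff_cst (c : C) z : diff (fun=> c) z.
Proof. exact: differentiable_cst. Qed.

Lemma diff_fst z : diff (fun u => u.1) z.
Proof.
apply: (@linear_differentiable _ _ _ (fst : {linear (C^o * C^o)%type -> C^o})).
by move=> u; exact: cvg_fst.
Qed.

Lemma diff_snd z : diff (fun u => u.2) z.
Proof.
apply: (@linear_differentiable _ _ _ (snd : {linear (C^o * C^o)%type -> C^o})).
by move=> u; exact: cvg_snd.
Qed.

Lemma diffD f g z : diff f z -> diff g z -> diff (fun u => f u + g u) z.
Proof. exact: differentiableD. Qed.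

Lemma diffM f g z : diff f z -> diff g z -> diff (fun u => f u * g u) z.
Proof. exact: differentiableM. Qed.

Lemma diffV f z : f z != 0 -> diff f z -> diff (fun u => (f u)^-1) z.
Proof.
move=> f0 df; exact: (@differentiable_comp _ _ _ _ (f : C^o * C^o -> C^o)
  (GRing.inv : C^o -> C^o) z df (@differentiable_Rinv C (f z) f0)).
Qed.

Lemma diff_sum (I : Type) (r : seq I) (f : I -> C * C -> C) z :
  (forall i, diff (f i) z) -> diff (fun u => \sum_(i <- r) f i u) z.
Proof.
move=> h; elim: r => [|i r IH].
  by rewrite (_ : (fun u => _) = fun=> 0); [exact: diff_cst|apply/funext => u; rewrite big_nil].
rewrite (_ : (fun u => _) = fun u => f i u + \sum_(j <- r) f j u).
  exact: diffD.
by apply/funext => u; rewrite big_cons.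
Qed.

Lemma diff_prod (I : Type) (r : seq I) (f : I -> C * C -> C) z :
  (forall i, diff (f i) z) -> diff (fun u => \prod_(i <- r) f i u) z.
Proof.
move=> h; elim: r => [|i r IH].
  by rewrite (_ : (fun u => _) = fun=> 1); [exact: diff_cst|apply/funext => u; rewrite big_nil].
rewrite (_ : (fun u => _) = fun u => f i u * \prod_(j <- r) f j u).
  exact: diffM.
by apply/funext => u; rewrite big_cons.
Qed.

Definition mxdiff m n (M : C * C -> 'M[C]_(m, n)) z := forall i j, diff (fun u => M u i j) z.

Lemma mxdiff_cst m n (M : 'M[C]_(m, n)) z : mxdiff (fun=> M) z.
Proof. by move=> i j; exact: diff_cst. Qed.

Lemma mxdiffD m n (A B : C * C -> 'M[C]_(m, n)) z :
  mxdiff A z -> mxdiff B z -> mxdiff (fun u => A u + B u) z.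
Proof.
move=> hA hB i j; rewrite (_ : (fun u => _) = fun u => A u i j + B u i j).
  exact: diffD.
by apply/funext => u; rewrite mxE.
Qed.

Lemma mxdiffZ m n (a : C * C -> C) (A : C * C -> 'M[C]_(m, n)) z :
  diff a z -> mxdiff A z -> mxdiff (fun u => a u *: A u) z.
Proof.
move=> ha hA i j; rewrite (_ : (fun u => _) = fun u => a u * A u i j).
  exact: diffM.
by apply/funext => u; rewrite mxE.
Qed.

Lemma mxdiffN m n (A : C * C -> 'M[C]_(m, n)) z : mxdiff A z -> mxdiff (fun u => - A u) z.
Proof.
move=> hA; rewrite (_ : (fun u => - A u) = fun u => (-1) *: A u).
  by apply: mxdiffZ => //; exact: diff_cst.
by apply/funext => u; rewrite scaleN1r.
Qed.

Lemma mxdiffM m n p (A : C * C -> 'M[C]_(m, n)) (B : C * C -> 'M[C]_(n, p)) z :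
  mxdiff A z -> mxdiff B z -> mxdiff (fun u => A u *m B u) z.
Proof.
move=> hA hB i j; rewrite (_ : (fun u => _) = fun u => \sum_k A u i k * B u k j).
  by apply: diff_sum => k; exact: diffM.
by apply/funext => u; rewrite mxE.
Qed.

Lemma diff_det n (A : C * C -> 'M[C]_n) z : mxdiff A z -> diff (fun u => \det (A u)) z.
Proof.
move=> hA; rewrite /determinant; apply: diff_sum => s; apply: diffM; first exact: diff_cst.
by apply: diff_prod => i; exact: hA.
Qed.

Lemma mxdiff_adj n (A : C * C -> 'M[C]_n) z : mxdiff A z -> mxdiff (fun u => \adj (A u)) z.
Proof.
move=> hA i j; rewrite (_ : (fun u => _) = fun u => cofactor (A u) j i).
  apply: diffM; first exact: diff_cst.
  apply: diff_det => k l; rewrite (_ : (fun u => _) = fun u => A u (lift j k) (lift i l)).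
    exact: hA.
  by apply/funext => u; rewrite !mxE.
by apply/funext => u; rewrite mxE.
Qed.
End MatrixDifferentiable.

(** * Transfer functions of unitary matrices *)

Section Realization.
Variable R : realType.
Local Notation C := R[i].
Variables (n1 n2 : nat).
Implicit Types (U : 'M[C]_(1 + (n1 + n2))) (z : C * C).

(** Blocks of any size are allowed, because the factors of an arbitrary permissible pair may have
    any rank. The final formula is the case of sizes 1 and 1. *)
Definition diag_var z : 'M[C]_(n1 + n2) := block_mx z.1%:M 0 0 z.2%:M.

Definition gen_transfer U z : C :=
  (ulsubmx U + ursubmx U *m diag_var z *m
     invmx (1%:M - drsubmx U *m diag_var z) *m dlsubmx U) 0 0.

(* The same function on the bidisk, by Cramer's rule. *)
Definition rat_transfer U z : C :=
  (ulsubmx U + (\det (1%:M - drsubmx U *m diag_var z))^-1 *: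
    (ursubmx U *m diag_var z *m \adj (1%:M - drsubmx U *m diag_var z) *m dlsubmx U)) 0 0.

Lemma inj_unitmx n (M : 'M[C]_n) : (forall x : 'cV[C]_n, M *m x = 0 -> x = 0) ->
  M \in unitmx.
Proof.
move=> h; rewrite -unitmx_tr -row_free_unit -kermx_eq0; apply/eqP/row_matrixP => i.
rewrite row0; apply: trmx_inj; rewrite trmx0; apply: h.
by apply: trmx_inj; rewrite trmx_mul trmxK trmx0 -row_mul mulmx_ker row0.
Qed.

Lemma sqnorm_col m1 m2 (x : 'cV[C]_m1) (y : 'cV[C]_m2) :
  ((col_mx x y) ^t* *m col_mx x y) 0 0 = (x ^t* *m x) 0 0 + (y ^t* *m y) 0 0.
Proof. by rewrite adjmx_col mul_row_col mxE. Qed.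

Lemma sqnorm_unitary n (U : 'M[C]_n) (x : 'cV[C]_n) : U \is unitarymx ->
  ((U *m x) ^t* *m (U *m x)) 0 0 = (x ^t* *m x) 0 0.
Proof.
by move=> Uu; rewrite adjmxM -mulmxA (mulmxA (U ^t*)) mulmx_adj_unitary ?mul1mx.
Qed.

Lemma sqnorm_diag_var z (x : 'cV[C]_(n1 + n2)) :
  ((diag_var z *m x) ^t* *m (diag_var z *m x)) 0 0 =
  `|z.1| ^+ 2 * ((usubmx x) ^t* *m usubmx x) 0 0 +
  `|z.2| ^+ 2 * ((dsubmx x) ^t* *m dsubmx x) 0 0.
Proof.
rewrite /diag_var -{1 2}[x]vsubmxK mul_block_col !mul0mx add0r addr0 !mul_scalar_mx.
rewrite sqnorm_col !adjmxZ -!scalemxAl -!scalemxAr !scalerA !mxE.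
by rewrite !normCKC.
Qed.

Lemma sqnorm_vsub (x : 'cV[C]_(n1 + n2)) : (x ^t* *m x) 0 0 =
  ((usubmx x) ^t* *m usubmx x) 0 0 + ((dsubmx x) ^t* *m dsubmx x) 0 0.
Proof. by rewrite -{1 2}[x]vsubmxK sqnorm_col. Qed.

Lemma sqnorm_diag_var_le z (x : 'cV[C]_(n1 + n2)) : `|z.1| <= 1 -> `|z.2| <= 1 ->
  ((diag_var z *m x) ^t* *m (diag_var z *m x)) 0 0 <= (x ^t* *m x) 0 0.
Proof.
move=> h1 h2; rewrite sqnorm_diag_var sqnorm_vsub.
by rewrite lerD // ler_piMl ?sqnorm_ge0 // exprn_ile1.
Qed.

Variable U : 'M[C]_(1 + (n1 + n2)).
Hypothesis Uu : U \is unitarymx.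

Lemma unitary_action (a : 'cV[C]_1) (b : 'cV[C]_(n1 + n2)) : U *m col_mx a b =
  col_mx (ulsubmx U *m a + ursubmx U *m b) (dlsubmx U *m a + drsubmx U *m b).
Proof. by rewrite -{1}[U]submxK mul_block_col. Qed.

(** If x = Q E x, with Q the lower right block of U and E the diagonal matrix of z, then U maps (0,
    E x) to a vector whose last part is x. Hence |x| <= |E x|, while E strictly shrinks nonzero
    vectors on the bidisk. *)
Lemma transfer_unit z : bidisk z -> 1%:M - drsubmx U *m diag_var z \in unitmx.
Proof.
move=> [z1 z2]; apply: inj_unitmx => x /eqP.
rewrite mulmxBl mul1mx subr_eq0 -mulmxA => /eqP xE.
have := sqnorm_unitary (col_mx 0 (diag_var z *m x)) Uu.
have z00 : ((0 : 'cV[C]_1) ^t* *m (0 : 'cV[C]_1)) 0 0 = 0 by rewrite mulmx0 mxE.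
rewrite unitary_action !mulmx0 !add0r -xE !sqnorm_col z00 add0r.
rewrite sqnorm_diag_var (sqnorm_vsub x) => e.
have p1 := sqnorm_ge0 (usubmx x); have p2 := sqnorm_ge0 (dsubmx x).
have p3 := sqnorm_ge0 (ursubmx U *m (diag_var z *m x)).
move: e p1 p2 p3; set a := (_ *m usubmx x) 0 0; set b := (_ *m dsubmx x) 0 0.
set c := (_ *m _) 0 0; move=> e p1 p2 p3.
have d1 : 0 < 1 - `|z.1| ^+ 2 by rewrite subr_gt0 exprn_ilt1.
have d2 : 0 < 1 - `|z.2| ^+ 2 by rewrite subr_gt0 exprn_ilt1.
have : c + ((1 - `|z.1| ^+ 2) * a + (1 - `|z.2| ^+ 2) * b) = 0.
  move: e => /eqP; rewrite -subr_eq0 => /eqP <-; ring.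
move/eqP; rewrite paddr_eq0 ?addr_ge0 ?mulr_ge0 ?(ltW d1) ?(ltW d2) // => /andP[_].
rewrite paddr_eq0 ?mulr_ge0 ?(ltW d1) ?(ltW d2) // !mulf_eq0 (gt_eqF d1) (gt_eqF d2) /=.
move=> /andP[/eqP a0 /eqP b0]; rewrite -[x]vsubmxK.
by rewrite (sqnorm_eq0 a0) (sqnorm_eq0 b0) col_mx0.
Qed.

Lemma rat_transferE z : 1%:M - drsubmx U *m diag_var z \in unitmx ->
  rat_transfer U z = gen_transfer U z.
Proof.
by move=> hu; rewrite /rat_transfer /gen_transfer /invmx hu -scalemxAr -scalemxAl.
Qed.

Lemma transfer_solution z : 1%:M - drsubmx U *m diag_var z \in unitmx ->
  exists x, U *m col_mx 1%:M (diag_var z *m x) = col_mx (gen_transfer U z)%:M x.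
Proof.
move=> hu; pose x := invmx (1%:M - drsubmx U *m diag_var z) *m dlsubmx U; exists x.
rewrite unitary_action !mulmx1; congr col_mx.
  by rewrite [LHS]mx11_scalar /gen_transfer /x !mulmxA.
apply/esym/eqP; rewrite -subr_eq mulmxA -{1}[x]mul1mx -mulmxBl /x mulmxA mulmxV //.
by rewrite mul1mx.
Qed.

Lemma transfer_unique z (v : 'cV[C]_1) x : 1%:M - drsubmx U *m diag_var z \in unitmx ->
  U *m col_mx 1%:M (diag_var z *m x) = col_mx v x -> gen_transfer U z = v 0 0.
Proof.
move=> hu; rewrite unitary_action !mulmx1 => /eq_col_mx[vE xE].
have xE' : (1%:M - drsubmx U *m diag_var z) *m x = dlsubmx U.
  by rewrite mulmxBl mul1mx -{1}xE -mulmxA addrK.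
by rewrite /gen_transfer -xE' -!mulmxA mulKmx // vE.
Qed.

(** The energy balance of the unitary U. The diagonal matrix is contractive on the bidisk and
    isometric on the torus, which gives modulus at most 1 and equal to 1 respectively. *)
Lemma transfer_norm z : 1%:M - drsubmx U *m diag_var z \in unitmx ->
  exists x : 'cV[C]_(n1 + n2), `|gen_transfer U z| ^+ 2 + (x ^t* *m x) 0 0 =
    1 + ((diag_var z *m x) ^t* *m (diag_var z *m x)) 0 0.
Proof.
move=> /transfer_solution[x e]; exists x.
have := sqnorm_unitary (col_mx 1%:M (diag_var z *m x)) Uu; rewrite e !sqnorm_col.
by rewrite !sqnormE !big_ord1 !mxE eqxx !mulr1n normr1 expr1n.
Qed.

Lemma transfer_le1 z : bidisk z -> modulus (gen_transfer U z) <= 1.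
Proof.
move=> hz; have [x e] := transfer_norm (transfer_unit hz).
case: hz => /ltW z1 /ltW z2; have := sqnorm_diag_var_le x z1 z2.
rewrite -(lerD2l 1) -e lerD2r => h.
by rewrite -modulus_le1 -(ler_pXn2r (n := 2)) ?nnegrE // expr1n.
Qed.

Lemma transfer_torus z : `|z.1| = 1 -> `|z.2| = 1 ->
  1%:M - drsubmx U *m diag_var z \in unitmx -> modulus (gen_transfer U z) = 1.
Proof.
move=> z1 z2 /transfer_norm[x]; rewrite sqnorm_diag_var z1 z2 !expr1n !mul1r -sqnorm_vsub.
move=> /addIr /eqP; rewrite sqrp_eq1 ?normr_ge0 // modulus_eq1.
by move/eqP.
Qed.

Lemma rat_transfer_diff z : \det (1%:M - drsubmx U *m diag_var z) != 0 ->
  differentiable (rat_transfer U : C^o * C^o -> C^o) (z : C^o * C^o).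
Proof.
move=> det0; have hE : mxdiff diag_var z.
  rewrite (_ : diag_var = fun u => u.1 *: (block_mx 1%:M 0 0 0 : 'M[C]_(n1 + n2)) +
    u.2 *: (block_mx 0 0 0 1%:M : 'M[C]_(n1 + n2))); last first.
    apply/funext => u; rewrite !scale_block_mx add_block_mx !scaler0 !addr0 !add0r.
    by rewrite !scalemx1.
  by apply: mxdiffD; (apply: mxdiffZ; last exact: mxdiff_cst);
    [exact: diff_fst|exact: diff_snd].
have hM : mxdiff (fun u => 1%:M - drsubmx U *m diag_var u) z.
  apply: mxdiffD; first exact: mxdiff_cst.
  by apply: mxdiffN; apply: mxdiffM => //; exact: mxdiff_cst.
suff : mxdiff (fun u => ulsubmx U + (\det (1%:M - drsubmx U *m diag_var u))^-1 *:
  (ursubmx U *m diag_var u *m \adj (1%:M - drsubmx U *m diag_var u) *m dlsubmx U)) z.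
  by move=> /(_ 0 0).
apply: mxdiffD; first exact: mxdiff_cst.
apply: mxdiffZ; first by apply: diffV => //; exact: diff_det.
apply: mxdiffM; last exact: mxdiff_cst.
apply: mxdiffM; last exact: mxdiff_adj.
by apply: mxdiffM => //; exact: mxdiff_cst.
Qed.

Lemma rat_transfer_Hinfty : Hinfty (rat_transfer U) /\ Hinfty_norm (rat_transfer U) <= 1.
Proof.
have le1 z : bidisk z -> modulus (rat_transfer U z) <= 1.
  by move=> hz; rewrite (rat_transferE (transfer_unit hz)) transfer_le1.
split; first split.
- move=> z hz; apply: rat_transfer_diff.
  by rewrite -unitfE -unitmxE; exact: transfer_unit.
- by exists 1.
apply: ge_sup; first by exists (modulus (rat_transfer U (0, 0))), (0, 0) => //;
  split; rewrite /= normr0.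
by move=> _ [z hz <-]; exact: le1.
Qed.

Lemma transfer_pick N (lam : 'I_N -> C * C) (w : 'I_N -> C) (x : 'I_N -> 'cV[C]_(n1 + n2)) :
  (forall j, bidisk (lam j)) ->
  (forall j, U *m col_mx 1%:M (diag_var (lam j) *m x j) = col_mx (w j)%:M (x j)) ->
  Pick_solution lam w (rat_transfer U).
Proof.
move=> lamD h; have [h1 h2] := rat_transfer_Hinfty; split => // j.
rewrite (rat_transferE (transfer_unit (lamD j))) (transfer_unique (transfer_unit (lamD j)) (h j)).
by rewrite mxE eqxx mulr1n.
Qed.
End Realization.

(** * A permissible pair yields a solution *)

Section Sufficiency.
Variable R : realType.
Local Notation C := R[i].

Lemma colligation_gram N n1 n2 (lam : 'I_N -> C * C) (w : 'I_N -> C)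
    (A : 'M[C]_(n1, N)) (B : 'M[C]_(n2, N)) :
  Wmx w = schur (Lambda1 lam) (A ^t* *m A) + schur (Lambda2 lam) (B ^t* *m B) ->
  let X := col_mx (const_mx 1 : 'rV[C]_N) (col_mx (\matrix_(k, j) ((lam j).1 * A k j))
    (\matrix_(k, j) ((lam j).2 * B k j))) in
  let Y := col_mx (\row_j w j) (col_mx A B) in X ^t* *m X = Y ^t* *m Y.
Proof.
move=> WE X Y; rewrite /X /Y !adjmx_col !mul_row_col; apply/matrixP => i j.
have e : (Wmx w) i j = (schur (Lambda1 lam) (A ^t* *m A) + schur (Lambda2 lam) (B ^t* *m B)) i j.
  by rewrite WE.
move: e; rewrite !mxE !big_ord1 !mxE => e.
have s1 : \sum_k ((\matrix_(k0, j0) ((lam j0).1 * A k0 j0)) ^t*) i k *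
    (\matrix_(k0, j0) ((lam j0).1 * A k0 j0)) k j =
    ((lam i).1)^* * (lam j).1 * \sum_k (A ^t*) i k * A k j.
  by rewrite mulr_sumr; apply: eq_bigr => k _; rewrite !mxE rmorphM /=; ring.
have s2 : \sum_k ((\matrix_(k0, j0) ((lam j0).2 * B k0 j0)) ^t*) i k *
    (\matrix_(k0, j0) ((lam j0).2 * B k0 j0)) k j =
    ((lam i).2)^* * (lam j).2 * \sum_k (B ^t*) i k * B k j.
  by rewrite mulr_sumr; apply: eq_bigr => k _; rewrite !mxE rmorphM /=; ring.
rewrite s1 s2 rmorph1 mul1r.
move: e; move: (\sum_k (A ^t*) i k * A k j) (\sum_k (B ^t*) i k * B k j) => a b e.
have -> : 1 = (1 - (w i)^* * w j) + (w i)^* * w j by ring.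
by rewrite e; ring.
Qed.

Lemma realization N (lam : 'I_N -> C * C) (w : 'I_N -> C) G D :
  (forall j, bidisk (lam j)) -> permissible lam w G D ->
  exists phi, Pick_solution lam w phi.
Proof.
move=> lamD [/psd_factor[A ->] /psd_factor[B ->] WE].
have [U Uu UE] := unitary_extension (colligation_gram WE).
exists (rat_transfer U).
apply: (@transfer_pick _ _ _ _ Uu _ _ _ (fun j => col j (col_mx A B))) => // j.
have := congr1 (col j) UE; rewrite -mulmx_col !col_col_mx => e.
have -> : (w j)%:M = col j (\row_j w j) by apply/matrixP => a b; rewrite !ord1 !mxE.
rewrite -e; congr (U *m _); congr col_mx; first by apply/matrixP => a b; rewrite !ord1 !mxE.
rewrite /diag_var mul_block_col !mul0mx add0r addr0 !mul_scalar_mx.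
by congr col_mx; apply/colP => k; rewrite !mxE.
Qed.
End Sufficiency.

(** * Scaling solutions *)

Section Scaling.
Variable R : realType.
Local Notation C := R[i].
Variables (N : nat) (lam : 'I_N -> C * C).
Implicit Types (phi : C * C -> C) (w : 'I_N -> C).

Lemma conj_realC (x : R) : ((x%:C%C)^* : C) = x%:C%C.
Proof. by apply: conj_Creal; rewrite complex_real. Qed.

Lemma Hinfty_norm_ub phi z : Hinfty phi -> bidisk z -> modulus (phi z) <= Hinfty_norm phi.
Proof.
move=> [_ [M hM]] hz; apply: ub_le_sup; last by exists z.
by exists M => _ [u hu <-]; exact: hM.
Qed.

Lemma Hinfty_norm_le phi M : (forall z, bidisk z -> modulus (phi z) <= M) ->
  Hinfty_norm phi <= M.
Proof.
move=> h; apply: ge_sup; last by move=> _ [z hz <-]; exact: h.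
by exists (modulus (phi (0, 0))), (0, 0) => //; split; rewrite /= normr0.
Qed.

Lemma Hinfty_scale phi (c : C) : Hinfty phi -> Hinfty (fun z => c * phi z) /\
  Hinfty_norm (fun z => c * phi z) <= modulus c * Hinfty_norm phi.
Proof.
move=> hphi; have le z : bidisk z -> modulus (c * phi z) <= modulus c * Hinfty_norm phi.
  by move=> hz; rewrite modulusM ler_wpM2l ?modulus_ge0 // Hinfty_norm_ub.
split; last exact: Hinfty_norm_le.
split; last by exists (modulus c * Hinfty_norm phi).
by move=> z hz; apply: diffM; [exact: diff_cst|exact: hphi.1].
Qed.

Lemma scale_solution w phi (c : C) : modulus c * Hinfty_norm phi <= 1 ->
  Hinfty phi -> (forall i, phi (lam i) = w i) ->
  Pick_solution lam (fun i => c * w i) (fun z => c * phi z) /\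
  Hinfty_norm (fun z => c * phi z) <= modulus c * Hinfty_norm phi.
Proof.
move=> h hphi hw; have [h1 h2] := Hinfty_scale c hphi.
by split=> //; split=> //; [move=> i; rewrite hw|exact: le_trans h].
Qed.

Lemma pairing_Wmx (K : 'M[C]_N) w : pairing K (Wmx w) =
  pairing K (const_mx 1) - \sum_i \sum_j K i j * ((w i)^* * w j).
Proof.
rewrite /pairing -sumrB; apply: eq_bigr => i _; rewrite -sumrB.
by apply: eq_bigr => j _; rewrite !mxE; ring.
Qed.

Lemma pairing_const (K : 'M[C]_N) :
  pairing K (const_mx 1) = ((const_mx 1 : 'cV[C]_N) ^t* *m K *m (const_mx 1 : 'cV[C]_N)) 0 0.
Proof.
rewrite mulmx3E; apply: eq_bigr => i _; apply: eq_bigr => j _.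
by rewrite !mxE rmorph1 mul1r.
Qed.

(* A multiple [c phi] with [c > 1] is still a solution for the data [c w]. *)
Lemma pairing_strict (K : 'M[C]_N) w phi : (forall i, bidisk (lam i)) ->
  Pick_solution lam w phi -> Hinfty_norm phi < 1 -> admissible lam K ->
  pairing K (Wmx w) = 0 -> pairing K (const_mx 1) = 0.
Proof.
move=> lamD [hphi hw _] n1 adm KW0; have pK := admissible_psd lamD adm.
pose r : R := 1 - (1 - Hinfty_norm phi) / 2.
have p0 : 0 <= Hinfty_norm phi.
  apply: le_trans (Hinfty_norm_ub hphi (_ : bidisk (0, 0))); first exact: modulus_ge0.
  by split; rewrite /= normr0.
have r0 : 0 < r by rewrite /r; lra.
have r1 : r < 1 by rewrite /r; lra.
have pr : Hinfty_norm phi <= r by rewrite /r; lra.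
have mc : modulus ((r^-1)%:C%C : C) = r^-1 by rewrite modulus_real gtr0_norm ?invr_gt0.
have [|sol _] := @scale_solution w phi (r^-1)%:C%C _ hphi hw.
  by rewrite mc mulrC ler_pdivrMr // mul1r.
have := dual_inequality lamD sol adm; rewrite -/(pairing K (Wmx _)) pairing_Wmx.
have -> : \sum_i \sum_j K i j * (((r^-1)%:C%C * w i)^* * ((r^-1)%:C%C * w j)) =
    (r ^- 2)%:C%C * \sum_i \sum_j K i j * ((w i)^* * w j).
  rewrite mulr_sumr; apply: eq_bigr => i _; rewrite mulr_sumr; apply: eq_bigr => j _.
  rewrite rmorphM /= conj_realC.
  have -> : ((r ^- 2)%:C%C : C) = (r^-1)%:C%C * (r^-1)%:C%C.
    by rewrite -rmorphM /= -invfM -expr2.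
  by ring.
have := pairing_Wmx K w; rewrite KW0 => /esym /eqP; rewrite subr_eq0 => /eqP <-.
have : 0 <= pairing K (const_mx 1) by rewrite pairing_const; case: pK.
move: (pairing K (const_mx 1)) => x x0; rewrite -{1}[x]mul1r -mulrBl.
have h : ((1 : C) - (r ^- 2)%:C%C) < 0.
  rewrite -(rmorph1 (real_complex R)) -rmorphB /= -(rmorph0 (real_complex R)) ltcR.
  by rewrite subr_lt0 invf_gt1 ?exprn_gt0 // expr_lt1 // ltW.
by rewrite nmulr_rge0 // => xn; apply/eqP; rewrite eq_le x0 xn.
Qed.
End Scaling.

(** * The kernel of an admissible matrix *)

Section Kernel.
Variable R : realType.
Local Notation C := R[i].
Variables (N : nat) (lam : 'I_N -> C * C) (K : 'M[C]_N).
Hypotheses (lamD : forall i, bidisk (lam i)) (adm : admissible lam K).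

(** For v in the kernel of K, positivity of K - d^* K d at v leaves (d v)^* K d v <= 0, and K itself
    is positive. *)
Lemma admissible_kernel (v : 'cV[C]_N) : K *m v = 0 ->
  K *m (\col_i ((lam i).1 * v i 0)) = 0 /\ K *m (\col_i ((lam i).2 * v i 0)) = 0.
Proof.
have pK := admissible_psd lamD adm; case: adm => p1 p2 Kv.
have gen (L d : 'M[C]_N) : psd (K - d ^t* *m K *m d) -> K *m (d *m v) = 0.
  move=> p; apply: psd_null => //; apply/eqP; rewrite eq_le; apply/andP; split; last first.
    by case: pK.
  have [_ /(_ v)] := p; rewrite mulmxBr mulmxBl -(mulmxA (v ^t*) K) Kv mulmx0.
  rewrite (mulmxA (v ^t*)) -(mulmxA _ d) (mulmxA (v ^t*)) -adjmxM.
  by rewrite sub0r mxE oppr_ge0 !mulmxA.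
split.
  have -> : \col_i ((lam i).1 * v i 0) = diag_mx (\row_i (lam i).1) *m v.
    by rewrite mul_diag_mx; apply/colP => i; rewrite !mxE.
  by apply: (gen 0); rewrite -schur_Lambda1.
have -> : \col_i ((lam i).2 * v i 0) = diag_mx (\row_i (lam i).2) *m v.
  by rewrite mul_diag_mx; apply/colP => i; rewrite !mxE.
by apply: (gen 0); rewrite -schur_Lambda2.
Qed.

(* The kernel of [K] is invariant under multiplication by the coordinates; a
   vector without zero entries in it generates everything by Lagrange
   interpolation. *)
Lemma admissible_cyclic (v : 'cV[C]_N) : injective lam -> (forall i, v i 0 != 0) ->
  K *m v = 0 -> K = 0.
Proof.
move=> inj v0 Kv.
pose f i l : C := if (lam i).1 != (lam l).1 then (lam i).1 else (lam i).2.
(* The Lagrange factor that vanishes at node l and not at node i, formed with a coordinate in which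
   these two nodes differ. *)
pose g (i l j : 'I_N) : C :=
  if (lam i).1 != (lam l).1 then (lam j).1 - (lam l).1 else (lam j).2 - (lam l).2.
have Kg i (s : seq 'I_N) : K *m (\col_j ((\prod_(l <- s) g i l j) * v j 0)) = 0.
  elim: s => [|l s IH].
    by rewrite -[RHS]Kv; congr (_ *m _); apply/colP => j; rewrite mxE big_nil mul1r.
  set u := \col_j _ in IH.
  have [h1 h2] := admissible_kernel IH.
  case/boolP: ((lam i).1 != (lam l).1) => h.
    have -> : \col_j ((\prod_(k <- l :: s) g i k j) * v j 0) =
        \col_j ((lam j).1 * u j 0) - (lam l).1 *: u.
      by apply/colP => j; rewrite !mxE big_cons {1}/g h; ring.
    by rewrite mulmxBr h1 -scalemxAr IH scaler0 subr0.
  have -> : \col_j ((\prod_(k <- l :: s) g i k j) * v j 0) =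
      \col_j ((lam j).2 * u j 0) - (lam l).2 *: u.
    by apply/colP => j; rewrite !mxE big_cons {1}/g (negPf h); ring.
  by rewrite mulmxBr h2 -scalemxAr IH scaler0 subr0.
have gi i l : l != i -> g i l i != 0.
  rewrite /g => li; case: ifP; first by rewrite subr_eq0.
  move=> /negbFE /eqP e1; rewrite subr_eq0; apply: contra_neq li => e2.
  by apply: inj; rewrite [lam l]surjective_pairing -e1 -e2 -surjective_pairing.
have gl i l : g i l l = 0 by rewrite /g; case: ifP; rewrite subrr.
apply/matrixP => k i; rewrite mxE.
have := Kg i [seq l <- index_enum 'I_N | l != i]; set u := \col_j _.
have -> : u = u i 0 *: delta_mx i 0.
  apply/colP => j; rewrite [RHS]mxE [delta_mx _ _ _ _]mxE andbT.
  case: eqP => [->|/eqP ji]; first by rewrite mulr1.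
  rewrite mulr0 mxE; apply/eqP; rewrite mulf_eq0; apply/orP; left.
  by rewrite big_filter (bigD1 j) //= gl mul0r.
rewrite -scalemxAr -colE => /colP/(_ k); rewrite [LHS]mxE [col _ _ _ _]mxE [RHS]mxE => /eqP.
rewrite mulf_eq0 => /orP[|/eqP//].
rewrite mxE mulf_eq0 (negPf (v0 i)) orbF prodf_seq_eq0 => /hasP[l].
by rewrite mem_filter => /andP[li _] /=; rewrite (negPf (gi _ _ li)).
Qed.
End Kernel.

(** * Active functionals of an extremal problem *)

Section Extremal.
Variable R : realType.
Local Notation C := R[i].

Lemma psd_sub m N (f : 'I_m -> 'I_N) (A : 'M[C]_N) : psd A -> psd (mxsub f f A).
Proof.
move=> /psd_factor[X ->]; rewrite (_ : mxsub _ _ _ = (colsub f X) ^t* *m colsub f X).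
  exact: psd_gram.
by apply/matrixP => i j; rewrite !mxE; apply: eq_bigr => k _; rewrite !mxE.
Qed.

(** A dual certificate of extremality. The nonzero pairing with the all-ones matrix excludes
    solutions of norm less than 1 ([pairing_strict]), and the nonzero rows say that every node takes
    part. *)
Definition active N (lam : 'I_N -> C * C) (w : 'I_N -> C) (K : 'M[C]_N) : Prop :=
  [/\ admissible lam K, pairing K (Wmx w) = 0, pairing K (const_mx 1) != 0 &
      forall k, exists j, K k j != 0].

Variables (n : nat) (lam : 'I_n.+1 -> C * C) (w : 'I_n.+1 -> C) (phi : C * C -> C).
Hypotheses (lamD : forall i, bidisk (lam i)) (ext : extremal_solution lam w phi).
Hypothesis ext2 : forall k, ~ extremal_solution (fun i => lam (lift k i))
  (fun i => w (lift k i)) phi.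

(** The function [phi] solves the problem with one node fewer and has norm 1, so it can fail to be
    extremal there only because a solution of smaller norm exists. *)
Lemma omit_point_strict k : exists psi, Pick_solution (fun i => lam (lift k i))
  (fun i => w (lift k i)) psi /\ Hinfty_norm psi < 1.
Proof.
case: ext => -[hphi hw le1] n1 _; apply: contrapT => h; apply: (ext2 (k := k)).
by split=> //; rewrite n1.
Qed.

Lemma extremal_norm psi : Pick_solution lam w psi -> ~ Hinfty_norm psi < 1.
Proof. by case: ext => _ -> h sol lt; apply: h; exists psi. Qed.

(** If two nodes coincide, omitting one of them loses no condition, and the strict solution of the
    reduced problem would contradict extremality. *)
Lemma extremal_distinct : injective lam.
Proof.
move=> k l e; apply/eqP; apply: contraT => kl.
have [psi [[hpsi hw le1] lt1]] := omit_point_strict k.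
case: (unliftP k l) kl hw => [l' lE kl hw|->]; last by rewrite eqxx.
case: ext => -[_ phiw _] _ _; exfalso; apply: (@extremal_norm psi) => //; split=> // i.
case: (unliftP k i) => [j ->|->]; first exact: hw.
by rewrite e lE hw -lE -phiw -e phiw.
Qed.

(** The entries of W - e J, J all ones, are r^2 - conj w_i w_j with r^2 = 1 - e. In the cone they
    would give a permissible pair for the data w / r, hence a solution for w of norm at most r <
    1. *)
Lemma extremal_boundary (e : R) : 0 < e ->
  ~ cone lam (Wmx w - e%:C%C *: const_mx 1).
Proof.
move=> e0 [G [D [pG pD WE]]].
have Wii i : `|w i| ^+ 2 <= (1 - e)%:C%C.
  have : 0 <= (Wmx w - e%:C%C *: const_mx 1) i i.
    rewrite WE !mxE addr_ge0 // mulr_ge0 ?psd_diag_ge0 //.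
      by rewrite -normCKC subr_ge0 exprn_ile1 // ltW //; case: (lamD i).
    by rewrite -normCKC subr_ge0 exprn_ile1 // ltW //; case: (lamD i).
  by rewrite !mxE -normCKC mulr1 addrAC subr_ge0 rmorphB rmorph1.
have e1 : 0 <= 1 - e by rewrite -ler0c; apply: le_trans (Wii ord0); rewrite exprn_ge0.
pose r := Num.sqrt (1 - e).
have r2 : r ^+ 2 = 1 - e by rewrite sqr_sqrtr.
have r0 : 0 <= r by exact: sqrtr_ge0.
have r1 : r < 1 by rewrite -(ltr_pXn2r (n := 2)) ?nnegrE // r2 expr1n; lra.
suff [psi [hpsi psiw psi1]] : exists psi, [/\ Hinfty psi,
    forall i, r%:C%C * psi (lam i) = w i & Hinfty_norm psi <= 1].
  have mr : modulus (r%:C%C : C) = r by rewrite modulus_real ger0_norm.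
  have [|] := @scale_solution _ _ lam (fun i => psi (lam i)) psi r%:C%C _ hpsi (fun i => erefl).
    by rewrite mr; apply: mulr_ile1 => //; [|exact: ltW];
      apply: le_trans (Hinfty_norm_ub hpsi (_ : bidisk (0, 0)));
      [exact: modulus_ge0|split; rewrite /= normr0].
  rewrite mr => sol le; apply: (@extremal_norm (fun z => r%:C%C * psi z)).
    by case: sol => h1 h2 h3; split=> // i; rewrite psiw.
  apply: le_lt_trans le _; apply: le_lt_trans r1.
  by rewrite -{2}[r]mulr1 ler_wpM2l.
(* For r = 0 all w_i vanish, division by r is impossible, and the zero function serves. *)
have [rz|rn0] := eqVneq r 0.
  exists (fun=> 0); split.
  - by split; [move=> z _; exact: diff_cst|exists 0 => z _; rewrite modulus0].
  - move=> i; rewrite rz mul0r; apply/esym/eqP; rewrite -normr_eq0 -sqrf_eq0 eq_le.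
    by rewrite exprn_ge0 // andbT (le_trans (Wii i)) // -r2 rz expr0n.
  - by apply: Hinfty_norm_le => z _; rewrite modulus0.
have rC : (r%:C%C : C) != 0 by rewrite -(rmorph0 (real_complex R)) (inj_eq (@complexI R)).
have rCr : ((r%:C%C)^* : C) = r%:C%C by rewrite conj_realC.
have : cone lam (Wmx (fun i => w i / r%:C%C)).
  have -> : Wmx (fun i => w i / r%:C%C) = (r%:C%C ^- 2) *: (Wmx w - e%:C%C *: const_mx 1).
    apply/matrixP => i j; rewrite !mxE rmorphM fmorphV /= rCr mulr1.
    have -> : 1 - (w i)^* * w j - e%:C%C = r%:C%C ^+ 2 - (w i)^* * w j.
      by rewrite -rmorphXn /= r2 rmorphB rmorph1; ring.
    by field.
  apply: coneZ; last by exists G, D.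
  by rewrite invr_ge0 exprn_ge0 // ler0c.
case=> G' [D' [pG' pD' WE']].
have [psi [hpsi psiw psi1]] :=
  @realization _ _ lam (fun i => w i / r%:C%C) G' D' lamD (And3 pG' pD' WE').
by exists psi; split=> // i; rewrite psiw mulrC mulfVK.
Qed.

(** A zero pairing with the all-ones matrix would put the vector of ones into the kernel of K and
    force K = 0. If row k vanished, K would be a functional for the problem without node k, whose
    strict solution forces that same pairing to be zero. *)
Lemma extremal_active : exists K, active lam w K.
Proof.
have [K [adm trK KW]] := active_functional lamD (Wmx_herm w) extremal_boundary.
have pK := admissible_psd lamD adm.
have K0 : K <> 0 by move=> K0; move: trK; rewrite K0 mxtrace0 => /eqP; rewrite eq_sym oner_eq0.
have KW0 : pairing K (Wmx w) = 0.
  case: ext => sol _ _; have h := dual_inequality lamD sol adm.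
  rewrite -/(pairing K (Wmx w)) in h; apply/eqP; rewrite eq_le h andbT.
  rewrite lecE; move: (h); rewrite lecE => /andP[/eqP -> _].
  by rewrite eqxx KW.
have KJ : pairing K (const_mx 1) != 0.
  apply/eqP; rewrite pairing_const => h; apply: K0.
  apply: (admissible_cyclic lamD adm extremal_distinct (v := const_mx 1)).
    by move=> i; rewrite mxE oner_neq0.
  exact: psd_null.
exists K; split=> // k; apply: contrapT => h.
have Kk j : K k j = 0 by apply/eqP; apply: contraT => kj; exfalso; apply: h; exists j.
have Kk' j : K j k = 0 by rewrite (psd_sym j k pK) Kk rmorph0.
have [psi [sol lt1]] := omit_point_strict k.
pose K' := mxsub (lift k) (lift k) K.
have pairK' H : pairing K H = pairing K' (mxsub (lift k) (lift k) H).
  rewrite /pairing (bigD1_ord k) //= big1 ?add0r; last by move=> j _; rewrite Kk mul0r.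
  apply: eq_bigr => i _; rewrite (bigD1_ord k) //= Kk' mul0r add0r.
  by apply: eq_bigr => j _; rewrite !mxE.
have adm' : admissible (fun i => lam (lift k i)) K'.
  case: adm => p1 p2; split.
    rewrite (_ : schur _ _ = mxsub (lift k) (lift k) (schur K (Lambda1 lam))).
      exact: psd_sub.
    by apply/matrixP => i j; rewrite !mxE.
  rewrite (_ : schur _ _ = mxsub (lift k) (lift k) (schur K (Lambda2 lam))).
    exact: psd_sub.
  by apply/matrixP => i j; rewrite !mxE.
have := pairing_strict (fun i => lamD (lift k i)) sol lt1 adm'.
have -> : Wmx (fun i => w (lift k i)) = mxsub (lift k) (lift k) (Wmx w).
  by apply/matrixP => i j; rewrite !mxE.
rewrite -pairK' => /(_ KW0).
have -> : const_mx 1 = mxsub (lift k) (lift k) (const_mx 1 : 'M[C]_n.+1).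
  by apply/matrixP => i j; rewrite !mxE.
by rewrite -pairK' => /eqP; rewrite (negPf KJ).
Qed.
End Extremal.

(** * Symmetry between the two coordinates *)

Section Swap.
Variable R : realType.
Local Notation C := R[i].
Variables (N : nat).
Implicit Types (lam : 'I_N -> C * C) (w : 'I_N -> C) (K G D : 'M[C]_N).

Definition swap lam : 'I_N -> C * C := fun i => ((lam i).2, (lam i).1).

Lemma swap_bidisk lam : (forall i, bidisk (lam i)) -> forall i, bidisk (swap lam i).
Proof. by move=> h i; have [] := h i. Qed.

Lemma active_swap lam w K : active lam w K -> active (swap lam) w K.
Proof. by case=> -[p1 p2] h1 h2 h3; exact: And4 (conj p2 p1) h1 h2 h3. Qed.

Lemma permissible_swap lam w G D : permissible lam w G D -> permissible (swap lam) w D G.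
Proof. by case=> pG pD WE; apply: And3 pD pG _; rewrite WE addrC. Qed.

Lemma degenerate_swap lam w : degenerate (swap lam) w -> degenerate lam w.
Proof.
case=> G [D [[pG pD WE] GD0]]; exists D, G; split; last by case: GD0; [right|left].
by apply: And3 pD pG _; rewrite WE addrC.
Qed.
End Swap.

(** * Ranks for a non-degenerate three point problem *)

Section ThreePoints.
Variable R : realType.
Local Notation C := R[i].
Variables (lam : 'I_3 -> C * C) (w : 'I_3 -> C) (K : 'M[C]_3).
Hypotheses (lamD : forall i, bidisk (lam i)) (act : active lam w K).
Hypothesis nondeg : ~ degenerate lam w.
Local Notation L1 := (Lambda1 lam).
Local Notation L2 := (Lambda2 lam).
Local Notation W := (Wmx w).

Lemma Lambda1_neq0 i j : L1 i j != 0.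
Proof.
rewrite mxE; have [? _] := lamD i; have [? _] := lamD j.
exact: one_sub_conj_neq0.
Qed.

Lemma Lambda2_neq0 i j : L2 i j != 0.
Proof.
rewrite mxE; have [_ ?] := lamD i; have [_ ?] := lamD j.
exact: one_sub_conj_neq0.
Qed.

Lemma Lambda1_gt0 i : 0 < L1 i i.
Proof.
by rewrite mxE -normCKC subr_gt0 exprn_ilt1 //; case: (lamD i).
Qed.

Lemma Lambda2_gt0 i : 0 < L2 i i.
Proof.
by rewrite mxE -normCKC subr_gt0 exprn_ilt1 //; case: (lamD i).
Qed.

Lemma permissible_diag G D i : permissible lam w G D -> 0 <= W i i.
Proof.
case=> pG pD ->; have h1 := psd_diag_ge0 i pG; have h2 := psd_diag_ge0 i pD.
have := mulr_ge0 (ltW (Lambda1_gt0 i)) h1; have := mulr_ge0 (ltW (Lambda2_gt0 i)) h2.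
move: {pG pD} h1 h2 => _ _ h2 h1; rewrite mxE [schur _ _ _ _]mxE [X in _ + X]mxE.
exact: addr_ge0.
Qed.

(** The zero pairing of K with W is the sum of the pairings of K . Lambda1 with G and of K . Lambda2
    with D, both nonnegative. *)
Lemma permissible_pairing G D : permissible lam w G D -> pairing (schur K L1) G = 0.
Proof.
case: act => -[p1 p2] KW _ _ [pG pD WE].
move: KW; rewrite WE pairingD !pairing_schur => /eqP.
rewrite paddr_eq0; [by move=> /andP[/eqP]| |]; exact: pairing_psd_ge0.
Qed.

(** The vanishing pairing with A^* A is a sum of nonnegative values of the form at the rows of A, so
    each row is a null vector. In dimension 3 a rank above 1 then leaves rank at most 1 for A. *)
Lemma permissible_kernel G D m (A : 'M[C]_(m, 3)) : permissible lam w G D ->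
  G = A ^t* *m A -> schur K L1 *m A^T = 0.
Proof.
move=> perm GE; have := permissible_pairing perm; rewrite GE pairing_gram => /eqP.
have p1 : psd (schur K L1) by case: act => -[].
rewrite psumr_eq0; last by move=> k _; case: p1.
move=> /allP h; apply/matrixP => i k; rewrite [RHS]mxE.
have := h k (mem_index_enum _) => /eqP /(psd_null p1) /colP/(_ i).
by rewrite [RHS]mxE mxE => e; rewrite mxE -[RHS]e; apply: eq_bigr => j _; rewrite !mxE.
Qed.

(* If [K . L1 = u^* u] with no zero entry of [u] then [L2 / L1] is positive, so
   that [W / L1 = G + (L2 / L1) . D] would be a permissible choice. *)
Lemma active_rank G D : permissible lam w G D -> (1 < \rank (schur K L1))%N.
Proof.
move=> [pG pD WE]; rewrite ltnNge; apply/negP => rk.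
have [p1 p2] : admissible lam K by case: act.
have [u uE] := psd_rank1 p1 rk.
have KE i j : K i j * L1 i j = (u 0 i)^* * u 0 j.
  have /matrixP/(_ i j) := uE; rewrite mxE => ->.
  by rewrite mxE big_ord1 adjmxE.
have u0 i : u 0 i != 0.
  apply/eqP => ui; case: act => _ _ _ /(_ i)[j /negP]; apply.
  have := KE i j; rewrite ui rmorph0 mul0r => /eqP.
  by rewrite mulf_eq0 (negPf (Lambda1_neq0 i j)) orbF.
have pQ : psd (\matrix_(i, j) (L2 i j / L1 i j)).
  rewrite (_ : (\matrix_(i, j) _) = (diag_mx (\row_i (u 0 i)^-1)) ^t* *m schur K L2 *m
    diag_mx (\row_i (u 0 i)^-1)); first exact: psd_congr.
  apply/matrixP => i j; rewrite mul_mx_diag [RHS]mxE [X in _ = X * _]mxE (bigD1 i) //=.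
  rewrite big1 ?addr0; last first.
    by move=> k ki; rewrite adjmxE mxE (negPf ki) mulr0n rmorph0 mul0r.
  rewrite adjmxE [diag_mx _ _ _]mxE eqxx mulr1n ![(\row_i _) _ _]mxE [LHS]mxE.
  rewrite [schur _ _ _ _]mxE fmorphV /=.
  have -> : K i j = (u 0 i)^* * u 0 j / L1 i j by rewrite -KE mulfK // Lambda1_neq0.
  have uc : (u 0 i)^* != 0 by rewrite fmorph_eq0.
  move: (Lambda1_neq0 i j) (u0 j) uc; move: (L1 i j) (L2 i j) (u 0 j) (u 0 i)^* => x y z t *.
  field; by apply/and3P.
apply: nondeg; exists (G + schur (\matrix_(i, j) (L2 i j / L1 i j)) D), 0.
split; last by right.
apply: And3 (psdD pG (psd_schur pQ pD)) (psd0 _ _) _.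
rewrite schur0r addr0 schurDr WE; congr (_ + _).
apply/matrixP => i j; rewrite ![schur _ _ _ _]mxE [(\matrix_(i, j) (L2 i j / L1 i j)) _ _]mxE.
by rewrite mulrA mulrCA mulfV ?Lambda1_neq0 // mulr1.
Qed.

Lemma permissible_rank_le1 G D : permissible lam w G D -> (\rank G <= 1)%N.
Proof.
move=> perm; have [/psd_factor[A GE] _ _] := perm.
have := mulmx0_rank_max (permissible_kernel perm GE); rewrite mxrank_tr.
have := active_rank perm; have : (\rank G <= \rank A)%N by rewrite GE mxrankM_maxr.
by lia.
Qed.

Lemma permissible_neq0 G D : permissible lam w G D -> G <> 0 /\ D <> 0.
Proof.
by move=> perm; split=> e; apply: nondeg; exists G, D; apply: (conj perm); [left|right].
Qed.

(** Such a W would have a permissible pair with first member 0. The scalar c is nonnegative because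
    the diagonals of W and of the Schur product are. *)
Lemma Wmx_Lambda2 (N0 : 'M[C]_3) (c : C) G D : permissible lam w G D -> psd N0 ->
  N0 <> 0 -> W = c *: schur L2 N0 -> False.
Proof.
move=> perm pN N0n WE.
have [i /eqP Ni] : exists i, N0 i i <> 0.
  by apply/existsNP => h; apply: N0n; exact: psd_eq0.
have pos : 0 < L2 i i * N0 i i.
  by rewrite mulr_gt0 ?Lambda2_gt0 // lt_def Ni psd_diag_ge0.
have c0 : 0 <= c.
  have := permissible_diag i perm; rewrite WE mxE [schur _ _ _ _]mxE.
  by rewrite pmulr_lge0.
apply: nondeg; exists 0, (c *: N0); split; last by left.
by apply: And3 (psd0 _ _) (psdZ c0 pN) _; rewrite schur0r add0r schurZr.
Qed.
End ThreePoints.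

(** * Uniqueness of the permissible pair *)

Section ThreePointsUnique.
Variable R : realType.
Local Notation C := R[i].
Variables (lam : 'I_3 -> C * C) (w : 'I_3 -> C) (K : 'M[C]_3).
Hypotheses (lamD : forall i, bidisk (lam i)) (act : active lam w K).
Hypothesis nondeg : ~ degenerate lam w.
Local Notation L1 := (Lambda1 lam).
Local Notation L2 := (Lambda2 lam).
Local Notation W := (Wmx w).

Lemma permissible_ranks G D : permissible lam w G D -> \rank G = 1%N /\ \rank D = 1%N.
Proof.
move=> perm; have [G0 D0] := permissible_neq0 nondeg perm.
have rG := permissible_rank_le1 lamD act nondeg perm.
have rD : (\rank D <= 1)%N.
  apply: (permissible_rank_le1 (swap_bidisk lamD) (active_swap act) _ (permissible_swap perm)).
  by move/degenerate_swap.
by split; apply/eqP; rewrite eqn_leq ?rG ?rD lt0n mxrank_eq0; apply/eqP.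
Qed.

Lemma permissible_average G D G' D' : permissible lam w G D -> permissible lam w G' D' ->
  permissible lam w (2^-1 *: G + 2^-1 *: G') (2^-1 *: D + 2^-1 *: D').
Proof.
have h2 : (0 : C) <= 2^-1 by rewrite invr_ge0.
move=> [pG pD WE] [pG' pD' WE'].
apply: And3 (psdD (psdZ h2 pG) (psdZ h2 pG')) (psdD (psdZ h2 pD) (psdZ h2 pD')) _.
rewrite !schurDr !schurZr addrACA -!scalerDr -WE -WE'.
by apply/matrixP => i j; rewrite !mxE; field.
Qed.

(** The average of two pairs again has rank one members, so G and G' are multiples of one matrix,
    and D and D' of another. If the coefficients of G and G' differ, eliminating their common matrix
    makes W a multiple of Lambda2 . N0, which is degenerate. *)
Lemma permissible_unique G D G' D' : permissible lam w G D -> permissible lam w G' D' ->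
  G' = G /\ D' = D.
Proof.
move=> perm perm'; have avg := permissible_average perm perm'.
have [pG pD WE] := perm; have [pG' pD' WE'] := perm'.
have h2 : (0 : C) <= 2^-1 by rewrite invr_ge0.
have h2n : (2^-1 : C) != 0 by rewrite invr_neq0.
have [pM pN _] := avg; have [rM rN] := permissible_ranks avg.
have [G0 D0] := permissible_neq0 nondeg perm.
have [g gE] := psd_rank1 pM (eq_leq rM); have [d dE] := psd_rank1 pN (eq_leq rN).
have line (X Y : 'M[C]_3) (h : 'rV[C]_3) : psd X -> psd Y ->
    2^-1 *: X + 2^-1 *: Y = h ^t* *m h -> exists t, X = t *: (h ^t* *m h).
  move=> pX pY e.
  have [t _ tE] := psd_le_rank1 (psdZ h2 pX) (psdZ h2 pY) e.
  by exists (2 * t); rewrite -scalerA -tE scalerA mulfV ?scale1r.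
have [a aE] := line _ _ _ pG pG' gE.
have [a' aE'] : exists t, G' = t *: (g ^t* *m g).
  by apply: (line G' G _ pG' pG); rewrite addrC.
have [b bE] := line _ _ _ pD pD' dE.
have [b' bE'] : exists t, D' = t *: (d ^t* *m d).
  by apply: (line D' D _ pD' pD); rewrite addrC.
set M0 := g ^t* *m g in aE aE'; set N0 := d ^t* *m d in bE bE'.
have N0n : N0 <> 0 by move=> e; apply: D0; rewrite bE e scaler0.
have [aa|aa] := eqVneq a a'.
  split; first by rewrite aE aE' aa.
  rewrite bE bE'; congr (_ *: _); apply/eqP; apply: contraT => bb; exfalso; apply: N0n.
  apply/matrixP => i j; rewrite [RHS]mxE; apply/eqP.
  have : W i j = W i j by [].
  rewrite {1}WE WE' aE aE' bE bE' aa mxE [in RHS]mxE => /addrI.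
  rewrite !schurZr mxE [RHS]mxE => /eqP; rewrite -subr_eq0 -mulrBl mulf_eq0 subr_eq0.
  by rewrite eq_sym (negPf bb) /= mxE mulf_eq0 (negPf (Lambda2_neq0 lamD i j)).
(* With M0 and N0 standing for their Schur products with Lambda1 and Lambda2, W = a M0 + b N0 = a'
   M0 + b' N0 gives (a - a') W = (a b' - a' b) N0. *)
exfalso; apply: (Wmx_Lambda2 lamD nondeg perm (psd_gram d) N0n (c := (a * b' - a' * b) / (a - a'))).
have aan : a - a' != 0 by rewrite subr_eq0.
apply: (scalerI aan); rewrite scalerA mulrC divfK //.
rewrite [LHS]scalerBl {1}WE' {1}WE aE aE' bE bE' !schurZr.
by apply/matrixP => i j; rewrite !mxE; ring.
Qed.
End ThreePointsUnique.

(** * Linear algebra on three indices *)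

Section ThreeIndices.
Variable R : realType.
Local Notation C := R[i].

Lemma ord3_third (p q : 'I_3) : p != q -> exists r : 'I_3,
  (forall j, [\/ j = p, j = q | j = r]) /\
  forall F : 'I_3 -> C, \sum_j F j = F p + F q + F r.
Proof.
move=> pq; have : #|~: [set p; q]| == 1%N.
  by have := cardsC [set p; q]; rewrite cards2 pq card_ord; lia.
case/cards1P => r rE.
have h j : (j != p) && (j != q) = (j == r).
  by have /setP/(_ j) := rE; rewrite !inE negb_or.
exists r; split.
  move=> j; have := h j; case: eqP => [->|_]; first by constructor 1.
  by case: eqP => [->|_]; [constructor 2|move=> /esym/eqP ->; constructor 3].
move=> F; rewrite (bigD1 p) //= (bigD1 q) 1?eq_sym //= -addrA; congr (_ + (_ + _)).
by rewrite (eq_bigl _ _ h) big_pred1_eq.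
Qed.

(* The roots of [T + S z + T^* z^2] come in pairs [z, 1 / z^*]. *)
Lemma self_inversive (S T z z' : C) : `|z| < 1 -> `|z'| < 1 -> z != z' ->
  T + S * z + T^* * z ^+ 2 = 0 -> T + S * z' + T^* * z' ^+ 2 = 0 -> T = 0 /\ S = 0.
Proof.
move=> z1 z1' zz e e'.
have SE : S = - (T^* * (z + z')).
  have : (z - z') * (S + T^* * (z + z')) = 0.
    by rewrite -[RHS](subrr 0) -{1}e -e'; ring.
  by move/eqP; rewrite mulf_eq0 subr_eq0 (negPf zz) /= addr_eq0 => /eqP.
have TE : T = T^* * (z * z') by apply/eqP; rewrite -subr_eq0 -e SE; apply/eqP; ring.
have T0 : T = 0.
  apply/eqP; rewrite -normr_eq0; apply: contraT => Tn.
  have := congr1 Num.norm TE; rewrite !normrM norm_conjC -{1}[`|T|]mulr1 => /(mulfI Tn) h.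
  by have := mulr_ilt1 (normr_ge0 z) (normr_ge0 z') z1 z1'; rewrite -h ltxx.
by split=> //; rewrite SE T0 rmorph0 mul0r oppr0.
Qed.

(** The rows annihilating a nonzero vector v of dimension 3 form a plane, and 1 and w span it
    because w is not constant. *)
Lemma pick_combination (w v y : 'I_3 -> C) (p q : 'I_3) : w p != w q ->
  \sum_j v j = 0 -> \sum_j w j * v j = 0 -> (exists j, v j != 0) ->
  \sum_j y j * v j = 0 -> exists s t, forall j, y j = s + t * w j.
Proof.
move=> wpq v0 wv0 vn yv0.
have pq : p != q by apply: contra_neq wpq => ->.
have [r [pqr sumE]] := ord3_third pq.
have wn : w p - w q != 0 by rewrite subr_eq0.
have vr : v r != 0.
  apply: contraT => /negbNE/eqP vr; move: v0 wv0; rewrite !sumE vr mulr0 !addr0.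
  move=> /eqP; rewrite addr_eq0 => /eqP vp; rewrite vp => e.
  have vq : v q = 0.
    have : (w p - w q) * v q = 0 by rewrite -oppr0 -e; ring.
    by move/eqP; rewrite mulf_eq0 (negPf wn) => /eqP.
  case: vn => j /negP[]; case: (pqr j) => ->; rewrite ?vr ?vp ?vq ?oppr0 //.
pose t := (y p - y q) / (w p - w q); pose s := y p - t * w p.
have ep : y p = s + t * w p by rewrite /s; ring.
have eq : y q = s + t * w q by rewrite /s /t; field.
exists s, t => j; case: (pqr j) => -> //.
apply: (mulIf vr); apply/eqP; rewrite -subr_eq0; apply/eqP.
transitivity (\sum_j y j * v j - (s * \sum_j v j + t * \sum_j w j * v j)).
  by rewrite !sumE ep eq; ring.
by rewrite yv0 v0 wv0; ring.
Qed.

Lemma colligation_exists N (lam : 'I_N -> C * C) w (a b : 'rV[C]_N) :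
  permissible lam w (a ^t* *m a) (b ^t* *m b) -> exists U, colligation lam w a b U.
Proof.
case=> _ _ /(@colligation_gram _ _ 1 1 lam w a b) /unitary_extension[U Uu UE].
exists U; split=> //; rewrite -UE; congr (U *m col_mx _ (col_mx _ _)).
  by apply/rowP => j; rewrite !mxE.
by apply/rowP => j; rewrite !mxE.
Qed.
End ThreeIndices.

(** * Independence of the three input vectors and the value of every solution *)

Section ActiveRows.
Variable R : realType.
Local Notation C := R[i].
Variables (lam : 'I_3 -> C * C) (w : 'I_3 -> C) (K G D : 'M[C]_3).
Hypotheses (act : active lam w K)
  (perm : permissible lam w G D).
Local Notation L1 := (Lambda1 lam).

Lemma active_row1 i : \sum_j K i j * (schur L1 G) i j = 0.
Proof.
have [/psd_factor[A GE] _ _] := perm.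
have := permissible_kernel act perm GE => e.
transitivity (\sum_k (A k i)^* * (schur K L1 *m A^T) i k); last first.
  by apply: big1 => k _; rewrite e mxE mulr0.
under [RHS]eq_bigr do rewrite mxE mulr_sumr.
rewrite exchange_big /=; apply: eq_bigr => j _.
rewrite GE !mxE mulrA mulr_sumr; apply: eq_bigr => k _; rewrite !mxE; ring.
Qed.
End ActiveRows.

Section Independence.
Variable R : realType.
Local Notation C := R[i].
Variables (lam : 'I_3 -> C * C) (w : 'I_3 -> C) (K G D : 'M[C]_3).
Hypotheses (lamD : forall i, bidisk (lam i)) (inj : injective lam) (act : active lam w K).
Hypothesis nondeg : ~ degenerate lam w.
Hypothesis perm : permissible lam w G D.
Local Notation L1 := (Lambda1 lam).
Local Notation L2 := (Lambda2 lam).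
Local Notation W := (Wmx w).
Local Notation F i := (\sum_j K i j).
Local Notation H i := (\sum_j K i j * w j).

(** The rows of K . Lambda1 . G and of K . Lambda2 . D sum to zero, hence so do those of K . W. *)
Lemma active_row i : F i = (w i)^* * H i.
Proof.
have h1 := active_row1 act perm i.
have h2 : \sum_j K i j * (schur L2 D) i j = 0 :=
  active_row1 (active_swap act) (permissible_swap perm) i.
have [_ _ WE] := perm.
have : \sum_j K i j * W i j = 0.
  rewrite WE; transitivity (\sum_j K i j * (schur L1 G) i j + \sum_j K i j * (schur L2 D) i j).
    rewrite -big_split; apply: eq_bigr => j _.
    by rewrite mxE mulrDr.
  by rewrite h1 h2 addr0.
move/eqP; rewrite (_ : \sum_j _ = F i - (w i)^* * H i) ?subr_eq0 => [/eqP //|].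
by rewrite mulr_sumr -sumrB; apply: eq_bigr => j _; rewrite mxE; ring.
Qed.

Lemma active_F_neq0 : exists i, F i != 0.
Proof.
apply: contrapT => h; case: act => _ _ /negP KJ _; apply: KJ; rewrite /pairing big1 // => i _.
under eq_bigr do rewrite mxE mulr1.
by apply/eqP; apply: contraT => Fi; exfalso; apply: h; exists i.
Qed.

Lemma Wmx_eq0 : W <> 0.
Proof.
move=> W0; apply: nondeg; exists 0, 0; split; last by left.
by apply: And3 (psd0 _ _) (psd0 _ _) _; rewrite W0 !schur0r addr0.
Qed.

(** For constant w the row relation reads F = |w|^2 F. Some F is nonzero, so |w| = 1 and W = 0,
    which is degenerate. *)
Lemma active_nonconstant : exists p q, w p != w q.
Proof.
apply: contrapT => h; have wE j : w j = w 0.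
  by apply/eqP; apply: contraT => e; exfalso; apply: h; exists j, 0.
have [i Fi] := active_F_neq0; apply: Wmx_eq0; apply/matrixP => k l.
have HE : H i = w 0 * F i by rewrite mulr_sumr; apply: eq_bigr => j _; rewrite wE mulrC.
have := active_row i; rewrite HE wE => e.
by rewrite !mxE !wE; apply: (mulIf Fi); rewrite mul0r mulrBl mul1r {1}e mulrA subrr.
Qed.

(** If |w_i| = 1, then W_ii = 0 forces G_ii = D_ii = 0, so row i of W vanishes and every w_j equals
    w_i. *)
Lemma interpolation_lt1 i : `|w i| < 1.
Proof.
have [pG pD WE] := perm.
have W0 := permissible_diag lamD i perm.
suff Wn : W i i != 0.
  have : 0 < W i i by rewrite lt_def Wn.
  by rewrite mxE -normCKC subr_gt0 expr_lt1.
apply/eqP => Wi.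
have g0 := mulr_ge0 (ltW (Lambda1_gt0 lamD i)) (psd_diag_ge0 i pG).
have d0 := mulr_ge0 (ltW (Lambda2_gt0 lamD i)) (psd_diag_ge0 i pD).
have : L1 i i * G i i + L2 i i * D i i = 0.
  by have /matrixP/(_ i i) := WE; rewrite Wi mxE ![schur _ _ _ _]mxE.
move/eqP; rewrite paddr_eq0; [|exact: g0|exact: d0].
rewrite !mulf_eq0 (negPf (Lambda1_neq0 lamD i i)) (negPf (Lambda2_neq0 lamD i i)) /=.
move=> /andP[/eqP Gi /eqP Di].
have Wij j : W i j = 0.
  rewrite WE mxE [schur _ _ _ _]mxE [X in _ + X]mxE.
  by rewrite (psd_diag_eq0 j pG Gi) (psd_diag_eq0 j pD Di) !mulr0 addr0.
have wi0 : (w i)^* != 0.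
  by apply/eqP => e; move: Wi; rewrite mxE e mul0r subr0 => /eqP; rewrite oner_eq0.
have wE j : w j = w i.
  apply: (mulfI wi0); have := Wij j; rewrite -Wi !mxE => /addrI /oppr_inj; exact.
by have [p [q]] := active_nonconstant; rewrite !wE eqxx.
Qed.

(** Otherwise one value w_i serves in the relation F = conj w_i H of every row, and K kills the
    vector with entries 1 - conj w_i w_j. None of these is zero, so K = 0 by cyclicity. *)
Lemma active_two_rows : exists i k, [/\ H i != 0, H k != 0 & w i != w k].
Proof.
have [i Fi] := active_F_neq0.
have Hi : H i != 0 by apply: contra_neq Fi => e; rewrite active_row e mulr0.
apply: contrapT => h.
have FE k : F k = (w i)^* * H k.
  rewrite active_row; have [->|Hk] := eqVneq (H k) 0; first by rewrite !mulr0.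
  have [->//|wik] := eqVneq (w i) (w k).
  by exfalso; apply: h; exists i, k.
case: act => adm _ /negP KJ _; apply: KJ.
suff -> : K = 0 by rewrite /pairing; apply/eqP; do 2![apply: big1 => ? _]; rewrite mxE mul0r.
apply: (admissible_cyclic lamD adm (v := \col_j (1 - (w i)^* * w j)) inj).
  by move=> j; rewrite mxE; apply: one_sub_conj_neq0; exact: interpolation_lt1.
apply/colP => k; rewrite mxE [RHS]mxE.
transitivity (F k - (w i)^* * H k); last by rewrite FE subrr.
by rewrite mulr_sumr -sumrB; apply: eq_bigr => j _; rewrite mxE; ring.
Qed.

(** If a and lam^1 a both lie in the span of 1 and w, then Lambda1 . G is a Hermitian form in 1 and
    w. The kernel relation at two rows with different values of w forces it to be a multiple of W,
    so that W would be a multiple of Lambda1 . G. *)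
Lemma gram_independent (a : 'rV[C]_3) (s t s' t' : C) : G = a ^t* *m a ->
  (forall j, a 0 j = s + t * w j) -> (forall j, (lam j).1 * a 0 j = s' + t' * w j) -> False.
Proof.
move=> GE aE laE; have ker := permissible_kernel act perm GE.
have row i : s * F i + t * H i = ((lam i).1)^* * (s' * F i + t' * H i).
  have /matrixP/(_ i 0) := ker; rewrite mxE [RHS]mxE => e.
  apply/eqP; rewrite -subr_eq0; apply/eqP; rewrite -[RHS]e.
  rewrite !mulr_sumr -!big_split /= mulr_sumr -sumrB; apply: eq_bigr => j _.
  rewrite ![in RHS]mxE.
  have -> : K i j * (1 - ((lam i).1)^* * (lam j).1) * a 0 j =
    K i j * a 0 j - ((lam i).1)^* * (K i j * ((lam j).1 * a 0 j)) by ring.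
  by rewrite laE aE; ring.
(* Multiplying the kernel relation of row i by conj a_i and inserting F_i = conj w_i H_i gives a
   quadratic equation for conj w_i with coefficients T, S and conj T. *)
pose S := s * s^* + t * t^* - (s' * s'^* + t' * t'^*).
pose T := t * s^* - t' * s'^*.
have TC : T^* = t^* * s - t'^* * s' by rewrite rmorphB !rmorphM /= !conjCK.
have key i : H i != 0 -> T + S * (w i)^* + T^* * (w i)^* ^+ 2 = 0.
  move=> Hi; apply: (mulfI Hi); rewrite mulr0.
  have aC : (a 0 i)^* = s^* + t^* * (w i)^* by rewrite aE rmorphD rmorphM.
  have laC : ((lam i).1)^* * (a 0 i)^* = s'^* + t'^* * (w i)^*.
    by rewrite -rmorphM laE rmorphD rmorphM.
  have := congr1 (fun x => x * (a 0 i)^*) (row i); rewrite active_row.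
  have -> : ((lam i).1)^* * (s' * ((w i)^* * H i) + t' * H i) * (a 0 i)^* =
    (s' * ((w i)^* * H i) + t' * H i) * (((lam i).1)^* * (a 0 i)^*) by ring.
  rewrite laC aC => /eqP; rewrite -subr_eq0 => /eqP e; rewrite -[RHS]e TC /S /T; ring.
have [i [k [Hi Hk wik]]] := active_two_rows.
have wl j : `|(w j)^*| < 1 by rewrite norm_conjC interpolation_lt1.
have [T0 S0] : T = 0 /\ S = 0.
  apply: (self_inversive (wl i) (wl k) _ (key i Hi) (key k Hk)).
  by rewrite (inj_eq (can_inj conjCK)).
have TC0 : t^* * s - t'^* * s' = 0 by rewrite -TC T0 rmorph0.
pose al := s * s^* - s' * s'^*.
have GW : schur L1 G = al *: W.
  apply/matrixP => j l; rewrite GE !mxE big_ord1 !mxE.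
  transitivity ((a 0 j)^* * a 0 l - ((lam j).1 * a 0 j)^* * ((lam l).1 * a 0 l)).
    by rewrite rmorphM /=; ring.
  rewrite !laE !aE !rmorphD !rmorphM /= /al.
  transitivity ((s * s^* - s' * s'^*) + T * w l + (t^* * s - t'^* * s') * (w j)^*
    + (S - (s * s^* - s' * s'^*)) * (w j)^* * w l); first by rewrite /S /T; ring.
  by rewrite T0 TC0 S0; ring.
have [G0 _] := permissible_neq0 nondeg perm.
have [al0|aln] := eqVneq al 0.
  apply: G0; apply/matrixP => j l; have /matrixP/(_ j l) := GW.
  rewrite al0 scale0r mxE [RHS]mxE [X in _ -> _ = X]mxE => /eqP.
  by rewrite mulf_eq0 (negPf (Lambda1_neq0 lamD j l)) => /eqP.
have [pG _ _] := perm.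
apply: (Wmx_Lambda2 (swap_bidisk lamD) _ (permissible_swap perm) pG G0 (c := al^-1)).
  by move/degenerate_swap.
by rewrite -[LHS]scale1r -(mulVf aln) -scalerA -GW.
Qed.

(** A vector v with X v = 0 also satisfies U X v = 0, so it is annihilated by 1, w, a and lam^1 a.
    If v is nonzero, the last two are combinations of the first two. *)
Lemma colligation_indep (a b : 'rV[C]_3) U : G = a ^t* *m a -> colligation lam w a b U ->
  col_mx (const_mx 1 : 'rV[C]_3)
    (col_mx (\row_j ((lam j).1 * a 0 j)) (\row_j ((lam j).2 * b 0 j))) \in unitmx.
Proof.
move=> GE [Uu UE]; apply: inj_unitmx => v Xv.
have Yv : col_mx (\row_j w j) (col_mx a b) *m v = 0 by rewrite -UE -mulmxA Xv mulmx0.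
move: Xv Yv; rewrite !mul_col_mx => /eqP; rewrite col_mx_eq0 => /andP[/eqP v1].
rewrite col_mx_eq0 => /andP[/eqP vl _] /eqP; rewrite col_mx_eq0 => /andP[/eqP vw].
rewrite col_mx_eq0 => /andP[/eqP va _].
apply: contrapT => v0; have vn : exists j, v j 0 != 0.
  apply: contrapT => h; apply: v0; apply/colP => j; rewrite mxE; apply/eqP.
  by apply: contraT => vj; exfalso; apply: h; exists j.
have [p [q wpq]] := active_nonconstant.
have e1 : \sum_j v j 0 = 0.
  have /matrixP/(_ 0 0) := v1; rewrite mxE [RHS]mxE => e; rewrite -[RHS]e.
  by apply: eq_bigr => j _; rewrite mxE mul1r.
have ew : \sum_j w j * v j 0 = 0.
  have /matrixP/(_ 0 0) := vw; rewrite mxE [RHS]mxE => e; rewrite -[RHS]e.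
  by apply: eq_bigr => j _; rewrite mxE.
have ea : \sum_j a 0 j * v j 0 = 0.
  by have /matrixP/(_ 0 0) := va; rewrite mxE [RHS]mxE.
have el : \sum_j ((lam j).1 * a 0 j) * v j 0 = 0.
  have /matrixP/(_ 0 0) := vl; rewrite mxE [RHS]mxE => e; rewrite -[RHS]e.
  by apply: eq_bigr => j _; rewrite mxE.
have [s [t aE]] := pick_combination wpq e1 ew vn ea.
have [s' [t' laE]] := pick_combination wpq e1 ew vn el.
exact: gram_independent GE aE laE.
Qed.

(** In a factorization A^* A of X, the columns of A other than the last one are multiples of a
    single vector with coefficients proportional to a_i; [al] is the scaled inner product of that
    vector with the last column. *)
Lemma gram_extension n (X : 'M[C]_n.+1) (a : 'rV[C]_n) : psd X -> a <> 0 ->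
  mxsub (lift ord_max) (lift ord_max) X = a ^t* *m a ->
  exists al, forall i, X (lift ord_max i) ord_max = (a 0 i)^* * al.
Proof.
move=> /psd_factor[A ->] a0 XE.
have [k ak] : exists k, a 0 k != 0.
  apply: contrapT => h; apply: a0; apply/rowP => j; rewrite mxE; apply/eqP.
  by apply: contraT => vj; exfalso; apply: h; exists j.
pose A' := colsub (lift ord_max) A.
have AE : A' ^t* *m A' = a ^t* *m a.
  rewrite -XE; apply/matrixP => i j; rewrite !mxE.
  by apply: eq_bigr => l _; rewrite !mxE.
have null i : a 0 k *: col i A' = a 0 i *: col k A'.
  pose v : 'cV[C]_n := a 0 k *: delta_mx i 0 - a 0 i *: delta_mx k 0.
  have av : a *m v = 0.
    rewrite mulmxBr -!scalemxAr -!colE; apply/matrixP => p q; rewrite !mxE !ord1; ring.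
  have : A' *m v = 0.
    by apply: sqnorm_eq0; rewrite adjmxM -mulmxA (mulmxA (A' ^t*)) AE -(mulmxA (a ^t*)) av
      !mulmx0 mxE.
  by rewrite mulmxBr -!scalemxAr -!colE => /eqP; rewrite subr_eq0 => /eqP.
exists (\sum_l (A l (lift ord_max k) / a 0 k)^* * A l ord_max) => i.
rewrite mxE mulr_sumr; apply: eq_bigr => l _; rewrite adjmxE mulrA -rmorphM.
congr (_^* * _); apply: (mulfI ak).
have /colP/(_ l) := null i; rewrite !mxE => ->; field; exact: ak.
Qed.

(* Adjoining the node [z] with the value [psi z] gives a four point problem; its
   permissible pair extends the given one, hence its last column is
   [(a_i^* al, b_i^* be)], and [U] maps [(1, z^1 al, z^2 be)] to
   [(psi z, al, be)]. *)
Lemma solution_transfer (a b : 'rV[C]_3) U psi z : G = a ^t* *m a -> D = b ^t* *m b ->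
  colligation lam w a b U -> Pick_solution lam w psi -> bidisk z -> psi z = transfer U z.
Proof.
move=> GE DE col sol hz; have Xu := colligation_indep GE col.
have [G0 D0] := permissible_neq0 nondeg perm.
have a0 : a <> 0 by move=> e; apply: G0; rewrite GE e mulmx0.
have b0 : b <> 0 by move=> e; apply: D0; rewrite DE e mulmx0.
pose lam4 i := if unlift ord_max i is Some j then lam j else z : C * C.
pose w4 i := psi (lam4 i).
have lam4l i : lam4 (lift ord_max i) = lam i by rewrite /lam4 liftK.
have lam4m : lam4 ord_max = z by rewrite /lam4 unlift_none.
have lam4D i : bidisk (lam4 i) by rewrite /lam4; case: unlift.
have [G4 [D4 [pG4 pD4 WE4]]] : exists G4 D4, permissible lam4 w4 G4 D4.
  by apply: (agler lam4D (phi := psi)); case: sol => h1 _ h3; split.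
have w4l i : w4 (lift ord_max i) = w i by rewrite /w4 lam4l; case: sol.
(* Restricted to the first three nodes, the four point pair is permissible for the original problem,
   so uniqueness identifies it. *)
have [GE4 DE4] : mxsub (lift ord_max) (lift ord_max) G4 = G /\
    mxsub (lift ord_max) (lift ord_max) D4 = D.
  apply: (permissible_unique lamD act nondeg perm).
  apply: And3 (psd_sub _ pG4) (psd_sub _ pD4) _.
  apply/matrixP => i j; have /matrixP/(_ (lift ord_max i) (lift ord_max j)) := WE4.
  by rewrite !mxE !w4l !lam4l.
rewrite GE in GE4; rewrite DE in DE4.
have [al alE] := gram_extension pG4 a0 GE4.
have [be beE] := gram_extension pD4 b0 DE4.
pose p : 'cV[C]_(1 + (1 + 1)) := col_mx 1%:M (col_mx (z.1 * al)%:M (z.2 * be)%:M).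
pose q : 'cV[C]_(1 + (1 + 1)) := col_mx (psi z)%:M (col_mx al%:M be%:M).
case: col => Uu UE.
move: Xu UE; set X := col_mx _ _; set Y := col_mx (\row_j w j) _ => Xu UE.
(* This is the last column of the four point identity. Since U X = Y and X is invertible, it forces
   U p = q. *)
have XY : X ^t* *m p = Y ^t* *m q.
  apply/colP => i; rewrite /X /Y /p /q !adjmx_col !mul_row_col.
  rewrite !mxE !big_ord1 !mxE !eqxx !mulr1n.
  have /matrixP/(_ (lift ord_max i) ord_max) := WE4.
  rewrite !mxE alE beE w4l lam4l lam4m /w4 lam4m => /eqP.
  rewrite -subr_eq0 => /eqP e; apply/eqP; rewrite -subr_eq0 -e; apply/eqP.
  rewrite !rmorphM rmorph1 !ord1 /=; ring.
have Upq : U *m p = q.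
  have Xau : X ^t* \in unitmx by rewrite map_unitmx unitmx_tr.
  have : X ^t* *m p = X ^t* *m (U ^t* *m q) by rewrite mulmxA -adjmxM UE.
  move=> /(congr1 (mulmx (invmx (X ^t*)))); rewrite !mulKmx // => ->.
  by rewrite mulmxA; have /unitarymxP -> := Uu; rewrite mul1mx.
have pE : ((psi z)%:M : 'M[C]_1) 0 0 = psi z by rewrite mxE eqxx.
rewrite -[LHS]pE; apply/esym.
apply: (@transfer_unique R 1 1 U z _ (col_mx al%:M be%:M) (transfer_unit Uu hz)).
by rewrite -[RHS]Upq /p /diag_var mul_block_col !mul0mx add0r addr0 -!scalar_mxM.
Qed.
End Independence.

(** * Explicit determinants of order two and three *)

Section Determinants.
Variable F : comNzRingType.

Lemma det2 (M : 'M[F]_2) : \det M = M 0 0 * M 1 1 - M 0 1 * M 1 0.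
Proof.
rewrite (expand_det_row _ 0) !big_ord_recl big_ord0 /cofactor !det_mx11 !mxE.
have -> : lift 0 0 = 1 :> 'I_2 by apply: val_inj.
have -> : lift 1 0 = 0 :> 'I_2 by apply: val_inj.
rewrite /= expr0 expr1; ring.
Qed.

Lemma adj2 (M : 'M[F]_2) : [/\ \adj M 0 0 = M 1 1, \adj M 0 1 = - M 0 1,
  \adj M 1 0 = - M 1 0 & \adj M 1 1 = M 0 0].
Proof.
rewrite !mxE /cofactor !det_mx11 !mxE.
have -> : lift 0 0 = 1 :> 'I_2 by apply: val_inj.
have -> : lift 1 0 = 0 :> 'I_2 by apply: val_inj.
by rewrite /= !expr0 ?expr1 ?expr2; split; ring.
Qed.

Local Notation o1 := (lift 0 0 : 'I_3).
Local Notation o2 := (lift 0 1 : 'I_3).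

Lemma det3 (M : 'M[F]_3) : \det M =
  M 0 0 * (M o1 o1 * M o2 o2 - M o1 o2 * M o2 o1)
  - M o1 0 * (M 0 o1 * M o2 o2 - M 0 o2 * M o2 o1)
  + M o2 0 * (M 0 o1 * M o1 o2 - M 0 o2 * M o1 o1).
Proof.
rewrite (expand_det_col _ 0) !big_ord_recl big_ord0 /cofactor !det2 !mxE.
have -> : ord0 = 0 :> 'I_3 by [].
have -> : lift 0 (lift ord0 ord0) = o2 by apply: val_inj.
have -> : lift 0 ord0 = o1 by apply: val_inj.
have -> : lift o1 0 = 0 :> 'I_3 by apply: val_inj.
have -> : lift o1 1 = o2 :> 'I_3 by apply: val_inj.
have -> : lift o2 0 = 0 :> 'I_3 by apply: val_inj.
have -> : lift o2 1 = o1 :> 'I_3 by apply: val_inj.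
rewrite /= expr0 expr1 ?sqrrN ?expr1n; ring.
Qed.
End Determinants.

(** * Polynomials of degree at most one in each of two variables *)

Section Bilinear.
Variable R : realType.
Local Notation C := R[i].
Implicit Types (p q d u v : mpoly 2 C) (k : 'I_2).

Definition bilinear (c0 c1 c2 c3 : C) : mpoly 2 C :=
  mpolyC 2 c0 + mpolyC 2 c1 * mpolyX C (mnm1 0) + mpolyC 2 c2 * mpolyX C (mnm1 1)
  + mpolyC 2 c3 * (mpolyX C (mnm1 0) * mpolyX C (mnm1 1)).

Lemma bilinear_eval c0 c1 c2 c3 z :
  poly_eval (bilinear c0 c1 c2 c3) z = c0 + c1 * z.1 + c2 * z.2 + c3 * (z.1 * z.2).
Proof. by rewrite /poly_eval !mevalD !mevalM !mevalC !mevalXU. Qed.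

(* [p] as a polynomial in its [k]-th variable. *)
Definition section_poly k : mpoly 2 C -> {poly {poly C}} :=
  mmap (polyC \o polyC) (fun i => if i == k then 'X else ('X)%:P).

Lemma section_polyM k : {morph section_poly k : p q / p * q}.
Proof. exact: rmorphM. Qed.

Lemma ord2_other (i k k' : 'I_2) : k != k' -> i != k -> i = k'.
Proof. by case: i k k' => [[|[|//]] ?] [[|[|//]] ?] [[|[|//]] ?] // _ _; apply: val_inj. Qed.

Lemma section_coef k (k' : 'I_2) p (m : multinom 2) : k != k' ->
  ((section_poly k p)`_(m k))`_(m k') = mcoeff m p.
Proof.
move=> kk; rewrite {2}[p]mpolyE raddf_sum /= /section_poly /mmap !coef_sum.
apply: eq_bigr => m' _; rewrite mcoeffZ mcoeffX /= /mmap1.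
have -> : \prod_(i < 2) (if i == k then 'X else ('X)%:P : {poly {poly C}}) ^+ m' i =
    'X^(m' k) * ('X^(m' k'))%:P.
  have kk' : (k' == k) = false by rewrite eq_sym (negPf kk).
  rewrite (bigD1 k) //= eqxx (bigD1 k') ?kk' //= big_pred0.
    by rewrite mulr1 polyC_exp.
  move=> i; apply/negbTE; rewrite negb_and !negbK.
  by clear kk'; move: i k k' kk; do 3![case=> [[|[|//]] ?]].
rewrite coefCM coefMC coefXn; have [e|e] := eqVneq m' m.
  by rewrite e eqxx mul1r coefCM coefXn eqxx.
have [ek|_] := eqVneq (m k) (m' k); last by rewrite mul0r mulr0 coef0 mulr0.
have [ek'|nk'] := eqVneq (m k') (m' k').
  exfalso; move/eqP: e; apply; apply/mnmP => i.
  have [->//|ik] := eqVneq i k; by rewrite (ord2_other kk ik).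
by rewrite mul1r coefCM coefXn (negPf nk') !mulr0.
Qed.

Lemma section_neq0 k p : p != 0 -> section_poly k p != 0.
Proof.
move=> p0; have [k' kk] : exists k', k != k' by exists (rev_ord k); case: k => [[|[|]]].
apply: contra_neq p0 => e; apply/mpolyP => m; rewrite -(section_coef p m kk) e.
by rewrite !coef0 mcoeff0.
Qed.

Lemma section_size1 k p (m : multinom 2) :
  (size (section_poly k p) <= 1)%N -> m \in msupp p -> m k = 0%N.
Proof.
move=> sz; have [k' kk] : exists k', k != k' by exists (rev_ord k); case: k {sz} => [[|[|]]].
rewrite mcoeff_msupp -(section_coef p m kk) => /eqP mp.
apply/eqP; rewrite -leqn0 leqNgt; apply/negP => mk; apply: mp.
have -> : (section_poly k p)`_(m k) = 0 by apply: nth_default; exact: leq_trans sz mk.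
by rewrite coef0.
Qed.

Lemma bilinear_section k c0 c1 c2 c3 :
  (size (section_poly k (bilinear c0 c1 c2 c3)) <= 2)%N.
Proof.
rewrite /section_poly /bilinear !mmapD !rmorphM /= !mmapC !mmapX !mmap1U /=.
have h (a b : {poly C}) : (size (b%:P * 'X + a%:P)%R <= 2)%N.
  by rewrite size_MXaddC; case: ifP => // _; rewrite ltnS size_polyC_leq1.
have [->|->] : k = 0 \/ k = 1.
- by case: k => [[|[|//]] ?]; [left|right]; apply: val_inj.
- rewrite (_ : _ + _ = (c1%:P + c3%:P * 'X)%:P * 'X + (c0%:P + c2%:P * 'X)%:P) ?h //=.
  by rewrite !polyCD !polyCM; ring.
rewrite (_ : _ + _ = (c2%:P + c3%:P * 'X)%:P * 'X + (c0%:P + c1%:P * 'X)%:P) ?h //=.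
by rewrite !polyCD !polyCM; ring.
Qed.

(** The two implications say that z and z' agree in the variable other than k, the only one on which
    p depends. *)
Lemma section_eval k p z z' : (size (section_poly k p) <= 1)%N ->
  (k != 0 -> z.1 = z'.1) -> (k != 1 -> z.2 = z'.2) -> poly_eval p z = poly_eval p z'.
Proof.
move=> sz h0 h1; rewrite /poly_eval !mevalE !big_seq; apply: eq_bigr => m mp.
congr (_ * _); apply: eq_bigr => i _.
have mk := section_size1 sz mp.
have [ik|ik] := eqVneq i k; first by rewrite ik mk !expr0.
case: eqP => [i0|/eqP i0]; congr (_ ^+ _); [apply: h0|apply: h1].
  by rewrite -i0 eq_sym.
have i1 : i = 1 by apply: val_inj; move: i0; case: (i) => [[|[|//]] ?].
by rewrite -i1 eq_sym.
Qed.

(** A nonconstant common factor involves some variable k. Both polynomials have degree at most 1 in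
    it, so the cofactors are free of k, which the last premise excludes. *)
Lemma poly_coprimeP p q : p != 0 -> q != 0 ->
  (forall k, (size (section_poly k p) <= 2)%N /\ (size (section_poly k q) <= 2)%N) ->
  (forall k d u v, p = d * u -> q = d * v -> (size (section_poly k u) <= 1)%N ->
     (size (section_poly k v) <= 1)%N -> False) -> poly_coprime p q.
Proof.
move=> p0 q0 sz h d u v pE qE.
have d0 : d != 0 by apply: contra_neq p0 => e; rewrite pE e mul0r.
have u0 : u != 0 by apply: contra_neq p0 => e; rewrite pE e mulr0.
have v0 : v != 0 by apply: contra_neq q0 => e; rewrite qE e mulr0.
suff dk k : (size (section_poly k d) <= 1)%N.
  rewrite /poly_degree; apply/eqP; rewrite -subn1 subn_eq0 mmeasureE.
  apply/bigmax_leqP_seq => m md _; rewrite ltnS leqn0 mdeg_eq0; apply/eqP/mnmP => i.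
  by rewrite mnm0E (section_size1 (dk i)).
rewrite leqNgt; apply/negP => dk; have [sp sq] := sz k.
have szM (x : mpoly 2 C) : x != 0 -> (size (section_poly k (d * x)%R) <= 2)%N ->
    (size (section_poly k x) <= 1)%N.
  move=> x0; rewrite section_polyM size_mul ?section_neq0 //.
  by move: (size (section_poly k d)) dk (size (section_poly k x)) => s ? t; lia.
by apply: (h k d u v pE qE); apply: szM; rewrite -?pE -?qE.
Qed.

Lemma bilinear_degree c0 c1 c2 c3 : (poly_degree (bilinear c0 c1 c2 c3) <= 2)%N /\
  (c3 != 0 -> poly_degree (bilinear c0 c1 c2 c3) = 2%N).
Proof.
have le : (mmeasure mdeg (bilinear c0 c1 c2 c3) <= 3)%N.
  have hC (c : C) : (mmeasure mdeg (mpolyC 2 c) <= 1)%N by rewrite mmeasureC; case: eqP.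
  have hZ (c : C) (m : multinom 2) : (mmeasure mdeg (mpolyC 2 c * mpolyX C m) <= (mdeg m).+1)%N.
    by rewrite mul_mpolyC (leq_trans (mmeasureZ_le _ _ _)) // mmeasureX.
  have hD (x y : mpoly 2 C) : (mmeasure mdeg x <= 3)%N -> (mmeasure mdeg y <= 3)%N ->
      (mmeasure mdeg (x + y)%R <= 3)%N.
    by move=> hx hy; apply: (leq_trans (mmeasureD_le _ _ _)); rewrite geq_max hx.
  rewrite /bilinear -mpolyXD; apply: (hD) => //; first (apply: (hD) => //; first apply: (hD) => //).
  - exact: leq_trans (hC _) _.
  - by apply: leq_trans (hZ _ _) _; rewrite mdeg1.
  - by apply: leq_trans (hZ _ _) _; rewrite mdeg1.
  - by apply: leq_trans (hZ _ _) _; rewrite mdegD !mdeg1.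
split; first by rewrite /poly_degree; move: le; case: mmeasure.
move=> c30; suff : (2 < mmeasure mdeg (bilinear c0 c1 c2 c3))%N.
  by rewrite /poly_degree; move: le; case: mmeasure => [|[|[|[|]]]].
have d2 : mdeg (mnm_add (mnm1 0) (mnm1 1) : multinom 2) = 2%N by rewrite mdegD !mdeg1.
rewrite -[X in (X < _)%N]d2; apply: msize_mdeg_lt.
rewrite mcoeff_msupp /bilinear -mpolyXD !mcoeffD mcoeffC !mcoeffCM !mcoeffX.
have n0 (i : 'I_2) : (mnm1 i == mnm_add (mnm1 0) (mnm1 1) :> multinom 2) = false.
  by apply/negbTE/eqP => /(congr1 (@mdeg 2)); rewrite mdegD !mdeg1.
have n1 : (mnm_add (mnm1 0) (mnm1 1) == @mnm0 2) = false.
  by apply/negbTE/eqP => /(congr1 (@mdeg 2)); rewrite mdeg0 mdegD !mdeg1.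
by rewrite n1 !n0 // eqxx !mulr0 !add0r mulr1.
Qed.
End Bilinear.

(** * The transfer function as a quotient of degree two *)

Section TransferRational.
Variable R : realType.
Local Notation C := R[i].
Variable U : 'M[C]_(1 + (1 + 1)).
Local Notation o1 := (lift 0 0 : 'I_3).
Local Notation o2 := (lift 0 1 : 'I_3).
Local Notation u i j := ((U : 'M[C]_3) i j).

Definition transfer_den : mpoly 2 C :=
  bilinear 1 (- u o1 o1) (- u o2 o2) (u o1 o1 * u o2 o2 - u o1 o2 * u o2 o1).

(** The top coefficient is the determinant of U, which is nonzero for unitary U; hence the degree is
    exactly 2. *)
Definition transfer_num : mpoly 2 C :=
  bilinear (u 0 0) (u 0 o1 * u o1 0 - u 0 0 * u o1 o1)
    (u 0 o2 * u o2 0 - u 0 0 * u o2 o2) (\det U).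

Lemma diag_var_cols m (B : 'M[C]_(m, 1 + 1)) z i : (B *m diag_var 1 1 z) i 0 = B i 0 * z.1 /\
  (B *m diag_var 1 1 z) i 1 = B i 1 * z.2.
Proof.
have DE (k j : 'I_(1 + 1)) : diag_var 1 1 z k j = (if k == 0 then z.1 else z.2) *+ (k == j).
  rewrite /diag_var; case: (split_ordP k) => k' ->; case: (split_ordP j) => j' ->;
    rewrite ?block_mxEul ?block_mxEur ?block_mxEdl ?block_mxEdr ?mxE !ord1 //=.
rewrite !mxE !big_ord_recl !big_ord0 !DE /=.
by rewrite ?mulr1n ?mulr0n ?mulr0 ?addr0 ?add0r; split=> //; congr (B i _ * _); apply: val_inj.
Qed.

Lemma mulmx2E m n (A : 'M[C]_(m, 1 + 1)) (B : 'M[C]_(1 + 1, n)) i j :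
  (A *m B) i j = A i 0 * B 0 j + A i 1 * B 1 j.
Proof.
rewrite mxE !big_ord_recl big_ord0 addr0 (_ : lift ord0 ord0 = 1 :> 'I_(1 + 1)) //.
exact: val_inj.
Qed.

Lemma resolvent_entries z i j : (1%:M - drsubmx U *m diag_var 1 1 z) i j =
  (i == j)%:R - (drsubmx U *m diag_var 1 1 z) i j.
Proof. by rewrite mxE [X in X + _]mxE [X in _ + X]mxE. Qed.

(** The products of equalities are multi-rules: one [rewrite] applies all of them. *)
Lemma transfer_entries : [/\ ulsubmx U 0 0 = u 0 0,
  (ursubmx U 0 0 = u 0 o1) * (ursubmx U 0 1 = u 0 o2),
  (dlsubmx U 0 0 = u o1 0) * (dlsubmx U 1 0 = u o2 0) &
  (drsubmx U 0 0 = u o1 o1) * (drsubmx U 0 1 = u o1 o2) *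
  (drsubmx U 1 0 = u o2 o1) * (drsubmx U 1 1 = u o2 o2)].
Proof. by split; do ?split; rewrite !mxE; congr (U _ _); apply: val_inj. Qed.

Lemma transfer_den_eval z : poly_eval transfer_den z =
  \det (1%:M - drsubmx U *m diag_var 1 1 z).
Proof.
rewrite bilinear_eval (det2 (1%:M - drsubmx U *m diag_var 1 1 z : 'M[C]_2)).
have [_ _ _ e] := transfer_entries.
have E i := diag_var_cols (drsubmx U) z i.
rewrite !resolvent_entries !(E _).1 !(E _).2 !e /=; ring.
Qed.

Lemma transfer_num_eval z : poly_eval transfer_den z != 0 ->
  rat_transfer U z = poly_eval transfer_num z / poly_eval transfer_den z.
Proof.
move=> q0; apply: (mulIf q0); rewrite divfK // /rat_transfer -transfer_den_eval.
rewrite mxE [X in _ + X]mxE mulrDl mulrAC mulVf // mul1r.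
have [e1 e2 e3 e4] := transfer_entries.
have [a00 a01 a10 a11] := adj2 (1%:M - drsubmx U *m diag_var 1 1 z : 'M[C]_2).
have E i := diag_var_cols (drsubmx U) z i.
have F i := diag_var_cols (ursubmx U) z i.
rewrite mulmx2E !(mulmx2E _ (\adj _)) a00 a01 a10 a11 !(F _).1 !(F _).2.
rewrite !resolvent_entries !(E _).1 !(E _).2 !e1 !e2 !e3 !e4 !bilinear_eval det3 /=.
ring.
Qed.

(** A common factor involving the variable k would cancel and leave a quotient independent of that
    variable, contrary to the hypothesis. *)
Lemma transfer_rational : U \is unitarymx ->
  (forall k : 'I_2, ~ forall z z' : C * C, bidisk z -> bidisk z' ->
     (k != 0 -> z.1 = z'.1) -> (k != 1 -> z.2 = z'.2) ->
     rat_transfer U z = rat_transfer U z') ->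
  rational_of_degree (rat_transfer U) 2.
Proof.
move=> Uu h; have den0 z : bidisk z -> poly_eval transfer_den z != 0.
  by move=> hz; rewrite transfer_den_eval -unitfE -unitmxE; exact: transfer_unit.
have detU : \det U != 0 by rewrite -unitfE -unitmxE; exact: unitarymx_unit.
have b0 : bidisk ((0, 0) : C * C) by split; rewrite /= normr0.
have [dn dn2] := bilinear_degree (u 0 0) (u 0 o1 * u o1 0 - u 0 0 * u o1 o1)
    (u 0 o2 * u o2 0 - u 0 0 * u o2 o2) (\det U).
have [dd _] := bilinear_degree 1 (- u o1 o1) (- u o2 o2) (u o1 o1 * u o2 o2 - u o1 o2 * u o2 o1).
exists transfer_num, transfer_den; split.
- apply: poly_coprimeP.
  + by apply/eqP => e; have := dn2 detU; rewrite -/transfer_num e /poly_degree mmeasure0.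
  + apply/eqP => e; have := den0 _ b0; rewrite e /poly_eval meval0 eqxx //.
  + by move=> k; split; exact: bilinear_section.
  move=> k d n v nE vE sn sv; apply: (h k) => z z' hz hz' h0 h1.
  rewrite !transfer_num_eval ?den0 //.
  have dz x : bidisk x -> poly_eval d x != 0.
    by move=> /den0; rewrite vE /poly_eval mevalM mulf_eq0 negb_or => /andP[].
  have Q x : bidisk x -> poly_eval transfer_num x / poly_eval transfer_den x =
      poly_eval n x / poly_eval v x.
    move=> hx; rewrite nE vE /poly_eval !mevalM -mulf_div divff ?mul1r //; exact: dz.
  by rewrite !Q // (section_eval sn h0 h1) (section_eval sv h0 h1).
- by rewrite dn2 //; apply/maxn_idPl.
by move=> z hz; split; [exact: den0|apply: transfer_num_eval; exact: den0].
Qed.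
End TransferRational.

(** * The zeros of the denominator on the torus form a null set *)

Section Measurability.
Variable R : realType.
Local Notation C := R[i].
Local Notation T := (measurableTypeR R * measurableTypeR R)%type.
Local Notation mu := (lebesgue_measure \x lebesgue_measure)%E.
Implicit Types F G : T -> C.

Definition cmeasurable F := measurable_fun setT (fun x => complex.Re (F x)) /\
  measurable_fun setT (fun x => complex.Im (F x)).

Lemma cmeasurable_cst c : cmeasurable (fun=> c).
Proof. by split; exact: measurable_cst. Qed.

Lemma cmeasurableD F G : cmeasurable F -> cmeasurable G -> cmeasurable (fun x => F x + G x).
Proof.
move=> [f1 f2] [g1 g2]; split.
  rewrite (_ : (fun x => _) = (fun x => complex.Re (F x) + complex.Re (G x))).
    exact: measurable_funD.
  by apply/funext => x; case: (F x) (G x) => ? ? [].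
rewrite (_ : (fun x => _) = (fun x => complex.Im (F x) + complex.Im (G x))).
  exact: measurable_funD.
by apply/funext => x; case: (F x) (G x) => ? ? [].
Qed.

Lemma cmeasurableM F G : cmeasurable F -> cmeasurable G -> cmeasurable (fun x => F x * G x).
Proof.
move=> [f1 f2] [g1 g2]; split.
  rewrite (_ : (fun x => _) = (fun x => complex.Re (F x) * complex.Re (G x)
      - complex.Im (F x) * complex.Im (G x))).
    by apply: measurable_funB; apply: measurable_funM.
  by apply/funext => x; case: (F x) (G x) => ? ? [].
rewrite (_ : (fun x => _) = (fun x => complex.Re (F x) * complex.Im (G x)
    + complex.Im (F x) * complex.Re (G x))).
  by apply: measurable_funD; apply: measurable_funM.
by apply/funext => x; case: (F x) (G x) => ? ? [].
Qed.

Lemma cmeasurable_torus (f : T -> measurableTypeR R) : measurable_fun setT f ->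
  cmeasurable (fun x => torus_pt (f x)).
Proof.
move=> mf; split; rewrite /torus_pt /=.
  apply: (measurableT_comp (f := (cos : measurableTypeR R -> measurableTypeR R))) => //.
  by apply: continuous_measurable_fun; exact: continuous_cos.
apply: (measurableT_comp (f := (sin : measurableTypeR R -> measurableTypeR R))) => //.
by apply: continuous_measurable_fun; exact: continuous_sin.
Qed.

Lemma cmeasurable_eq0 F : cmeasurable F -> measurable [set x | F x = 0].
Proof.
move=> [f1 f2]; rewrite (_ : [set x | _] =
  (setT `&` (fun x => complex.Re (F x)) @^-1` [set 0]) `&`
  (setT `&` (fun x => complex.Im (F x)) @^-1` [set 0])).
  by apply: measurableI; [apply: f1|apply: f2].
rewrite !setTI; apply/seteqP; split=> x /=; first by move=> ->.
by case: (F x) => a b /= [-> ->].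
Qed.

Lemma cos_level (c : R) : countable [set s : R | s \in `[0, 2 * pi] /\ cos s = c].
Proof.
apply: (@sub_countable _ _ _ [set acos c; 2 * pi - acos c]); last first.
  exact/finite_set_countable/finite_set2.
apply: subset_card_le => s [] /=; rewrite in_itv /= => /andP[s0 s2] sc.
have [sp|sp] := leP s pi.
  by left; rewrite -sc cosK // in_itv /= s0.
right; have e : cos (2 * pi - s) = c.
  by rewrite mulr_natl addrC cosD2pi cosN.
rewrite /= -e cosK; first by ring.
by rewrite in_itv /= subr_ge0 s2 /=; lra.
Qed.

Lemma torus_level (z : C) :
  countable [set s : R | s \in `[0, 2 * pi] /\ torus_pt s = z].
Proof.
apply: (sub_countable _ (cos_level (complex.Re z))).
by apply: subset_card_le => s [/= hs <-].
Qed.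

(* For a given first coordinate the form is affine in the second one; it is
   constant in the latter and zero for at most one first coordinate. *)
Lemma torus_zeros_null (c1 c2 c3 : C) : mu.-negligible
  [set st : R * R | [/\ st.1 \in `[0, 2 * pi], st.2 \in `[0, 2 * pi] &
    1 + c1 * torus_pt st.1 + c2 * torus_pt st.2 + c3 * (torus_pt st.1 * torus_pt st.2) = 0]].
Proof.
(* The first coordinates at which 1 + c1 [torus_pt s] vanishes; the set is empty for c1 = 0 because
   [torus_pt] is never 0. Elsewhere the equation determines [torus_pt t], so that only countably
   many t remain. *)
pose F := [set s : R | s \in `[0, 2 * pi] /\ torus_pt s = - c1^-1].
have cF : countable F := torus_level _.
have mF : measurable (F : set (measurableTypeR R)).
  exact: countable_measurable.
pose I : set (measurableTypeR R) := [set` `[0, 2 * pi : R]].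
have mI : measurable I by exact: measurable_itv.
pose q (st : T) : C :=
  1 + c1 * torus_pt st.1 + c2 * torus_pt st.2 + c3 * (torus_pt st.1 * torus_pt st.2).
have mq : cmeasurable q.
  have m1 : cmeasurable (fun st : T => torus_pt st.1) by apply: cmeasurable_torus.
  have m2 : cmeasurable (fun st : T => torus_pt st.2) by apply: cmeasurable_torus.
  apply: cmeasurableD.
    apply: cmeasurableD; last by apply: cmeasurableM m2; exact: cmeasurable_cst.
    apply: cmeasurableD; first exact: cmeasurable_cst.
    by apply: cmeasurableM m1; exact: cmeasurable_cst.
  by apply: cmeasurableM; [exact: cmeasurable_cst|exact: cmeasurableM].
pose N1 : set T := F `*` setT.
pose N2 : set T := ([set x | q x = 0] `&` (I `*` I)) `\` N1.
have mN1 : measurable N1 by apply: measurableX.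
have mN2 : measurable N2.
  apply: measurableD => //; apply: measurableI; first exact: cmeasurable_eq0.
  exact: measurableX.
have n1 : mu.-negligible N1.
  apply/negligibleP => //; apply: etrans (product_measure1E _ _ mF measurableT) _.
  by rewrite [X in (X * _)%E](countable_lebesgue_measure0 cF) mul0e.
have n2 : mu.-negligible N2.
  apply/negligibleP => //; apply: integral0_eq => s _ /=.
  apply: countable_lebesgue_measure0.
  have [sF|sF] := pselect (F s).
    apply: (@sub_countable _ _ _ set0); last exact: countable0.
    by apply: subset_card_le => t; rewrite /xsection /= inE => -[_ []].
  have [sI|sI] := pselect (I s); last first.
    apply: (@sub_countable _ _ _ set0); last exact: countable0.
    by apply: subset_card_le => t; rewrite /xsection /= inE => -[[_ []]].
  pose d := c2 + c3 * torus_pt s; pose e := 1 + c1 * torus_pt s.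
  have e0 : e != 0.
    apply/eqP => e0; apply: sF; split=> //.
    have c10 : c1 != 0.
      by apply/eqP => c; move/eqP: e0; rewrite /e c mul0r addr0 oner_eq0.
    apply: (mulfI c10); rewrite mulrN mulfV //; apply/eqP.
    by rewrite -addr_eq0 addrC -/e e0.
  apply: (sub_countable _ (torus_level (- e / d))).
  apply: subset_card_le => t; rewrite /xsection /= inE => -[[/= qt [_ tI]] _]; split=> //.
  have dt : d * torus_pt t = - e.
    by apply/eqP; rewrite -addr_eq0 -qt /q /= /d /e; apply/eqP; ring.
  have d0 : d != 0.
    by apply: contra_neq e0 => d0; apply: oppr_inj; rewrite -dt d0 mul0r oppr0.
  by rewrite -dt mulrAC mulfV // mul1r.
apply: negligibleS (negligibleU n1 n2) => -[s t] [/= hs ht h0].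
have [sF|sF] := pselect (F s); first by left; split.
by right; split; [split=> //|case].
Qed.
End Measurability.

(** * The transfer function is inner *)

Section Inner.
Variable R : realType.
Local Notation C := R[i].
Variable U : 'M[C]_(1 + (1 + 1)).
Hypothesis Uu : U \is unitarymx.

Lemma real_scale_cvg (c : C) : (fun r : R => (r%:C%C * c : C^o)) @ (1 : R) --> (c : C^o).
Proof.
apply/cvgrPdist_lt => e e0.
have eE : e = (complex.Re e)%:C%C by rewrite RRe_real // gtr0_real.
have e0' : 0 < complex.Re e by rewrite -ltr0c -eE.
have h : 0 < complex.Re e / (modulus c + 1).
  by rewrite divr_gt0 // ltr_wpDl ?modulus_ge0.
near=> r; rewrite eE modulusE ltcR -{1}[c]mul1r -mulrBl modulusM.
rewrite -(rmorph1 (real_complex R)) -rmorphB modulus_real.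
have : `|1 - r| < complex.Re e / (modulus c + 1).
  by near: r; apply/nbhs_ballP; exists (complex.Re e / (modulus c + 1)).
rewrite ltr_pdivlMr ?ltr_wpDl ?modulus_ge0 // => /(le_lt_trans _); apply.
by rewrite ler_wpM2l // lerDl.
Unshelve. all: by end_near.
Qed.

Lemma radial_cvg (a b : C) :
  (fun r : R => ((r%:C%C * a, r%:C%C * b) : C^o * C^o)) @ (1 : R) --> ((a, b) : C^o * C^o).
Proof. by apply: (cvg_pair (@real_scale_cvg a) (@real_scale_cvg b)). Qed.

(** At a torus point where the denominator is nonzero the function given by Cramer's rule is
    differentiable, hence continuous. Its radial limit is its value there, which has modulus 1. *)
Lemma transfer_inner : inner_function (rat_transfer U).
Proof.
split; first by have [] := rat_transfer_Hinfty Uu.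
pose u i j := (U : 'M[C]_3) i j; pose o1 := lift 0 0 : 'I_3; pose o2 := lift 0 1 : 'I_3.
apply: negligibleS (torus_zeros_null (- u o1 o1) (- u o2 o2)
  (u o1 o1 * u o2 o2 - u o1 o2 * u o2 o1)) => -[s t] /= h.
have [hs|hs] := boolP (s \in `[0, 2 * pi]); last by exfalso; apply: h => hs'; rewrite hs' in hs.
have [ht|ht] := boolP (t \in `[0, 2 * pi]); last by exfalso; apply: h => _ ht'; rewrite ht' in ht.
split=> //; apply: contrapT => q0; apply: h => _ _.
pose z : C * C := (torus_pt s, torus_pt t).
have det0 : \det (1%:M - drsubmx U *m diag_var 1 1 z) != 0.
  by rewrite -transfer_den_eval bilinear_eval; apply/eqP.
have hu : 1%:M - drsubmx U *m diag_var 1 1 z \in unitmx by rewrite unitmxE unitfE.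
exists (rat_transfer U z); split.
  rewrite (rat_transferE hu) (transfer_torus Uu) //=; apply/eqP.
    by rewrite modulus_eq1 modulus_cis.
  by rewrite modulus_eq1 modulus_cis.
apply: (@cvg_at_left_filter R C^o
  (fun r : R => rat_transfer U (r%:C%C * torus_pt s, r%:C%C * torus_pt t)) 1).
apply: (@cvg_comp _ _ _ (fun r : R => ((r%:C%C * torus_pt s, r%:C%C * torus_pt t) : C^o * C^o))
  (rat_transfer U : C^o * C^o -> C^o) _ (nbhs (z : C^o * C^o))).
  exact: radial_cvg.
exact: differentiable_continuous (rat_transfer_diff det0).
Qed.
End Inner.

(** * Dependence on both variables, and the conclusion *)

Section Final.
Variable R : realType.
Local Notation C := R[i].

(** If phi depends on one coordinate only, it also interpolates at the nodes with that coordinate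
    repeated. There Lambda1 and Lambda2 coincide, and the two members of a permissible pair merge
    into one. *)
Lemma one_variable_degenerate (lam : 'I_3 -> C * C) w phi : (forall i, bidisk (lam i)) ->
  Pick_solution lam w phi ->
  (forall k : 'I_2, (forall z z' : C * C, bidisk z -> bidisk z' ->
     (k != 0 -> z.1 = z'.1) -> (k != 1 -> z.2 = z'.2) -> phi z = phi z') -> degenerate lam w).
Proof.
move=> lamD [h1 h2 h3] k hk.
have [k0|k0] := eqVneq k 0.
  pose lam' i := ((lam i).2, (lam i).2).
  have lamD' i : bidisk (lam' i) by split=> /=; case: (lamD i).
  have [|G [D [pG pD WE]]] := @agler _ _ lam' lamD' w phi.
    by apply: And3 h1 _ h3 => i; rewrite -h2; apply: hk; rewrite // k0 eqxx.
  exists 0, (G + D); split; last by left.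
  by apply: And3 (psd0 _ _) (psdD pG pD) _; rewrite schur0r add0r schurDr.
have k1 : k = 1 by apply: val_inj; case: k k0 {hk} => [[|[|//]] ?].
pose lam' i := ((lam i).1, (lam i).1).
have lamD' i : bidisk (lam' i) by split=> /=; case: (lamD i).
have [|G [D [pG pD WE]]] := @agler _ _ lam' lamD' w phi.
  by apply: And3 h1 _ h3 => i; rewrite -h2; apply: hk; rewrite // k1 eqxx.
exists (G + D), 0; split; last by right.
by apply: And3 (psdD pG pD) (psd0 _ _) _; rewrite schur0r addr0 schurDr.
Qed.
End Final.

Theorem theorem0p1 (R : realType) (lam : 'I_3 -> R[i] * R[i]) (w : 'I_3 -> R[i])
    (hlam : forall i, bidisk (lam i))
    (hext : extremal_nondegenerate lam w) :
  exists phi : R[i] * R[i] -> R[i],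
    [/\ Pick_solution lam w phi,
        (forall psi, Pick_solution lam w psi ->
           forall z, bidisk z -> psi z = phi z),
        inner_function phi,
        rational_of_degree phi 2
      & exists G D : 'M[R[i]]_3,
          [/\ permissible lam w G D,
              (forall G' D', permissible lam w G' D' -> G' = G /\ D' = D),
              \rank G = 1%N, \rank D = 1%N
            & given_by lam w G D phi]].
Proof.
case: hext => psi0 [ext ext2 nondeg]; have [sol0 _ _] := ext.
have inj := extremal_distinct ext ext2.
have [K act] := extremal_active hlam ext ext2.
have [G [D perm]] := agler hlam sol0.
have [rG rD] := permissible_ranks hlam act nondeg perm.
have [pG pD _] := perm.
have [a aE] := psd_rank1 pG (eq_leq rG); have [b bE] := psd_rank1 pD (eq_leq rD).
have colU a' b' : G = a' ^t* *m a' -> D = b' ^t* *m b' -> exists U, colligation lam w a' b' U.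
  by move=> GE DE; apply: colligation_exists; rewrite -GE -DE.
have transferE := solution_transfer hlam inj act nondeg perm.
have [U col] := colU a b aE bE; have [Uu _] := col.
have uniq psi z : Pick_solution lam w psi -> bidisk z -> psi z = rat_transfer U z.
  move=> sol hz; rewrite (transferE a b U psi z aE bE col sol hz).
  by rewrite (rat_transferE (transfer_unit Uu hz)).
(* The interpolation conditions come from the given solution [psi0], which by [uniq] agrees with the
   transfer function at the nodes. *)
have sol : Pick_solution lam w (rat_transfer U).
  have [h1 h2] := rat_transfer_Hinfty Uu.
  by apply: And3 h1 _ h2 => i; rewrite -(uniq psi0 _ sol0 (hlam i)); case: sol0.
exists (rat_transfer U); split.
- exact: sol.
- by move=> psi hpsi z; exact: uniq.
- exact: transfer_inner.
- apply: transfer_rational => // k hk; apply: nondeg.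
  by apply: (one_variable_degenerate hlam sol); exact: hk.
exists G, D; split.
- exact: perm.
- by move=> G' D' perm'; apply: (permissible_unique hlam act nondeg perm perm').
- exact: rG.
- exact: rD.
split; first by exists a, b.
move=> a' b' GE DE; split; first exact: colU.
by move=> U' col' z hz; exact: (transferE a' b' U' _ z GE DE col' sol hz).
Qed.
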